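(* Let $(M,Q)$ be a connected quaternionic manifold of dimension $4n\geq 8$ with twistor space $\pi:Z\to M$ and tangent vertical bundle $\Theta\to Z$. Let $D$ be a quaternionic connection on $(M,Q)$ and let $\nabla:=\Pi\circ\pi^*D$ be the connection on $\Theta$ induced by $D$. Then $\nabla$ is a Chern connection of $\Theta$ if and only if $D$ is self-dual.
   Context: A quaternionic structure on a manifold $M$ of dimension $4n\ge 8$ is a rank-3 subbundle $Q\subset\mathrm{End}(TM)$, locally generated by almost complex structures $J_1,J_2,J_3$ satisfying the quaternionic relations (an admissible basis), which is preserved by some torsion-free linear connection on $M$; any torsion-free linear connection preserving $Q$ is called a quaternionic connection. $Q$ carries the Euclidean metric $\langle\cdot,\cdot\rangle$ for which admissible bases are orthonormal; a quaternionic connection $D$ acts on $Q$ by $D_XA=[D_X,A]$ and preserves $\langle\cdot,\cdot\rangle$. A $2$-form $\omega$ on $M$ is $Q$-hermitian if $\omega(JX,JY)=\omega(X,Y)$ for all $J\in Q$ with $J^2=-\mathrm{Id}$. $D$ is self-dual if the curvature of the connection induced by $D$ on $\Lambda^{4n}(T^*M)$ is $Q$-hermitian. The twistor space $Z$ is the unit sphere bundle of $Q$, with projection $\pi:Z\to M$ and fibers $Z_p=\pi^{-1}(p)$. For $J\in Z_p$, $T_JZ_p=J^\perp\subset Q_p$. A quaternionic connection gives a splitting of $T_JZ$ into $T_JZ_p$ and a horizontal space $\mathrm{Hor}_J\cong T_pM$ (via $\pi_*$). The (integrable) complex structure $\mathcal J$ of $Z$ is $A\mapsto J\circ A$ on $T_JZ_p$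 and $J$ on $\mathrm{Hor}_J\cong T_pM$; it does not depend on the choice of quaternionic connection. $\Theta\to Z$ is the complex line bundle with fiber $\Theta_J=T_JZ_p=J^\perp\subset Q_p$, $p=\pi(J)$, complex structure of the fibers $\mathcal J(A)=J\circ A$, and hermitian metric $h(X,Y)=\frac12(\langle X,Y\rangle-i\langle\mathcal JX,Y\rangle)$. $\Pi:\pi^*Q\to\Theta$ is the orthogonal projection, $\Pi_J(A)=A-\langle A,J\rangle J$. The connection $\nabla=\Pi\circ\pi^*D$ is hermitian and $\mathbb C$-linear. A Chern connection of $\Theta$ is a hermitian connection whose curvature is $\mathcal J$-invariant: $R^\nabla_{\mathcal JU,\mathcal JV}=R^\nabla_{U,V}$ for all $U,V\in TZ$. *)

(* Defs.v *)
From HB Require Import structures.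
From mathcomp Require Import all_boot all_order all_algebra.
From mathcomp Require Import all_classical all_reals all_analysis.
From mathcomp Require Import complex.

Set Implicit Arguments.
Unset Strict Implicit.
Unset Printing Implicit Defensive.

Import Order.TTheory GRing.Theory Num.Theory.
Import numFieldNormedType.Exports.

Local Open Scope classical_set_scope.
Local Open Scope ring_scope.

(* Description operator: an element satisfying P if there is one, x0 otherwise.
   (xget needs a choiceType; here T is often a dependent function type.)       *)
Definition the (T : Type) (x0 : T) (P : set T) : T :=
  if pselect (exists x, P x) is left e then projT1 (cid e) else x0.

Section SmoothMaps.
Variables (R : realType) (k : nat) (V : normedModType R).

Definition iter_derive (f : 'rV[R]_k -> V) (s : seq 'rV[R]_k) : 'rV[R]_k -> V :=
  foldr (fun w g u => 'D_w g u) f s.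

(* f is C^oo on a neighbourhood of u: all its iterated directional derivatives
   are Frechet differentiable there. *)
Definition smooth_at (f : 'rV[R]_k -> V) (u : 'rV[R]_k) : Prop :=
  \forall u' \near u, forall s, differentiable (iter_derive f s) u'.

End SmoothMaps.

(* Smoothness and locality are expressed through charts only, so that the
   notions below apply both to a manifold with a given topology and to a bare
   set with an atlas, such as the twistor space.                               *)

Record chart (R : realType) (X : Type) (k : nat) := Chart {
  cdom : set X;
  cmap :> X -> 'rV[R]_k }.

Section Atlas.
Variables (R : realType) (X : Type) (k : nat) (A : set (chart R X k)).
Implicit Types (x y : X) (c : chart R X k).

Definition chart_at x c : Prop := A c /\ cdom c x.

(* The inverse of c : cdom c -> c @` cdom c, with value x off the image. *)
Definition cinv c x (u : 'rV[R]_k) : X := the x [set y | cdom c y /\ c y = u].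

Definition near_pt x (P : set X) : Prop :=
  forall c, chart_at x c -> \forall u \near c x, P (cinv c x u).

Definition smooth_fun (f : X -> R) x : Prop :=
  forall c, chart_at x c -> smooth_at (fun u => f (cinv c x u) : R^o) (c x).

Definition transition c c' x : 'rV[R]_k -> 'rV[R]_k := fun u => c' (cinv c x u).

(* A tangent vector at x is the family of its coordinate vectors in the charts
   around x, related by the Jacobians of the transition maps (and 0, by
   convention, on the other charts).                                           *)
Definition tangent_family x : {pred chart R X k -> 'rV[R]_k} :=
  fun v => `[< (forall c, ~ chart_at x c -> v c = 0) /\
    (forall c c', chart_at x c -> chart_at x c' ->
       v c' = 'd (transition c c' x) (c x) (v c)) >].

Fact tangent_family_submod x : submod_closed (tangent_family x).
Proof.
split; first by apply/asboolP; split=> // c c' _ _; rewrite /= linear0.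
move=> a u v /asboolP[u0 uJ] /asboolP[v0 vJ]; apply/asboolP; split=> [c cx|c c' cx cx'].
  by rewrite !fctE u0 // v0 // scaler0 addr0.
by rewrite !fctE (uJ c c') // (vJ c c') // linearP.
Qed.
HB.instance Definition _ x :=
  GRing.isSubmodClosed.Build R (chart R X k -> 'rV[R]_k) (tangent_family x)
    (tangent_family_submod x).

Record tangent x := Tangent {
  coords :> chart R X k -> 'rV[R]_k;
  _ : coords \in tangent_family x }.

HB.instance Definition _ x := [isSub for @coords x].
HB.instance Definition _ x := [Choice of tangent x by <:].
HB.instance Definition _ x := [SubChoice_isSubLmodule of tangent x by <:].

Definition vfield := forall x, tangent x.

Definition smooth_vfield (U : vfield) x : Prop :=
  forall c, chart_at x c -> smooth_at (fun u => U (cinv c x u) c) (c x).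

(* v.f, the derivative of f along v. *)
Definition dird x (v : tangent x) (f : X -> R) : R :=
  the 0 [set r | exists2 c, chart_at x c &
                 r = 'd (fun u => f (cinv c x u) : R^o) (c x) (v c)].

Definition lie_bracket (U V : vfield) : vfield := fun x =>
  the 0 [set w : tangent x | forall f, smooth_fun f x ->
    dird w f = dird (U x) (fun y => dird (V y) f)
             - dird (V x) (fun y => dird (U y) f)].

Definition extension x (v : tangent x) : vfield :=
  the (fun=> 0) [set U | smooth_vfield U x /\ U x = v].

(* A vector bundle over X is given by a family E of vector spaces together with
   the relation Sec s x: "s is, on a neighbourhood of x, a smooth section".  For
   a subbundle, E is the ambient family and Sec s x also says that s takes its
   values in the subbundle near x.  A connection acts on locally defined
   sections, i.e. on their germs.                                              *)
Section Connections.
Variables (E : X -> lmodType R) (Sec : (forall x, E x) -> X -> Prop).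

Definition is_connection
    (D : forall x, tangent x -> (forall y, E y) -> E x) : Prop :=
  [/\ forall x s, Sec s x -> forall a (v w : tangent x),
        D x (a *: v + w) s = a *: D x v s + D x w s,
      forall x s t, Sec s x -> Sec t x -> forall v : tangent x,
        D x v (fun y => s y + t y) = D x v s + D x v t,
      forall x f s, smooth_fun f x -> Sec s x -> forall v : tangent x,
        D x v (fun y => f y *: s y) = dird v f *: s x + f x *: D x v s,
      forall x s t, Sec s x -> Sec t x -> near_pt x (fun y => s y = t y) ->
        forall v : tangent x, D x v s = D x v t
    & forall x U s, smooth_vfield U x -> Sec s x ->
        Sec (fun y => D y (U y) s) x].

Definition curvature (D : forall x, tangent x -> (forall y, E y) -> E x)
    (U V : vfield) (s : forall y, E y) : forall x, E x := fun x =>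
  D x (U x) (fun y => D y (V y) s) - D x (V x) (fun y => D y (U y) s)
  - D x (lie_bracket U V x) s.

End Connections.

End Atlas.

Arguments chart_at {R X k}.
Arguments near_pt {R X k}.
Arguments smooth_fun {R X k}.
Arguments smooth_vfield {R X k}.
Arguments vfield {R X k}.
Arguments lie_bracket {R X k}.

(* w = F_* v, for v tangent at x and w tangent at y = F x. *)
Definition is_push (R : realType) (X Y : Type) (k l : nat)
    (A : set (chart R X k)) (B : set (chart R Y l)) (F : X -> Y)
    (x : X) (y : Y) (v : tangent A x) (w : tangent B y) : Prop :=
  forall c c', chart_at A x c -> chart_at B y c' ->
    w c' = 'd (fun u => c' (F (cinv c x u))) (c x) (v c).

Definition smooth_manifold (R : realType) (M : topologicalType) (m : nat)
    (A : set (chart R M m)) : Prop :=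
  [/\ hausdorff_space M /\ @second_countable M,
      forall p, exists c, chart_at A p c,
      forall c, A c ->
        [/\ open (cdom c), {in cdom c &, injective c},
            {in cdom c, continuous c}
          & forall W, open W -> W `<=` cdom c -> open (c @` W)]
    & forall p c c', chart_at A p c -> chart_at A p c' ->
        smooth_at (transition c c' p) (c p)].

Section Quaternionic.
Variables (R : realType) (M : topologicalType) (m : nat).
Variables (A : set (chart R M m)).
Notation T := (tangent A).
Variable (Q : forall p : M, set (T p -> T p)).
Arguments Q : clear implicits.

Definition smooth_endo (B : forall p, T p -> T p) (p : M) : Prop :=
  forall Y, smooth_vfield A Y p -> smooth_vfield A (fun q => B q (Y q)) p.

Definition quaternion_triple p (J : 'I_3 -> T p -> T p) : Prop :=
  let I1 := J ord0 in let I2 := J 1 in let I3 := J ord_max in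
  [/\ forall i, linear (J i),
      forall i x, J i (J i x) = - x,
      forall x, I1 (I2 x) = I3 x
    & forall x, I2 (I1 x) = - I3 x].

Definition lincomb p (J : 'I_3 -> T p -> T p) (a : 'I_3 -> R) : T p -> T p :=
  fun x => \sum_i a i *: J i x.

Definition admissible_basis p (J : 'I_3 -> T p -> T p) : Prop :=
  quaternion_triple J /\ (forall B, Q p B <-> exists a, B = lincomb J a).

Definition admissible_frame (W : set M)
    (F : 'I_3 -> forall p, T p -> T p) : Prop :=
  open W /\ forall p, W p ->
    admissible_basis (fun i => F i p) /\ forall i, smooth_endo (F i) p.

(* The metric of Q_p for which the admissible bases are orthonormal. *)
Definition qdot p (B C : T p -> T p) : R :=
  the 0 [set r | exists J b c, [/\ admissible_basis J, B = lincomb J b,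
                                C = lincomb J c & r = \sum_i b i * c i]].

Definition affine_connection := forall p, T p -> vfield A -> T p.

(* (D_v B) y = [D_v, B] y, for any extension of y to a local vector field. *)
Definition endo_conn (D : affine_connection) p (v : T p)
    (B : forall q, T q -> T q) : T p -> T p :=
  fun y => D p v (fun q => B q (extension y q)) - B p (D p v (extension y)).

Definition torsion_free (D : affine_connection) : Prop :=
  forall p U V, smooth_vfield A U p -> smooth_vfield A V p ->
    D p (U p) V - D p (V p) U = lie_bracket A U V p.

Definition preserves_Q (D : affine_connection) : Prop :=
  forall p (v : T p) B, smooth_endo B p -> near_pt A p (fun q => Q q (B q)) ->
    Q p (endo_conn D v B).

Definition quaternionic_connection (D : affine_connection) : Prop :=
  [/\ is_connection (E := fun p => T p) (smooth_vfield A) D,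
      torsion_free D & preserves_Q D].

Definition quaternionic_structure : Prop :=
  (forall p, exists W F, W p /\ admissible_frame W F) /\
  exists D, quaternionic_connection D.

Definition Q_hermitian (w : forall p, T p -> T p -> R) : Prop :=
  forall p J, Q p J -> (forall x, J (J x) = - x) ->
    forall x y, w p (J x) (J y) = w p x y.

Definition topform := forall p, ('I_m -> T p) -> R^o.

Definition subst_arg p (y : 'I_m -> T p) (i : 'I_m) (x : T p) : 'I_m -> T p :=
  fun j => if j == i then x else y j.

Definition alternating p (w : ('I_m -> T p) -> R^o) : Prop :=
  (forall y i, linear (fun x => w (subst_arg y i x))) /\
  (forall y i j, i != j -> y i = y j -> w y = 0).

Definition smooth_topform (w : topform) p : Prop :=
  near_pt A p (fun q => alternating (w q)) /\
  forall Y : 'I_m -> vfield A, (forall i, smooth_vfield A (Y i) p) ->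
    smooth_fun A (fun q => w q (fun i => Y i q)) p.

(* (D_v w)(y_1, ..., y_m) = v.(w(Y_1, ..., Y_m)) - \sum_i w(.., D_v Y_i, ..)
   for local extensions Y_i of the y_i.                                        *)
Definition topform_conn (D : affine_connection) p (v : T p) (w : topform) :
    ('I_m -> T p) -> R^o := fun y =>
  dird v (fun q => w q (fun i => extension (y i) q))
  - \sum_i w p (subst_arg y i (D p v (extension (y i)))).

(* The top-degree forms are the sections of a real line bundle: the curvature
   endomorphism at (x, y) is a real number. *)
Definition topform_curv (D : affine_connection) p (x y : T p) : R :=
  the 0 [set r | forall U V w,
    smooth_vfield A U p -> smooth_vfield A V p -> smooth_topform w p ->
    U p = x -> V p = y ->
    curvature (E := fun q => ('I_m -> T q) -> R^o) (topform_conn D) U V w p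
      = r *: w p].

Definition self_dual (D : affine_connection) : Prop :=
  Q_hermitian (topform_curv D).

Record twistor := Twistor {
  tpr : M;
  tJ : T tpr -> T tpr;
  _ : Q tpr tJ;
  _ : qdot tJ tJ = 1 }.

(* The point (p, B) of the twistor space, and z0 if B is not a unit vector of
   Q_p.                                                                        *)
Definition mk_twistor (z0 : twistor) p (B : T p -> T p) : twistor :=
  the z0 [set z | exists (hQ : Q p B) (h1 : qdot B B = 1), z = Twistor hQ h1].

(* Chart of Z given by a chart c of M and a local admissible frame F: with
   J = \sum_i a_i F_i, the fibre coordinates are those of the stereographic
   projection of (a_0, a_1, a_2) from (-1, 0, 0).                              *)
Definition twistor_chart (c : chart R M m) (W : set M)
    (F : 'I_3 -> forall p, T p -> T p) : chart R twistor (m + 2) :=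
  let a i (z : twistor) := qdot (F i (tpr z)) (@tJ z) in
  Chart [set z | [/\ cdom c (tpr z), W (tpr z) & a ord0 z != -1]]
    (fun z => row_mx (c (tpr z))
                (\row_(i < 2) (a (lift ord0 i) z / (1 + a ord0 z)))).

Definition twistor_atlas : set (chart R twistor (m + 2)) :=
  [set C | exists c W F, [/\ A c, admissible_frame W F
                           & C = twistor_chart c W F]].
Notation TZ := (tangent twistor_atlas).

(* The fibre Theta_J = J^perp in Q_p, identified with T_J Z_p. *)
Definition Theta (z : twistor) : set (T (tpr z) -> T (tpr z)) :=
  [set B | Q (tpr z) B /\ qdot B (@tJ z) = 0].
Arguments Theta : clear implicits.

Definition pi_push (z : twistor) (v : TZ z) : T (tpr z) :=
  the 0 [set w | is_push tpr v w].

(* The vertical vector corresponding to B in J^perp: velocity at t = 0 of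
   t |-> (J + t B) / |J + t B|.                                                *)
Definition vert (z : twistor) (B : T (tpr z) -> T (tpr z)) : TZ z :=
  let curve (t : R) := let C : T (tpr z) -> T (tpr z) := @tJ z + t *: B in
    mk_twistor z ((Num.sqrt (qdot C C))^-1 *: C) in
  the 0 [set w : TZ z | forall C, chart_at twistor_atlas z C ->
    is_derive (0 : R^o) (1 : R^o) (fun t => C (curve t)) (w C)].
Arguments vert : clear implicits.

(* The horizontal lift of x in T_p M at J: the image of x by the differential
   of a local section B of Z with B_p = J and D_x B = 0.                       *)
Definition hor (D : affine_connection) (z : twistor) (x : T (tpr z)) : TZ z :=
  the 0 [set w : TZ z | exists B : forall q, T q -> T q,
    [/\ smooth_endo B (tpr z),
        near_pt A (tpr z) (fun q => Q q (B q) /\ qdot (B q) (B q) = 1),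
        B (tpr z) = @tJ z, endo_conn D x B = 0
      & is_push (fun q => mk_twistor z (B q)) x w]].
Arguments hor : clear implicits.

(* The complex structure of Z is independent of the quaternionic connection D
   used for the splitting of TZ. *)
Definition twistor_J (D : affine_connection) (z : twistor) (v : TZ z) : TZ z :=
  the 0 [set w : TZ z | exists B x,
    [/\ Theta z B, v = vert z B + hor D z x
      & w = vert z (@tJ z \o B) + hor D z (@tJ z x)]].

Definition endo_at (z : twistor) : lmodType R := T (tpr z) -> T (tpr z).
Definition pullback_section := forall z, endo_at z.

Definition smooth_pullbackQ (s : pullback_section) (z : twistor) : Prop :=
  near_pt twistor_atlas z (fun z' => Q (tpr z') (s z')) /\
  forall W F, W (tpr z) -> admissible_frame W F -> forall i,
    smooth_fun twistor_atlas (fun z' => qdot (F i (tpr z')) (s z')) z.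

Definition smooth_Theta (s : pullback_section) (z : twistor) : Prop :=
  near_pt twistor_atlas z (fun z' => Theta z' (s z')) /\ smooth_pullbackQ s z.

(* pi^* D: for s = \sum_i f_i (F_i o pi) with F a local admissible frame of Q,
   (pi^* D)_v s = \sum_i (v.f_i) F_i + f_i D_(pi_* v) F_i.                     *)
Definition pullback_conn (D : affine_connection) (z : twistor) (v : TZ z)
    (s : pullback_section) : endo_at z :=
  the 0 [set B : endo_at z | exists W F,
    [/\ W (tpr z), admissible_frame W F
      & let f i z' := qdot (F i (tpr z')) (s z') in
        B = \sum_i (dird v (f i) *: (F i (tpr z) : endo_at z)
                    + f i z *: (endo_conn D (pi_push v) (F i) : endo_at z))]].

Definition Pi (z : twistor) (B : endo_at z) : endo_at z :=
  B - qdot B (@tJ z) *: (@tJ z : endo_at z).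

Definition Theta_conn (D : affine_connection) (z : twistor) (v : TZ z)
    (s : pullback_section) : endo_at z :=
  Pi (pullback_conn D v s).

Definition Theta_h (z : twistor) (B C : endo_at z) : R[i] :=
  Complex (qdot B C / 2) (- (qdot (@tJ z \o B) C / 2)).

Definition hermitian_connection
    (N : forall z, TZ z -> pullback_section -> endo_at z) : Prop :=
  [/\ is_connection (E := endo_at) smooth_Theta N,
      forall z s, smooth_Theta s z -> forall v : TZ z,
        N z v (fun z' => @tJ z' \o s z') = @tJ z \o N z v s
    & forall z s t, smooth_Theta s z -> smooth_Theta t z -> forall v : TZ z,
        Complex (dird v (fun z' => complex.Re (Theta_h (s z') (t z'))))
                (dird v (fun z' => complex.Im (Theta_h (s z') (t z'))))
        = Theta_h (N z v s) (t z) + Theta_h (s z) (N z v t)].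

(* JZ is the complex structure of Z. *)
Definition chern_connection (JZ : forall z, TZ z -> TZ z)
    (N : forall z, TZ z -> pullback_section -> endo_at z) : Prop :=
  hermitian_connection N /\
  forall z U V s, smooth_vfield twistor_atlas U z ->
    smooth_vfield twistor_atlas V z -> smooth_Theta s z ->
    curvature (E := endo_at) N (fun z' => JZ z' (U z')) (fun z' => JZ z' (V z'))
      s z
    = curvature (E := endo_at) N U V s z.

End Quaternionic.

Arguments twistor_J {R M m A} Q D.
Arguments Theta_conn {R M m A} Q D.
Arguments chern_connection {R M m A} Q JZ N.

(* Main.v *)
(* Let tau be the tautological section of pi^*Q, D the pulled back connection and
   pi_* the differential of the projection.  A tangent vector v of Z is determined
   by pi_* v and D_v tau, and the complex structure of Z is J on both components.
   Since nabla_v s = D_v s + <s, D_v tau> tau, the curvature of nabla is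
     Pi [r(pi_* U, pi_* V), s] + <s, D_V tau> D_U tau - <s, D_U tau> D_V tau,
   r being the curvature of D on TM.  The last two terms are J-invariant because
   the fibres have real dimension 2, and in an admissible basis J, J_2, J_3 the
   first one is k_32(pi_* U, pi_* V) J s, where [r, J_j] = sum_i k_ij J_i.  So nabla is
   a Chern connection if and only if k_32 is J-invariant for all J in Z.

   Taking traces of [r(x, y), J_j] and using the Bianchi identity expresses the
   k_ij through the Ricci tensor; for n >= 2 this gives that k_32 is J-invariant if
   and only if the skew part of the Ricci tensor, that is tr r(x, y), is.  Finally
   the curvature of D on the top-degree forms is - tr r. *)
Require Import Defs.
From HB Require Import structures.
From mathcomp Require Import all_boot all_order all_algebra.
From mathcomp Require Import all_classical all_reals all_analysis.
From mathcomp Require Import all_fingroup complex ring lra.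

Set Implicit Arguments.
Unset Strict Implicit.
Unset Printing Implicit Defensive.

Import Order.TTheory GRing.Theory Num.Theory.
Import numFieldNormedType.Exports.

Local Open Scope classical_set_scope.
Local Open Scope ring_scope.

(** The condition n >= 2 comes from an elimination. With h = m / 2 = 2n and
    [S x y = Ric x y - Ric y x], the traces of [r, J_j] give three relations that couple k_21, k_20,
    k_10 (indices 0, 1, 2, with J = J_0) through arguments rotated by the J_i. Eliminating two of
    them leaves (h^2 - 4) (k_21(x, y) - k_21(J x, J y)) = (h - 2) (S(J x, y) + S(x, J y)), and only
    h - 2 = 2n - 2 can vanish. What shapes the development is that the metric of Q, brackets, lifts,
    the complex structure of Z and the curvature of top-degree forms are all description operators:
    each must be shown to exist and not to depend on charts, frames or extensions before it can be
    computed. The twistor space has no topology, so its calculus goes through charts alone. Two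
    devices keep the computations finite. On M, curvature is evaluated on fields with constant
    coordinates in a chart, whose brackets vanish. On Z, near a given J, the local frame is rotated
    so that its first vector at the base point is J; there the tautological section has coefficients
    (1, 0, 0) and the first coefficient has zero derivative. *)

Section Description.

Lemma the_spec (T : Type) (x0 : T) (P : set T) : (exists x, P x) -> P (the x0 P).
Proof. by move=> e; rewrite /the; case: pselect => // e'; exact: projT2 (cid e'). Qed.

Lemma the_eq (T : Type) (x0 : T) (P : set T) x :
  P x -> (forall y, P y -> y = x) -> the x0 P = x.
Proof. by move=> Px Pu; apply: Pu; apply: the_spec; exists x. Qed.

End Description.

(** * Smooth functions on open subsets of row vectors *)

Section Calculus.
Variables (R : realType).

(** [differentiable] speaks of the chosen differential ['d f u]; by uniqueness of the differential,
    any continuous linear map satisfying the first-order estimate is that one. *)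
Lemma is_diff_epsP (V W : normedModType R) (f : V -> W) (df : {linear V -> W}) u :
  continuous df ->
  (forall e, 0 < e -> \forall h \near 0, `|f (h + u) - f u - df h| <= e * `|h|) ->
  differentiable f u.
Proof.
move=> dfc H.
have E : f \o shift u = cst (f u) + df +o_ 0 id.
  apply/eqaddoP => e e0; apply: filterS (H e e0) => h.
  by rewrite !fctE /= opprD addrA.
have dE := diff_unique dfc E.
by apply/diff_locallyP; rewrite dE; split.
Qed.

Lemma differentiable_eps (V W : normedModType R) (f : V -> W) u :
  differentiable f u -> forall e, 0 < e ->
  \forall h \near 0, `|f (h + u) - f u - 'd f u h| <= e * `|h|.
Proof.
move=> /diff_locallyP[_ /eqaddoP H] e e0; apply: filterS (H e e0) => h.
by rewrite !fctE /= opprD addrA.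
Qed.

Lemma near_eq_differentiable (V W : normedModType R) (f g : V -> W) u :
  (\forall x \near u, f x = g x) -> differentiable f u -> differentiable g u.
Proof.
move=> fg df; have dfc := diff_continuous df.
apply: (is_diff_epsP dfc) => e e0.
have fg' : \forall h \near 0, f (h + u) = g (h + u).
  by have := fg; rewrite (near_shift 0) /= => H; apply: filterS H => h; rewrite /= subr0.
apply: filterS2 fg' (differentiable_eps df e0) => h <-.
by rewrite -(nbhs_singleton fg).
Qed.

Lemma differentiable_rV (V : normedModType R) l (g : V -> 'rV[R]_l) u :
  (forall i, differentiable (fun x => g x 0 i : R^o) u) -> differentiable g u.
Proof.
move=> dg.
have -> : g = \sum_i (fun x => g x 0 i *: delta_mx 0 i).
  apply/funext => x; rewrite fct_sumE {1}(matrix_sum_delta (g x)) big_ord1.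
  by [].
by apply: differentiable_sum => i; apply: differentiableZl.
Qed.

Lemma derive_coord (V : normedModType R) l (g : V -> 'rV[R]_l) u w i :
  differentiable g u -> 'D_w g u 0 i = 'D_w (fun x => g x 0 i : R^o) u.
Proof. by move=> dg; rewrite derive_mx ?mxE//; exact: diff_derivable. Qed.

Lemma differentiable_coord_rV (V : normedModType R) l (g : V -> 'rV[R]_l) u i :
  differentiable g u -> differentiable (fun x => g x 0 i : R^o) u.
Proof.
move=> dg; apply: (differentiable_comp (g := fun M : 'rV[R]_l => M 0 i : R^o) dg).
exact: differentiable_coord.
Qed.

Lemma derive_comp_rV (V W : normedModType R) l (g : V -> 'rV[R]_l) (h : 'rV[R]_l -> W) u w :
  differentiable g u -> differentiable h (g u) ->
  'D_w (h \o g) u = \sum_i 'D_w (fun x => g x 0 i : R^o) u *: 'D_(delta_mx 0 i) h (g u).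
Proof.
move=> dg dh; rewrite deriveE; last exact: differentiable_comp.
rewrite diff_comp //= -(deriveE _ dg) [X in 'd h _ X = _](matrix_sum_delta ('D_w g u)) big_ord1.
rewrite linear_sum; apply: eq_bigr => i _.
by rewrite linearZ -[in LHS](deriveE _ dh) derive_coord.
Qed.

Section Smooth.
Variable k : nat.
Local Notation E := 'rV[R]_k.

(** In [smooth_at] the neighbourhood is chosen before the list of directions, so one open set serves
    all iterated derivatives; with that set fixed, induction on the list is possible. *)
Definition smooth_on (V : normedModType R) (O : set E) (f : E -> V) :=
  forall s u, O u -> differentiable (iter_derive f s) u.

Lemma smooth_atP (V : normedModType R) (f : E -> V) u :
  smooth_at f u <-> exists O, [/\ open O, O u & smooth_on O f].
Proof.
rewrite /smooth_at; split.
  rewrite /prop_near1 nbhsE; move=> [B [oB Bu] H]; exists B; split => // s u' Bu'.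
  exact: H.
move=> [B [oB Bu H]]; rewrite /prop_near1 nbhsE; exists B => // u' /= Bu' s.
exact: H.
Qed.

Lemma iter_derive_rcons (V : normedModType R) (f : E -> V) s w :
  iter_derive f (rcons s w) = iter_derive (fun u => 'D_w f u) s.
Proof. by rewrite /iter_derive foldr_rcons. Qed.

Lemma open_near (O : set E) (P : E -> Prop) u :
  open O -> O u -> (forall x, O x -> P x) -> \forall x \near u, P x.
Proof. by move=> oO Ou H; apply: filterS H _; exact: open_nbhs_nbhs. Qed.

Lemma iter_derive_eq_on (V : normedModType R) (O : set E) (f g : E -> V) s :
  open O -> (forall u, O u -> f u = g u) ->
  forall u, O u -> iter_derive f s u = iter_derive g s u.
Proof.
move=> oO fg; elim: s => [|w s IH] u Ou /=; first exact: fg.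
by apply: near_eq_derive; apply: open_near Ou IH.
Qed.

Lemma eq_smooth_on (V : normedModType R) (O : set E) (f g : E -> V) :
  open O -> (forall u, O u -> f u = g u) -> smooth_on O f -> smooth_on O g.
Proof.
move=> oO fg sf s u Ou; apply: near_eq_differentiable (sf s u Ou).
by apply: (open_near oO Ou) => x; exact: iter_derive_eq_on.
Qed.

(** [iter_derive] applies the last direction of the list first, so [last_ind] peels off the
    innermost derivative. It agrees on [O] with a member of [P], to which the induction hypothesis
    applies; smoothness thus reduces to a single derivative. *)
Lemma smooth_on_coind (V : normedModType R) (O : set E) (P : (E -> V) -> Prop) :
  open O ->
  (forall f u, P f -> O u -> differentiable f u) ->
  (forall f w, P f -> exists2 g, P g & forall u, O u -> 'D_w f u = g u) ->
  forall f, P f -> smooth_on O f.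
Proof.
move=> oO Pd PD f Pf s; elim/last_ind: s f Pf => [|s w IH] f Pf u Ou.
  exact: Pd.
rewrite iter_derive_rcons; have [g Pg fg] := PD _ w Pf.
apply: near_eq_differentiable (IH _ Pg u Ou).
by apply: (open_near oO Ou) => x Ox; apply/esym; exact: iter_derive_eq_on Ox.
Qed.

Lemma smooth_on_derive (V : normedModType R) (O : set E) (f : E -> V) w :
  smooth_on O f -> smooth_on O (fun u => 'D_w f u).
Proof. by move=> sf s u Ou; rewrite -iter_derive_rcons; apply: sf. Qed.

Lemma smooth_on_diff (V : normedModType R) (O : set E) (f : E -> V) u :
  smooth_on O f -> O u -> differentiable f u.
Proof. by move=> sf; exact: (sf [::]). Qed.

Lemma smooth_on_cst (V : normedModType R) (O : set E) (a : V) :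
  open O -> smooth_on O (fun=> a).
Proof.
move=> oO; apply: (@smooth_on_coind _ _ (fun f => exists a, f = cst a)) => //.
- by move=> f u [b ->] _; exact: differentiable_cst.
- move=> f w [b ->]; exists (cst 0); first by exists 0.
  by move=> u _; rewrite derive_cst.
- by exists a.
Qed.

(* Closing the smooth functions under the ring operations and composition
   yields a class stable under directional derivatives, hence again a class
   of smooth functions. *)
Inductive smooth_gen (O : set E) : (E -> R^o) -> Prop :=
| smooth_gen_base f : smooth_on O f -> smooth_gen O f
| smooth_gen_add f g : smooth_gen O f -> smooth_gen O g ->
    smooth_gen O (fun u => f u + g u)
| smooth_gen_mul f g : smooth_gen O f -> smooth_gen O g ->
    smooth_gen O (fun u => f u * g u)
| smooth_gen_inv f : smooth_gen O f -> (forall u, O u -> f u != 0) ->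
    smooth_gen O (fun u => (f u)^-1)
| smooth_gen_comp l (O' : set 'rV[R]_l) (h : 'rV[R]_l -> R^o) (g : E -> 'rV[R]_l) :
    (forall s u, O' u -> differentiable (iter_derive h s) u) ->
    (forall i, smooth_gen O (fun u => g u 0 i)) ->
    (forall u, O u -> O' (g u)) -> smooth_gen O (fun u => h (g u)).

Lemma smooth_gen_cst (O : set E) a : open O -> smooth_gen O (fun=> a).
Proof. by move=> oO; apply: smooth_gen_base; exact: smooth_on_cst. Qed.

Lemma smooth_gen_sum (O : set E) (I : Type) (r : seq I) (F : I -> E -> R^o) :
  open O -> (forall i, smooth_gen O (F i)) ->
  smooth_gen O (fun u => \sum_(i <- r) F i u).
Proof.
move=> oO sF; elim: r => [|i r IH].
  rewrite (_ : (fun u => _) = fun=> 0); first exact: smooth_gen_cst.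
  by apply/funext => u; rewrite big_nil.
rewrite (_ : (fun u => _) = fun u => F i u + \sum_(j <- r) F j u).
  exact: smooth_gen_add.
by apply/funext => u; rewrite big_cons.
Qed.

Lemma smooth_gen_diff (O : set E) f u : smooth_gen O f -> O u -> differentiable f u.
Proof.
move=> sf Ou; elim: sf => {f}.
- by move=> f sf; exact: smooth_on_diff sf Ou.
- by move=> f g _ df _ dg; apply: differentiableD.
- by move=> f g _ df _ dg; apply: differentiableM.
- by move=> f _ df f0; apply: (@differentiableV _ _ f); rewrite ?f0.
- move=> l O' h g sh _ dg gO.
  apply: (@differentiable_comp _ _ _ _ g h); first exact: differentiable_rV.
  exact: (sh [::] _ (gO _ Ou)).
Qed.

Lemma smooth_gen_derive (O : set E) f w : open O -> smooth_gen O f ->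
  exists2 g, smooth_gen O g & forall u, O u -> 'D_w f u = g u.
Proof.
move=> oO; elim => {f}.
- move=> f sf; exists (fun u => 'D_w f u) => //.
  by apply: smooth_gen_base; exact: smooth_on_derive.
- move=> f g sf [f' sf' fE] sg [g' sg' gE].
  exists (fun u => f' u + g' u) => [|u Ou]; first exact: smooth_gen_add.
  rewrite -fE// -gE// (@deriveD _ _ _ f g)//.
    exact/diff_derivable/(smooth_gen_diff sf).
  exact/diff_derivable/(smooth_gen_diff sg).
- move=> f g sf [f' sf' fE] sg [g' sg' gE].
  exists (fun u => f u * g' u + g u * f' u) => [|u Ou].
    by apply: smooth_gen_add; exact: smooth_gen_mul.
  rewrite -fE// -gE// (@deriveM _ _ f g)//.
    exact/diff_derivable/(smooth_gen_diff sf).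
  exact/diff_derivable/(smooth_gen_diff sg).
- move=> f sf [f' sf' fE] f0.
  (* This is - f' / f^2, written as a product of generators of the class. *)
  exists (fun u => (-1 * (f u)^-1) * ((f u)^-1 * f' u)) => [|u Ou].
    have sV : smooth_gen O (fun u => (f u)^-1) by exact: smooth_gen_inv.
    apply: smooth_gen_mul; apply: smooth_gen_mul => //; exact: smooth_gen_cst.
  rewrite -fE// (@deriveV _ _ f)//; first last.
  + exact/diff_derivable/(smooth_gen_diff sf).
  + exact: f0.
  by rewrite -exprVn mulN1r mulNr expr2 scaleNr mulrA.
- move=> l O' h g sh sg IH gO.
  have [g' g'P] : exists g', forall i, smooth_gen O (g' i) /\
      forall u, O u -> 'D_w (fun x => g x 0 i : R^o) u = g' i u.
    have [i|g' g'P] := @boolp.choice 'I_l (E -> R^o) (fun i f => smooth_gen O f /\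
      forall u, O u -> 'D_w (fun x => g x 0 i : R^o) u = f u).
      by have [f sf fE] := IH i; exists f.
    by exists g'.
  (* Chain rule: the partial derivatives of [h] are again smooth on [O'], so every summand stays in
     the class. *)
  exists (fun u => \sum_i g' i u * 'D_(delta_mx 0 i) h (g u)) => [|u Ou].
    apply: smooth_gen_sum => // i; apply: smooth_gen_mul; first exact: (g'P i).1.
    apply: (@smooth_gen_comp O l O' (fun u => 'D_(delta_mx 0 i) h u)) => // s u Ou.
    have := sh (rcons s (delta_mx 0 i)) u Ou.
    by rewrite /iter_derive foldr_rcons.
  rewrite (@derive_comp_rV _ _ _ g h).
  + by apply: eq_bigr => i _; rewrite (g'P i).2.
  + by apply: differentiable_rV => i; exact: smooth_gen_diff Ou.
  + exact: (sh [::] _ (gO _ Ou)).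
Qed.

Lemma smooth_gen_on (O : set E) f : open O -> smooth_gen O f -> smooth_on O f.
Proof.
move=> oO; apply: (@smooth_on_coind _ O (smooth_gen O)) => //.
- by move=> {}f u; exact: smooth_gen_diff.
- by move=> {}f w; exact: smooth_gen_derive.
Qed.

Lemma is_derive_line (V W : normedModType R) (f : V -> W) (v x : V) (t : R) :
  differentiable f (t *: v + x) ->
  is_derive t (1 : R) (fun t : R => f (t *: v + x)) ('D_v f (t *: v + x)).
Proof.
move=> df.
have E : (fun h : R => h^-1 *: (((fun t : R => f (t *: v + x)) \o shift t) (h *: (1 : R)) - f (t *: v + x)))
  = (fun h => h^-1 *: ((f \o shift (t *: v + x)) (h *: v) - f (t *: v + x))).
  apply/funext => h; congr (_ *: (f _ - _)).
  by rewrite /= [h *: 1]mulr1 scalerDl addrA.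
apply: DeriveDef; last by rewrite /derive E.
by rewrite /derivable E; exact: diff_derivable.
Qed.

(** The mean value theorem for t |-> f(t v + h w + u) - f(t v + u) turns the second difference into
    h times a difference of values of ['D_v f]. The differentiability of ['D_v f] at [u] then
    estimates both values; continuity of the second derivatives is not involved. *)
Lemma second_difference (f : E -> R^o) (O : set E) u v w : open O -> O u ->
  (forall x, O x -> differentiable f x) ->
  differentiable ('D_v f : E -> R^o) u ->
  forall e, 0 < e -> \forall h \near 0^'+,
   `|f (h *: v + (h *: w + u)) - f (h *: v + u) - (f (h *: w + u) - f u)
     - h ^+ 2 * 'D_w ('D_v f : E -> R^o) u| <= e * h ^+ 2.
Proof.
move=> oO Ou df ddf e e0.
(* The two error terms at c v + h w and at c v have total norm at most h (2 |v| + |w|); the added 1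
   makes [C] positive. *)
pose C := 2 * `|v| + `|w| + 1.
have C0 : 0 < C by rewrite ltr_wpDl// addr_ge0// mulr_ge0.
have nO : \forall x \near (0 : E), O (x + u).
  have : \forall x \near u, O x by exact: open_nbhs_nbhs.
  by rewrite (near_shift 0) /= => H; apply: filterS H => x; rewrite subr0.
have eC0 : 0 < e / C by rewrite divr_gt0.
have [d /= d0 dP] := (nbhs_ballP (0 : E) _).1 (filterI nO (differentiable_eps ddf eC0)).
near=> h.
have h0 : 0 < h by near: h; exact: nbhs_right_gt.
have hd : h < d / C by near: h; apply: nbhs_right_lt; rewrite divr_gt0.
(* The boolean selects the point: [t *: v + h *: w] for [true], [t *: v] for [false]. *)
have small (t : R) (b : bool) : 0 <= t -> t <= h -> `|t *: v + (b%:R * h) *: w| < d.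
  move=> t0 th; rewrite (le_lt_trans (ler_normD _ _))// !normrZ ger0_norm//.
  rewrite (@le_lt_trans _ _ (h * C))//; last by rewrite -ltr_pdivlMr.
  rewrite /C !mulrDr mulr1 -addrA lerD//.
    by rewrite (@le_trans _ _ (h * `|v|))// ?ler_wpM2r// ler_wpM2l ?(ltW h0)// ler_peMl// ler1n.
  rewrite ler_wpDr ?(ltW h0)// ler_wpM2r// (gtr0_norm h0).
  by case: b; rewrite ?normr1 ?mul1r// normr0 mul0r ltW.
have sub (t : R) (b : bool) : 0 <= t -> t <= h -> let x := t *: v + (b%:R * h) *: w in
    O (x + u) /\ `|'D_v f (x + u) - 'D_v f u - 'd ('D_v f : E -> R^o) u x| <= e / C * `|x|.
  move=> t0 th x; apply: dP; rewrite -ball_normE /ball_ /= sub0r normrN.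
  exact: small.
pose phi (t : R) := f (t *: v + (h *: w + u)) - f (t *: v + u).
pose dphi (t : R) := 'D_v f (t *: v + (h *: w + u)) - 'D_v f (t *: v + u).
have subO (t : R) : 0 <= t -> t <= h -> O (t *: v + (h *: w + u)) /\ O (t *: v + u).
  move=> t0 th; have [/= q1 _] := sub t true t0 th; have [/= q2 _] := sub t false t0 th.
  by move: q1 q2; rewrite mul1r mul0r scale0r addr0 addrA.
have dphiP (t : R) : 0 <= t -> t <= h -> is_derive t (1 : R) (phi : R -> R^o) (dphi t).
  move=> t0 th; have [q1 q2] := subO t t0 th.
  by apply: is_deriveB; apply: is_derive_line; exact: df.
have [||c] := @MVT R phi dphi 0 h h0.
- move=> t; rewrite in_itv /= => /andP[t0 th]; apply: dphiP; exact: ltW.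
- apply: derivable_within_continuous => t; rewrite in_itv /= => /andP[t0 th].
  by have [] := dphiP t t0 th.
rewrite in_itv /= subr0 => /andP[/ltW c0 /ltW ch] phiE.
have -> : f (h *: v + (h *: w + u)) - f (h *: v + u) - (f (h *: w + u) - f u) = dphi c * h.
  by rewrite -phiE /phi scale0r !add0r.
have ddE : 'd ('D_v f : E -> R^o) u (c *: v + h *: w)
    = 'd ('D_v f : E -> R^o) u (c *: v) + h * 'D_w ('D_v f : E -> R^o) u.
  rewrite (deriveE w ddf) linearD; congr (_ + _); exact: linearZ.
have [_ /=] := sub c true c0 ch; have [_ /=] := sub c false c0 ch.
rewrite /dphi mul1r mul0r scale0r addr0 addrA ddE.
move: ('D_v f (c *: v + u)) ('D_v f (c *: v + h *: w + u)) ('D_v f u) => a2 a1 b.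
move: ('d ('D_v f : E -> R^o) u (c *: v)) ('D_w ('D_v f : E -> R^o) u) => L D H2 H1.
have -> : (a1 - a2) * h - h ^+ 2 * D = h * ((a1 - b - (L + h * D)) - (a2 - b - L)).
  by ring.
rewrite normrM gtr0_norm// expr2 mulrCA ler_wpM2l ?(ltW h0)//.
rewrite (le_trans (ler_normB _ _))// (le_trans (lerD H1 H2))// -mulrDr.
have -> : e * h = e / C * (C * h) by rewrite mulrA divfK ?gt_eqF.
rewrite ler_wpM2l ?(ltW eC0)// (@le_trans _ _ (h * `|v| + h * `|w| + h * `|v|))//.
  have cv : `|c *: v| <= h * `|v| by rewrite normrZ ger0_norm// ler_wpM2r.
  rewrite lerD// (le_trans (ler_normD _ _))// lerD//.
  by rewrite normrZ ger0_norm// ltW.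
rewrite /C; have := ltW h0; lra.
Unshelve. all: by end_near. Qed.

(** The second difference is symmetric in [v] and [w], so after division by h^2 it approximates both
    mixed derivatives within e / 2. *)
Lemma derive_commute (f : E -> R^o) (O : set E) u v w : open O -> O u ->
  smooth_on O f ->
  'D_v ('D_w f : E -> R^o) u = 'D_w ('D_v f : E -> R^o) u.
Proof.
move=> oO Ou sf.
have df x : O x -> differentiable f x by move=> Ox; exact: smooth_on_diff sf Ox.
have ddf z : differentiable ('D_z f : E -> R^o) u.
  exact: smooth_on_diff (smooth_on_derive z sf) Ou.
apply/eqP; rewrite -subr_eq0 -normr_le0; apply/ler_addgt0Pl => e e0.
rewrite addr0; have e2 : 0 < e / 2 by rewrite divr_gt0.
have H1 := second_difference w oO Ou df (ddf v) e2.
have H2 := second_difference v oO Ou df (ddf w) e2.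
have [h [[+ +] h0]] := filter_ex (filterI (filterI H1 H2) (nbhs_right_gt (0 : R))).
rewrite /=; clear H1 H2; simpl in h0.
rewrite [h *: w + (h *: v + u)]addrCA.
move: (f _) (f _) (f _) (f u) ('D_w _ u) ('D_v _ u) => a b c d Y X H2 H1.
rewrite -(ler_pM2r (exprn_gt0 2 h0)).
rewrite -{1}(@gtr0_norm _ (h ^+ 2)) ?exprn_gt0// -normrM.
have -> : (X - Y) * h ^+ 2 = (c - b - (a - d) - h ^+ 2 * Y) - (c - a - (b - d) - h ^+ 2 * X).
  by ring.
rewrite (le_trans (ler_normB _ _))// (le_trans (lerD H2 H1))//.
by rewrite -mulrDl -splitr.
Qed.

Lemma smooth_on_coord l (g : E -> 'rV[R]_l) (O : set E) i : open O ->
  smooth_on O g -> smooth_on O (fun u => g u 0 i : R^o).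
Proof.
move=> oO sg.
refine (smooth_on_coind (P := fun f => exists2 g : E -> 'rV[R]_l, smooth_on O g & f = (fun u => g u
  0 i : R^o)) oO _ _ _).
- move=> f u [g' sg' ->] Ou; apply: differentiable_coord_rV.
  exact: smooth_on_diff sg' Ou.
- move=> f w [g' sg' ->]; exists (fun u => 'D_w g' u 0 i).
    by exists (fun u => 'D_w g' u) => //; exact: smooth_on_derive.
  by move=> u Ou; rewrite derive_coord//; exact: smooth_on_diff sg' Ou.
- by exists g.
Qed.

Lemma smooth_on_rV l (g : E -> 'rV[R]_l) (O : set E) : open O ->
  (forall i, smooth_on O (fun u => g u 0 i : R^o)) -> smooth_on O g.
Proof.
move=> oO sg.
refine (smooth_on_coind (P := fun g : E -> 'rV[R]_l => forall i, smooth_on O (fun u => g u 0 i : R^o)) oO _ _ sg).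
  move=> f u sf Ou; apply: differentiable_rV => i; exact: smooth_on_diff (sf i) Ou.
move=> f w sf; exists (fun u => 'D_w f u) => // i.
apply: eq_smooth_on (smooth_on_derive w (sf i)) => // u Ou.
rewrite derive_coord//; apply: differentiable_rV => j.
exact: smooth_on_diff (sf j) Ou.
Qed.

End Smooth.
End Calculus.

(** The base point of [h] is a variable [y] with [y = g u]: in the applications it is the image of a
    point under a chart, which is only provably equal to the value of a transition map. *)
Lemma derive_comp_at (R : realType) (U V W : normedModType R) (g : U -> V) (h : V -> W) u y w :
  differentiable g u -> differentiable h y -> y = g u ->
  'D_w (fun x => h (g x)) u = 'd h y ('d g u w).
Proof.
move=> dg dh yE; rewrite yE in dh *; rewrite -[fun x => h (g x)]/(h \o g).
rewrite (deriveE w (differentiable_comp dg dh)).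
exact: (congr1 (fun F => F w) (diff_comp dg dh)).
Qed.

Section SmoothAt.
Variables (R : realType) (k : nat).
Local Notation E := 'rV[R]_k.
Implicit Types (f g : E -> R^o) (u : E).

Lemma smooth_on_sub (V : normedModType R) (B C : set E) (f : E -> V) :
  B `<=` C -> smooth_on C f -> smooth_on B f.
Proof. by move=> BC sf s u Bu; apply: sf; exact: BC. Qed.

Lemma smooth_at_open (V : normedModType R) (f : E -> V) u (P : E -> Prop) :
  smooth_at f u -> (\forall x \near u, P x) ->
  exists B, [/\ open B, B u, smooth_on B f & forall x, B x -> P x].
Proof.
move=> /smooth_atP[B [oB Bu sf]]; rewrite /prop_near1 nbhsE; move=> [C [oC Cu] CP].
exists (B `&` C); split; [exact: openI|by []| |by move=> x [_ /CP]].
by apply: smooth_on_sub sf => x [].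
Qed.

Lemma smooth_at_near (V : normedModType R) (f : E -> V) u :
  smooth_at f u -> \forall x \near u, smooth_at f x.
Proof.
move=> /smooth_atP[B [oB Bu sf]]; apply: (open_near oB Bu) => x Bx.
by apply/smooth_atP; exists B.
Qed.

Lemma smooth_at_diff (V : normedModType R) (f : E -> V) u :
  smooth_at f u -> differentiable f u.
Proof. by move=> /nbhs_singleton/(_ [::]). Qed.

Lemma smooth_at_derive (V : normedModType R) (f : E -> V) u w :
  smooth_at f u -> smooth_at (fun x => 'D_w f x) u.
Proof.
move=> /smooth_atP[B [oB Bu sf]]; apply/smooth_atP; exists B; split => //.
exact: smooth_on_derive.
Qed.

Lemma smooth_at_near_eq (V : normedModType R) (f g : E -> V) u :
  (\forall x \near u, f x = g x) -> smooth_at f u -> smooth_at g u.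
Proof.
move=> fg sf; have [B [oB Bu sB fgB]] := smooth_at_open sf fg.
by apply/smooth_atP; exists B; split => //; exact: eq_smooth_on sB.
Qed.

Lemma smooth_at_cst (V : normedModType R) (a : V) u : smooth_at (fun=> a) u.
Proof.
apply/smooth_atP; exists setT; split => //; first exact: openT.
by apply: smooth_on_cst; exact: openT.
Qed.

Lemma smooth_at_coordP l (g : E -> 'rV[R]_l) u :
  smooth_at g u <-> forall i, smooth_at (fun x => g x 0 i : R^o) u.
Proof.
split=> [/smooth_atP[B [oB Bu sg]] i|sg].
  by apply/smooth_atP; exists B; split => //; exact: smooth_on_coord.
have : \forall x \near u, forall i, smooth_at (fun x => g x 0 i : R^o) x.
  by apply: filter_forall (fun i => smooth_at_near (sg i)).
rewrite /prop_near1 nbhsE; move=> [B [oB Bu] BP]; apply/smooth_atP; exists B.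
split => //; apply: smooth_on_rV => // i s x Bx.
exact: (nbhs_singleton (BP x Bx i) s).
Qed.

Lemma smooth_atD f g u : smooth_at f u -> smooth_at g u ->
  smooth_at (fun x => f x + g x : R^o) u.
Proof.
move=> sf /smooth_atP[B [oB Bu sg]].
have [C [oC Cu sC CB]] := smooth_at_open sf (open_nbhs_nbhs (conj oB Bu)).
apply/smooth_atP; exists C; split => //; apply: smooth_gen_on => //.
apply: smooth_gen_add; apply: smooth_gen_base => //.
exact: smooth_on_sub sg.
Qed.

Lemma smooth_atM f g u : smooth_at f u -> smooth_at g u ->
  smooth_at (fun x => f x * g x : R^o) u.
Proof.
move=> sf /smooth_atP[B [oB Bu sg]].
have [C [oC Cu sC CB]] := smooth_at_open sf (open_nbhs_nbhs (conj oB Bu)).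
apply/smooth_atP; exists C; split => //; apply: smooth_gen_on => //.
apply: smooth_gen_mul; apply: smooth_gen_base => //.
exact: smooth_on_sub sg.
Qed.

Lemma smooth_atV f u : smooth_at f u -> f u != 0 ->
  smooth_at (fun x => (f x)^-1 : R^o) u.
Proof.
move=> sf fu.
have n0 : \forall x \near u, f x != 0.
  have cf : f x @[x --> u] --> f u by exact: differentiable_continuous (smooth_at_diff sf).
  exact: cvgr_neq0 cf fu.
have [C [oC Cu sC CB]] := smooth_at_open sf n0.
apply/smooth_atP; exists C; split => //; apply: smooth_gen_on => //.
by apply: smooth_gen_inv => //; exact: smooth_gen_base.
Qed.

Lemma smooth_at_sum (I : Type) (r : seq I) (F : I -> E -> R^o) u :
  (forall i, smooth_at (F i) u) -> smooth_at (fun x => \sum_(i <- r) F i x : R^o) u.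
Proof.
move=> sF; elim: r => [|i r IH].
  rewrite (_ : (fun x => _) = fun=> 0); first exact: smooth_at_cst.
  by apply/funext => x; rewrite big_nil.
rewrite (_ : (fun x => _) = fun x => F i x + \sum_(j <- r) F j x).
  exact: smooth_atD.
by apply/funext => x; rewrite big_cons.
Qed.

Lemma smooth_at_comp l (h : 'rV[R]_l -> R^o) (g : E -> 'rV[R]_l) u :
  smooth_at h (g u) -> smooth_at g u -> smooth_at (fun x => h (g x) : R^o) u.
Proof.
move=> /smooth_atP[B [oB Bu sh]] sg.
have nB : \forall x \near u, B (g x).
  have cg : g x @[x --> u] --> g u by exact: differentiable_continuous (smooth_at_diff sg).
  by apply: cg; exact: open_nbhs_nbhs.
have [C [oC Cu sC CB]] := smooth_at_open sg nB.
apply/smooth_atP; exists C; split => //; apply: smooth_gen_on => //.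
apply: (@smooth_gen_comp R k C l B h g) => // i.
by apply: smooth_gen_base; exact: smooth_on_coord.
Qed.

Lemma smooth_at_id_coord (i : 'I_k) u : smooth_at (fun x : E => x 0 i : R^o) u.
Proof.
have oT : open [set: E] by exact: openT.
apply/smooth_atP; exists setT; split => //.
refine (smooth_on_coind (P := fun f : E -> R^o => f = (fun x => x 0 i) \/ exists a, f = cst a) oT _
  _ (or_introl erefl)).
  move=> f x [->|[a ->]] _; [exact: differentiable_coord|exact: differentiable_cst].
move=> f w [->|[a ->]].
  exists (cst (w 0 i)); first by right; exists (w 0 i).
  move=> x _; rewrite -(derive_coord (g := id)) ?derive_id//.
exists (cst 0); first by right; exists 0.
by move=> x _; rewrite derive_cst.
Qed.

Lemma derive_commute_at f u v w : smooth_at f u ->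
  'D_v (fun x => 'D_w f x : R^o) u = 'D_w (fun x => 'D_v f x : R^o) u.
Proof. by move=> /smooth_atP[B [oB Bu sf]]; exact: (derive_commute v w oB Bu sf). Qed.

End SmoothAt.

(** * Functions, tangent vectors and vector fields on a manifold *)

Section SmoothAtlas.
Variables (R : realType) (X : Type) (k : nat) (A : set (chart R X k)).
Implicit Types (x y : X) (c : chart R X k) (f g : X -> R) (P : set X).

(** What the atlas of the manifold and that of the twistor space have in common. No topology on [X]
    is involved, so all calculus below applies to both. *)
Record smooth_atlas : Prop := SmoothAtlas {
  atlas_inj : forall c x y, A c -> cdom c x -> cdom c y -> c x = c y -> x = y;
  atlas_open : forall c x, chart_at A x c ->
    \forall u \near c x, exists2 y, cdom c y & c y = u;
  atlas_dom : forall x c c', chart_at A x c -> chart_at A x c' ->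
    \forall u \near c x, cdom c' (cinv c x u);
  atlas_smooth : forall x c c', chart_at A x c -> chart_at A x c' ->
    smooth_at (transition c c' x) (c x);
  atlas_cover : forall x, exists c, chart_at A x c }.

Hypothesis As : smooth_atlas.

Lemma cinvK c x y : A c -> cdom c y -> cinv c x (c y) = y.
Proof.
move=> Ac cy; apply: the_eq => //= z [cz zy]; exact: (atlas_inj As) Ac cz cy zy.
Qed.

Lemma cinvK_at c x : chart_at A x c -> cinv c x (c x) = x.
Proof. by move=> [Ac cx]; exact: cinvK. Qed.

Lemma near_cinv c x : chart_at A x c ->
  \forall u \near c x, cdom c (cinv c x u) /\ c (cinv c x u) = u.
Proof.
move=> xc; apply: filterS (atlas_open As xc) => u [y cy <-].
by rewrite cinvK //; case: xc.
Qed.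

Lemma transition_id c x : chart_at A x c -> \forall u \near c x, transition c c x u = u.
Proof. by move=> xc; apply: filterS (near_cinv xc) => u []. Qed.

Lemma transition_at c c' x : chart_at A x c -> transition c c' x (c x) = c' x.
Proof. by move=> xc; rewrite /transition cinvK_at. Qed.

(** Transition maps are smooth, hence continuous, so a neighbourhood read in one chart is one in
    every other chart. The definition quantifies over all charts; this lets proofs check only
    one. *)
Lemma near_ptE c x P : chart_at A x c ->
  near_pt A x P <-> \forall u \near c x, P (cinv c x u).
Proof.
move=> xc; split; first exact.
move=> nP c' xc'.
have ct : transition c' c x u @[u --> c' x] --> transition c' c x (c' x).
  exact: differentiable_continuous (smooth_at_diff (atlas_smooth As xc' xc)).
rewrite (transition_at c xc') in ct.
have := ct _ nP; apply: filterS2 (atlas_dom As xc' xc) => u cu.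
by rewrite /= /transition cinvK //; case: xc.
Qed.

Lemma near_ptS x P Q : near_pt A x P -> (forall y, P y -> Q y) -> near_pt A x Q.
Proof. by move=> nP PQ c xc; apply: filterS (nP c xc) => u; exact: PQ. Qed.

Lemma near_ptS2 x P Q T : near_pt A x P -> near_pt A x Q ->
  (forall y, P y -> Q y -> T y) -> near_pt A x T.
Proof. by move=> nP nQ PQ c xc; apply: filterS2 (nP c xc) (nQ c xc) => u; exact: PQ. Qed.

Lemma near_ptS3 x P Q T T' : near_pt A x P -> near_pt A x Q -> near_pt A x T ->
  (forall y, P y -> Q y -> T y -> T' y) -> near_pt A x T'.
Proof.
move=> nP nQ nT PQ c xc.
by apply: filterS3 (nP c xc) (nQ c xc) (nT c xc) => u; exact: PQ.
Qed.

Lemma near_ptT x P : (forall y, P y) -> near_pt A x P.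
Proof. by move=> HP c xc; apply: filterE => u; exact: HP. Qed.

Lemma near_pt_forall x (I : finType) (P : I -> set X) :
  (forall i, near_pt A x (P i)) -> near_pt A x (fun y => forall i, P i y).
Proof. by move=> nP c xc; apply: filter_forall (fun i => nP i c xc). Qed.

Lemma near_pt_self x P : near_pt A x P -> P x.
Proof.
have [c xc] := atlas_cover As x.
by move=> /(_ c xc)/nbhs_singleton; rewrite cinvK_at.
Qed.

Lemma near_pt_chart x c : chart_at A x c -> near_pt A x (fun y => chart_at A y c).
Proof.
move=> xc; apply/(near_ptE _ xc); apply: filterS (near_cinv xc) => u [cu _].
by split => //; case: xc.
Qed.

Lemma near_near (T : topologicalType) (t : T) (P : T -> Prop) :
  (\forall u \near t, P u) -> \forall u \near t, \forall v \near u, P v.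
Proof. by move=> nP; have := nbhs_interior nP. Qed.

Lemma near_pt_near x P : near_pt A x P -> near_pt A x (fun y => near_pt A y P).
Proof.
have [c xc] := atlas_cover As x; move=> nP; apply/(near_ptE _ xc).
have Ac : A c by case: xc.
apply: filterS2 (near_near (nP c xc)) (near_near (near_cinv xc)) => u nPu nu.
have [cu ucu] := nbhs_singleton nu.
apply/(@near_ptE c) => //; rewrite ucu; apply: filterS2 nPu nu => v Pv [cv vcv].
by rewrite -vcv cinvK.
Qed.

Lemma near_cinv_eq c x : chart_at A x c ->
  \forall u \near c x, \forall v \near u, cinv c (cinv c x u) v = cinv c x v.
Proof.
move=> xc; have Ac : A c by case: xc.
apply: filterS (near_near (near_cinv xc)) => u; apply: filterS => v [cv vcv].
by rewrite -{1}vcv cinvK.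
Qed.

Lemma smooth_funE c x f : chart_at A x c ->
  smooth_fun A f x <-> smooth_at (fun u => f (cinv c x u) : R^o) (c x).
Proof.
move=> xc; split; first exact.
move=> sf c' xc'.
rewrite -(transition_at c xc') in sf.
have := smooth_at_comp sf (atlas_smooth As xc' xc).
apply: smooth_at_near_eq; apply: filterS (atlas_dom As xc' xc) => u cu.
by rewrite /transition cinvK //; case: xc.
Qed.

Lemma smooth_fun_near x f : smooth_fun A f x -> near_pt A x (smooth_fun A f).
Proof.
have [c xc] := atlas_cover As x; move=> sf; apply/(near_ptE _ xc).
have Ac : A c by case: xc.
apply: filterS3 (smooth_at_near (sf c xc)) (near_cinv xc) (near_cinv_eq xc) => u su [cu ucu] uE.
apply/(@smooth_funE c) => //; rewrite ucu.
by apply: smooth_at_near_eq su; apply: filterS uE => v ->.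
Qed.

Lemma smooth_fun_eq x f g : near_pt A x (fun y => f y = g y) ->
  smooth_fun A f x -> smooth_fun A g x.
Proof.
move=> fg sf c xc; apply: smooth_at_near_eq (sf c xc).
exact: (fg c xc).
Qed.

Lemma smooth_fun_cst x a : smooth_fun A (fun=> a) x.
Proof. by move=> c xc; exact: smooth_at_cst. Qed.

Lemma smooth_funD x f g : smooth_fun A f x -> smooth_fun A g x ->
  smooth_fun A (fun y => f y + g y) x.
Proof. by move=> sf sg c xc; exact: smooth_atD (sf c xc) (sg c xc). Qed.

Lemma smooth_funM x f g : smooth_fun A f x -> smooth_fun A g x ->
  smooth_fun A (fun y => f y * g y) x.
Proof. by move=> sf sg c xc; exact: smooth_atM (sf c xc) (sg c xc). Qed.

Lemma smooth_funV x f : smooth_fun A f x -> f x != 0 -> smooth_fun A (fun y => (f y)^-1) x.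
Proof. by move=> sf f0 c xc; apply: smooth_atV (sf c xc) _; rewrite cinvK_at. Qed.

Lemma smooth_funN x f : smooth_fun A f x -> smooth_fun A (fun y => - f y) x.
Proof.
move=> sf; rewrite (_ : (fun y => _) = fun y => -1 * f y).
  by apply: smooth_funM => //; exact: smooth_fun_cst.
by apply/funext => y; rewrite mulN1r.
Qed.

Lemma smooth_funB x f g : smooth_fun A f x -> smooth_fun A g x ->
  smooth_fun A (fun y => f y - g y) x.
Proof. by move=> sf sg; apply: smooth_funD => //; exact: smooth_funN. Qed.

Lemma smooth_fun_sum x (I : Type) (r : seq I) (F : I -> X -> R) :
  (forall i, smooth_fun A (F i) x) -> smooth_fun A (fun y => \sum_(i <- r) F i y) x.
Proof. by move=> sF c xc; apply: smooth_at_sum => i; exact: sF. Qed.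

Lemma smooth_fun_coord c x i : chart_at A x c -> smooth_fun A (fun y => c y 0 i) x.
Proof.
move=> xc; apply/(smooth_funE _ xc).
have := smooth_at_id_coord i (c x); apply: smooth_at_near_eq.
by apply: filterS (near_cinv xc) => u [_ ->].
Qed.

End SmoothAtlas.

Section Tangent.
Variables (R : realType) (X : Type) (k : nat) (A : set (chart R X k)).
Implicit Types (x y : X) (c : chart R X k) (f g : X -> R) (P : set X).
Hypothesis As : smooth_atlas A.

Lemma tangentD x (v w : tangent A x) c : (v + w) c = v c + w c.
Proof. by []. Qed.

Lemma tangentZ x a (v : tangent A x) c : (a *: v) c = a *: v c.
Proof. by []. Qed.

Lemma tangent_lin x a (v w : tangent A x) c : (a *: v + w) c = a *: v c + w c.
Proof. by []. Qed.

Lemma tangent_jacobian x (v : tangent A x) c c' : chart_at A x c -> chart_at A x c' ->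
  v c' = 'd (transition c c' x) (c x) (v c).
Proof. by case: v => v /= /asboolP[_]; apply. Qed.

Lemma tangent_eqP x (v w : tangent A x) c : chart_at A x c -> v c = w c -> v = w.
Proof.
move=> xc vw; apply: val_inj; apply/funext => c' /=.
have [xc'|nxc'] := pselect (chart_at A x c').
  by rewrite (tangent_jacobian v xc xc') (tangent_jacobian w xc xc') vw.
by case: v w {vw} => [v /= /asboolP[v0 _]] [w /= /asboolP[w0 _]]; rewrite v0// w0.
Qed.

Definition tangent_of_fun c x (u : 'rV[R]_k) : chart R X k -> 'rV[R]_k :=
  fun c' => if pselect (chart_at A x c') then 'd (transition c c' x) (c x) u else 0.

(** The Jacobian condition between two further charts is the chain rule along [c], [c1], [c2]; the
    composite of the two transitions agrees with the direct one only near the point, which is enough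
    for derivatives. *)
Lemma tangent_of_proof c x u : chart_at A x c -> tangent_of_fun c x u \in tangent_family A x.
Proof.
move=> xc; apply/asboolP; split.
  by move=> c' xc'; rewrite /tangent_of_fun; case: pselect.
move=> c1 c2 xc1 xc2; rewrite /tangent_of_fun.
case: pselect => // ?; case: pselect => // ?.
have d1 := smooth_at_diff (atlas_smooth As xc xc1).
have d2 := smooth_at_diff (atlas_smooth As xc1 xc2).
have d3 := smooth_at_diff (atlas_smooth As xc xc2).
apply: etrans (esym (deriveE u d3)) _.
apply: etrans (derive_comp_at u d1 d2 (esym (transition_at As c1 xc))).
apply: near_eq_derive; apply: filterS (atlas_dom As xc xc1) => v cv.
by rewrite /= /transition (cinvK As) //; case: xc1.
Qed.

Definition tangent_of c x (u : 'rV[R]_k) : tangent A x :=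
  if pselect (chart_at A x c) is left xc then Tangent (tangent_of_proof u xc) else 0.

Lemma tangent_ofE c x u : chart_at A x c -> tangent_of c x u c = u.
Proof.
move=> xc; rewrite /tangent_of; case: pselect => // xc' /=.
rewrite /tangent_of_fun; case: pselect => // ?.
have d1 := smooth_at_diff (atlas_smooth As xc xc).
rewrite -deriveE // -[RHS](derive_id (c x) u); apply: near_eq_derive.
exact: (transition_id As).
Qed.

(** Any other chart gives the same number by the chain rule and the Jacobian relation in
    [tangent_family]; this is the uniqueness that the description operator requires. *)
Lemma dirdE c x (v : tangent A x) f : chart_at A x c -> smooth_fun A f x ->
  dird v f = 'D_(v c) (fun u => f (cinv c x u) : R^o) (c x).
Proof.
move=> xc sf; rewrite deriveE; last exact: smooth_at_diff (sf c xc).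
apply: the_eq; first by exists c.
move=> r [c' xc' ->].
have d1 := smooth_at_diff (atlas_smooth As xc' xc).
have d2 := smooth_at_diff (sf c xc).
have d3 := smooth_at_diff (sf c' xc').
rewrite (tangent_jacobian v xc' xc).
apply: etrans (esym (deriveE (v c') d3)) _.
apply: etrans (derive_comp_at (v c') d1 d2 (esym (transition_at As c xc'))).
apply: near_eq_derive; apply: filterS (atlas_dom As xc' xc) => u cu.
by rewrite /= /transition (cinvK As) //; case: xc.
Qed.

Lemma dird_lin x a (v w : tangent A x) f : smooth_fun A f x ->
  dird (a *: v + w) f = a * dird v f + dird w f.
Proof.
have [c xc] := atlas_cover As x; move=> sf; rewrite !(dirdE _ xc)//.
have df := smooth_at_diff (sf c xc).
by rewrite !deriveE// tangent_lin linearP.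
Qed.

Lemma dird0v x f : smooth_fun A f x -> dird (0 : tangent A x) f = 0.
Proof.
move=> sf; have := dird_lin 1 0 0 sf; rewrite scale1r addr0 mul1r => /eqP.
by rewrite -subr_eq0 opprD addNKr oppr_eq0 => /eqP.
Qed.

Lemma dirdDv x (v w : tangent A x) f : smooth_fun A f x ->
  dird (v + w) f = dird v f + dird w f.
Proof. by move=> sf; rewrite -[v]scale1r dird_lin // scale1r mul1r. Qed.

Lemma dirdZv x a (v : tangent A x) f : smooth_fun A f x -> dird (a *: v) f = a * dird v f.
Proof. by move=> sf; rewrite -[a *: v]addr0 dird_lin// dird0v// addr0. Qed.

Lemma dird_sumv x (I : Type) (r : seq I) (v : I -> tangent A x) f : smooth_fun A f x ->
  dird (\sum_(i <- r) v i) f = \sum_(i <- r) dird (v i) f.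
Proof.
move=> sf; elim: r => [|i r IH]; first by rewrite !big_nil dird0v.
by rewrite !big_cons dirdDv// IH.
Qed.

Lemma dird_eq x (v : tangent A x) f g : near_pt A x (fun y => f y = g y) ->
  smooth_fun A f x -> dird v f = dird v g.
Proof.
have [c xc] := atlas_cover As x; move=> fg sf.
rewrite !(dirdE _ xc)//; last exact: smooth_fun_eq fg sf.
by apply: near_eq_derive; exact: (fg c xc).
Qed.

Lemma dird_cst x (v : tangent A x) a : dird v (fun=> a) = 0.
Proof.
have [c xc] := atlas_cover As x.
by rewrite (dirdE _ xc) ?derive_cst//; exact: smooth_fun_cst.
Qed.

Lemma dirdD x (v : tangent A x) f g : smooth_fun A f x -> smooth_fun A g x ->
  dird v (fun y => f y + g y) = dird v f + dird v g.
Proof.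
have [c xc] := atlas_cover As x; move=> sf sg.
rewrite !(dirdE _ xc)//; last exact: smooth_funD.
rewrite (@deriveD _ _ _ (fun u => f (cinv c x u) : R^o) (fun u => g (cinv c x u) : R^o))//.
  exact/diff_derivable/smooth_at_diff/sf.
exact/diff_derivable/smooth_at_diff/sg.
Qed.

Lemma dirdM x (v : tangent A x) f g : smooth_fun A f x -> smooth_fun A g x ->
  dird v (fun y => f y * g y) = dird v f * g x + f x * dird v g.
Proof.
have [c xc] := atlas_cover As x; move=> sf sg.
rewrite !(dirdE _ xc)//; last exact: smooth_funM.
rewrite (@deriveM _ _ (fun u => f (cinv c x u) : R^o) (fun u => g (cinv c x u) : R^o)).
- by rewrite (cinvK_at As)// addrC; congr (_ + _); exact: mulrC.
- exact/diff_derivable/smooth_at_diff/sf.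
- exact/diff_derivable/smooth_at_diff/sg.
Qed.

Lemma dirdN x (v : tangent A x) f : smooth_fun A f x ->
  dird v (fun y => - f y) = - dird v f.
Proof.
move=> sf; rewrite (_ : (fun y => _) = fun y => -1 * f y).
  by rewrite dirdM ?dird_cst ?mul0r ?add0r ?mulN1r//; exact: smooth_fun_cst.
by apply/funext => y; rewrite mulN1r.
Qed.

Lemma dirdB x (v : tangent A x) f g : smooth_fun A f x -> smooth_fun A g x ->
  dird v (fun y => f y - g y) = dird v f - dird v g.
Proof. by move=> sf sg; rewrite dirdD ?dirdN//; exact: smooth_funN. Qed.

Lemma dird_sum x (v : tangent A x) (I : Type) (r : seq I) (F : I -> X -> R) :
  (forall i, smooth_fun A (F i) x) ->
  dird v (fun y => \sum_(i <- r) F i y) = \sum_(i <- r) dird v (F i).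
Proof.
move=> sF; elim: r => [|i r IH].
  rewrite big_nil -[RHS](dird_cst v 0); congr dird.
  by apply/funext => y; rewrite big_nil.
rewrite big_cons -IH -(dirdD v (sF i) (smooth_fun_sum r sF)).
by congr dird; apply/funext => y; rewrite big_cons.
Qed.

Lemma dird_coord c x (v : tangent A x) i : chart_at A x c ->
  dird v (fun y => c y 0 i) = v c 0 i.
Proof.
move=> xc; rewrite (dirdE _ xc); last exact: smooth_fun_coord.
transitivity ('D_(v c) (fun u : 'rV[R]_k => u 0 i : R^o) (c x)).
  by apply: near_eq_derive; apply: filterS (near_cinv As xc) => u [_ ->].
by rewrite -(derive_coord (g := id)) ?derive_id.
Qed.

Lemma tangent_eq_dird c x (v w : tangent A x) : chart_at A x c ->
  (forall i, dird v (fun y => c y 0 i) = dird w (fun y => c y 0 i)) -> v = w.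
Proof.
move=> xc vw; apply: (tangent_eqP xc); apply/rowP => i.
by have := vw i; rewrite !dird_coord.
Qed.

Definition coord_field c (i : 'I_k) : vfield A := fun x => tangent_of c x (delta_mx 0 i).

Lemma tangent_sum c x (v : tangent A x) : chart_at A x c ->
  v = \sum_i v c 0 i *: coord_field c i x.
Proof.
move=> xc; apply: (tangent_eqP xc).
rewrite {1}(matrix_sum_delta (v c)) big_ord1.
transitivity (\sum_i (v c 0 i *: coord_field c i x) c).
  by apply: eq_bigr => i _; rewrite tangentZ tangent_ofE.
by elim/big_ind2: _ => // u1 u2 w1 w2 -> ->.
Qed.

Lemma smooth_dird_coord_field c x f i : chart_at A x c -> smooth_fun A f x ->
  smooth_fun A (fun y => dird (coord_field c i y) f) x.
Proof.
move=> xc sf; apply/(smooth_funE As _ xc).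
have Ac : A c by case: xc.
have := smooth_at_derive (delta_mx 0 i) (sf c xc); apply: smooth_at_near_eq.
have nsf : \forall u \near c x, smooth_fun A f (cinv c x u) by exact: smooth_fun_near.
apply: filterS3 nsf (near_cinv As xc) (near_cinv_eq As xc) => u su [cu ucu] uE.
rewrite (@dirdE c)// tangent_ofE// ucu; apply: near_eq_derive.
by apply: filterS uE => v ->.
Qed.

Lemma dird_expand c x (v : tangent A x) f : chart_at A x c -> smooth_fun A f x ->
  dird v f = \sum_i v c 0 i * dird (coord_field c i x) f.
Proof.
move=> xc sf; rewrite {1}(tangent_sum v xc) dird_sumv//.
by apply: eq_bigr => i _; rewrite dirdZv.
Qed.

(** One chart is enough because the j-th component in another chart [c'] is the sum of the
    components in [c] times the derivatives of the coordinate function [c' _ 0 j] along the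
    coordinate fields. *)
Lemma smooth_vfieldP c x (U : vfield A) : chart_at A x c ->
  smooth_vfield A U x <-> forall i, smooth_fun A (fun y => U y c 0 i) x.
Proof.
move=> xc; split=> [sU i|sU c' xc'].
  apply/(smooth_funE As _ xc); exact: (smooth_at_coordP _ _).1 (sU c xc) i.
apply/smooth_at_coordP => j; apply/(smooth_funE As (fun y => U y c' 0 j) xc').
apply: (@smooth_fun_eq _ _ _ _ _ (fun y => \sum_i U y c 0 i * dird (coord_field c i y) (fun z => c' z 0 j))).
  apply: (near_ptS2 (near_pt_chart As xc) (near_pt_chart As xc')) => y yc yc'.
  by rewrite -dird_expand ?dird_coord//; exact: smooth_fun_coord.
apply: smooth_fun_sum => i; apply: smooth_funM => //.
by apply: smooth_dird_coord_field => //; exact: smooth_fun_coord.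
Qed.

Lemma smooth_dird x (U : vfield A) f : smooth_vfield A U x -> smooth_fun A f x ->
  smooth_fun A (fun y => dird (U y) f) x.
Proof.
have [c xc] := atlas_cover As x; move=> /(smooth_vfieldP _ xc) sU sf.
apply: (@smooth_fun_eq _ _ _ _ _ (fun y => \sum_i U y c 0 i * dird (coord_field c i y) f)).
  apply: (near_ptS2 (near_pt_chart As xc) (smooth_fun_near As sf)) => y yc sfy.
  by rewrite -dird_expand.
by apply: smooth_fun_sum => i; apply: smooth_funM => //; exact: smooth_dird_coord_field.
Qed.

Lemma smooth_vfield_eq x (U V : vfield A) : near_pt A x (fun y => U y = V y) ->
  smooth_vfield A U x -> smooth_vfield A V x.
Proof.
move=> UV sU c xc; apply: smooth_at_near_eq (sU c xc).
by apply: filterS (UV c xc) => u ->.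
Qed.

Lemma smooth_vfield_near x (U : vfield A) : smooth_vfield A U x ->
  near_pt A x (smooth_vfield A U).
Proof.
have [c xc] := atlas_cover As x; move=> /(smooth_vfieldP _ xc) sU.
have nsU : near_pt A x (fun y => forall i, smooth_fun A (fun y => U y c 0 i) y).
  exact: (near_pt_forall (P := fun i => smooth_fun A (fun y => U y c 0 i)) (fun i => smooth_fun_near As (sU i))).
by apply: (near_ptS2 (near_pt_chart As xc) nsU) => y yc; exact: (smooth_vfieldP _ yc).2.
Qed.

Lemma smooth_tangent_of c x u : chart_at A x c -> smooth_vfield A (fun y => tangent_of c y u) x.
Proof.
move=> xc; apply/(smooth_vfieldP _ xc) => i.
apply: (@smooth_fun_eq _ _ _ _ _ (fun=> u 0 i)); last exact: smooth_fun_cst.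
by apply: (near_ptS (near_pt_chart As xc)) => y yc; rewrite tangent_ofE.
Qed.

Lemma smooth_coord_field c x i : chart_at A x c -> smooth_vfield A (coord_field c i) x.
Proof. exact: smooth_tangent_of. Qed.

Lemma extensionP x (v : tangent A x) :
  smooth_vfield A (extension v) x /\ extension v x = v.
Proof.
apply: (@the_spec _ _ [set U | smooth_vfield A U x /\ U x = v]).
have [c xc] := atlas_cover As x.
exists (fun y => tangent_of c y (v c)); split; first exact: smooth_tangent_of.
by apply: (tangent_eqP xc); rewrite tangent_ofE.
Qed.

Lemma coord_field_commute c x f i j : chart_at A x c -> smooth_fun A f x ->
  dird (coord_field c i x) (fun y => dird (coord_field c j y) f) =
  dird (coord_field c j x) (fun y => dird (coord_field c i y) f).
Proof.
move=> xc sf; have Ac : A c by case: xc.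
have H l l' : dird (coord_field c l x) (fun y => dird (coord_field c l' y) f) =
   'D_(delta_mx 0 l) (fun u => 'D_(delta_mx 0 l') (fun u => f (cinv c x u) : R^o) u : R^o) (c x).
  rewrite (@dirdE c)//; last exact: smooth_dird_coord_field.
  rewrite tangent_ofE//; apply: near_eq_derive.
  have nsf : \forall u \near c x, smooth_fun A f (cinv c x u) by exact: smooth_fun_near.
  apply: filterS3 nsf (near_cinv As xc) (near_cinv_eq As xc) => u su [cu ucu] uE.
  rewrite (@dirdE c)// tangent_ofE// ucu; apply: near_eq_derive.
  by apply: filterS uE => v ->.
by rewrite !H; apply: derive_commute_at; exact: sf.
Qed.

Lemma lie_bracketP x (U V : vfield A) f : smooth_vfield A U x -> smooth_vfield A V x ->
  smooth_fun A f x ->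
  dird (lie_bracket A U V x) f = dird (U x) (fun y => dird (V y) f)
             - dird (V x) (fun y => dird (U y) f).
Proof.
move=> sU sV; move: f.
apply: (@the_spec _ 0 [set w : tangent A x | forall f, smooth_fun A f x ->
    dird w f = dird (U x) (fun y => dird (V y) f)
             - dird (V x) (fun y => dird (U y) f)]).
have [c xc] := atlas_cover As x.
(* The classical coordinate expression of the bracket: its j-th component is U(V_j) - V(U_j). *)
exists (tangent_of c x (\row_j (dird (U x) (fun y => V y c 0 j) - dird (V x) (fun y => U y c 0 j)))).
move=> f sf; rewrite (@dird_expand c)// tangent_ofE//.
have sUc := (smooth_vfieldP _ xc).1 sU; have sVc := (smooth_vfieldP _ xc).1 sV.
have H (W W' : vfield A) : smooth_vfield A W' x ->
  dird (W x) (fun y => dird (W' y) f) =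
  \sum_j (dird (W x) (fun y => W' y c 0 j) * dird (coord_field c j x) f)
  + \sum_j \sum_i (W' x c 0 j * (W x c 0 i * dird (coord_field c i x) (fun y => dird (coord_field c j y) f))).
  move=> /(smooth_vfieldP _ xc) sW.
  have sd j : smooth_fun A (fun y => dird (coord_field c j y) f) x.
    exact: smooth_dird_coord_field.
  rewrite -big_split /= -(@dird_eq x (W x) (fun y => \sum_i W' y c 0 i * dird (coord_field c i y) f)).
  - rewrite dird_sum; last by move=> i; apply: smooth_funM.
    apply: eq_bigr => j _; rewrite dirdM//; congr (_ + _).
    by rewrite -mulr_sumr (@dird_expand c _ (W x)).
  - apply: (near_ptS2 (near_pt_chart As xc) (smooth_fun_near As sf)) => y yc sfy.
    by rewrite -dird_expand.
  - by apply: smooth_fun_sum => i; apply: smooth_funM.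
rewrite (H U V)// (H V U)// [X in _ = _ + X - _]exchange_big /= opprD addrACA.
(* These are the terms with second derivatives of [f]; they cancel because coordinate fields
   commute. *)
rewrite [X in _ = _ + X](_ : _ = 0).
  rewrite addr0 -sumrB; apply: eq_bigr => j _; rewrite mxE; ring.
rewrite -sumrB big1// => j _; rewrite -sumrB big1// => i _.
rewrite (coord_field_commute i j xc sf); ring.
Qed.

End Tangent.

(** * Quaternionic algebra at a point *)

Section Rot3.
Variable R : comPzRingType.

Lemma ord3P (P : 'I_3 -> Prop) : P ord0 -> P 1 -> P ord_max -> forall i, P i.
Proof.
move=> P0 P1 P2 [[|[|[|//]]] i3].
- by rewrite (_ : Ordinal i3 = ord0)//; exact: val_inj.
- by rewrite (_ : Ordinal i3 = 1)//; exact: val_inj.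
- by rewrite (_ : Ordinal i3 = ord_max)//; exact: val_inj.
Qed.

Lemma sum3 (V : nmodType) (F : 'I_3 -> V) : \sum_i F i = F ord0 + F 1 + F ord_max.
Proof.
rewrite !big_ord_recl big_ord0 addr0 addrA.
by congr (F _ + F _ + F _); exact: val_inj.
Qed.

Definition dot3 (a b : 'I_3 -> R) : R := \sum_i a i * b i.

Definition cross (a b : 'I_3 -> R) (i : 'I_3) : R :=
  if i == ord0 then a 1 * b ord_max - a ord_max * b 1
  else if i == 1 then a ord_max * b ord0 - a ord0 * b ord_max
  else a ord0 * b 1 - a 1 * b ord0.

End Rot3.

(** * Identities between tangent vectors, checked coordinate by coordinate *)

Section TangentRing.
Variables (R : realType) (X : Type) (k : nat) (A : set (chart R X k)) (p : X).
Implicit Types (x y : tangent A p).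

Lemma tangent_ext x y : (forall c i, x c 0 i = y c 0 i) -> x = y.
Proof. move=> xy; apply: val_inj; apply/funext => c; apply/rowP => i; exact: xy. Qed.

Lemma tangent_evD x y c i : (x + y) c 0 i = x c 0 i + y c 0 i.
Proof. by rewrite tangentD mxE. Qed.

Lemma tangent_evZ a x c i : (a *: x) c 0 i = a * x c 0 i.
Proof. by rewrite tangentZ mxE. Qed.

Lemma tangent_ev0 c i : (0 : tangent A p) c 0 i = 0.
Proof. by rewrite -(scale0r 0) tangent_evZ mul0r. Qed.

Lemma tangent_evN x c i : (- x) c 0 i = - x c 0 i.
Proof. by rewrite -scaleN1r tangent_evZ mulN1r. Qed.

End TangentRing.

(* Replaces by variables the maximal applications of a constant, so that ring
   does not try to convert them. *)
Ltac head_is t f :=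
  lazymatch t with
  | ?g _ => head_is g f
  | _ => constr_eq t f
  end.

Ltac abstract_terms f :=
  repeat match goal with
  | |- context [?t] =>
      head_is t f;
      lazymatch type of t with forall _, _ => fail | _ => idtac end;
      generalize t; intro
  end.

(* Builds the evaluation of a tangent vector at a coordinate by structural
   recursion: rewriting would make unification unfold the module structure. *)
Ltac tangent_ev t c i :=
  lazymatch t with
  | (?x + ?y)%R => let p := tangent_ev x c i in let q := tangent_ev y c i in
      constr:(etrans (tangent_evD x y c i) (f_equal2 +%R p q))
  | (- ?x)%R => let p := tangent_ev x c i in
      constr:(etrans (tangent_evN x c i) (f_equal -%R p))
  | (?a *: ?x)%R => let p := tangent_ev x c i in
      constr:(etrans (tangent_evZ a x c i) (f_equal ( *%R a) p))
  | 0%R => constr:(@tangent_ev0 _ _ _ _ _ c i : coords t c 0 i = 0)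
  | _ => constr:(erefl (coords t c 0 i))
  end.

Ltac tangent_ring :=
  let c := fresh "c" in let i := fresh "i" in
  lazymatch goal with |- ?x = ?y =>
    apply: tangent_ext => c i;
    let p := tangent_ev x c i in let q := tangent_ev y c i in
    refine (etrans p (etrans _ (esym q))); abstract_terms @fun_of_matrix; ring end.

Section QuaternionPoint.
Variables (R : realType) (M : topologicalType) (m : nat) (A : set (chart R M m)).
Variable Q : forall p : M, set (tangent A p -> tangent A p).
Variable p : M.
Local Notation Tp := (tangent A p).
Implicit Types (J : 'I_3 -> Tp -> Tp) (a b : 'I_3 -> R) (B C : Tp -> Tp).

Lemma linear_lin B : linear B -> forall (a : R) (x y : Tp), B (a *: x + y) = a *: B x + B y.
Proof. by move=> lB a x y; exact: lB. Qed.

Lemma linear_fD B : linear B -> forall x y, B (x + y) = B x + B y.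
Proof. by move=> lB x y; have := lB 1 x y; rewrite !scale1r. Qed.

Lemma linear_f0 B : linear B -> B 0 = 0.
Proof.
by move=> lB; apply: (addrI (B 0)); rewrite -(linear_fD lB) !addr0.
Qed.

Lemma linear_fZ B : linear B -> forall (a : R) x, B (a *: x) = a *: B x.
Proof. by move=> lB a x; rewrite -[in LHS](addr0 (a *: x)) lB linear_f0// addr0. Qed.

Lemma linear_fN B : linear B -> forall x, B (- x) = - B x.
Proof. by move=> lB x; rewrite -scaleN1r linear_fZ// scaleN1r. Qed.

Lemma linear_fB B : linear B -> forall x y, B (x - y) = B x - B y.
Proof. by move=> lB x y; rewrite linear_fD// linear_fN. Qed.

Lemma linear_f_sum B (I : Type) (r : seq I) (F : I -> Tp) : linear B ->
  B (\sum_(i <- r) F i) = \sum_(i <- r) B (F i).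
Proof.
move=> lB; elim: r => [|i r IH]; first by rewrite !big_nil linear_f0.
by rewrite !big_cons linear_fD// IH.
Qed.

(** Nested pairs let the nine products act together as one rewrite rule, and singly through
    projections. Four of them have to be derived, from the squares and the two products of the first
    two generators. *)
Lemma quat_table J : quaternion_triple J -> forall y,
  (J ord0 (J 1 y) = J ord_max y) * (J 1 (J ord0 y) = - J ord_max y) *
  (J 1 (J ord_max y) = J ord0 y) * (J ord_max (J 1 y) = - J ord0 y) *
  (J ord_max (J ord0 y) = J 1 y) * (J ord0 (J ord_max y) = - J 1 y) *
  (J ord0 (J ord0 y) = - y) * (J 1 (J 1 y) = - y) * (J ord_max (J ord_max y) = - y).
Proof.
move=> [lJ J2 J12 J21] y.
have e1 : J ord_max (J 1 y) = - J ord0 y by rewrite -J12 J2 linear_fN.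
have e2 : J ord0 (J ord_max y) = - J 1 y by rewrite -J12 J2.
have e3 : J ord_max (J ord0 y) = J 1 y by rewrite -J12 J21 linear_fN// e2 opprK.
have e4 : J 1 (J ord_max y) = J ord0 y.
  by rewrite -J12 J21 -J12 J2 linear_fN// opprK.
by rewrite J12 J21 e1 e2 e3 e4 !J2.
Qed.

Lemma lincomb_linear J a : quaternion_triple J -> linear (lincomb J a).
Proof.
move=> [lJ _ _ _] c x y; rewrite /lincomb scaler_sumr -big_split /=.
apply: eq_bigr => i _; by rewrite (lJ i) scalerDr !scalerA (mulrC c).
Qed.

(** The product of imaginary quaternions: vector part [cross a b], scalar part [- dot3 a b]. *)
Lemma quat_mul J a b : quaternion_triple J -> forall y,
  lincomb J a (lincomb J b y) = lincomb J (cross a b) y - dot3 a b *: y.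
Proof.
move=> qJ y; have [lJ _ _ _] := qJ.
rewrite /lincomb /dot3 !sum3 /cross /=.
rewrite !(linear_fD (lJ _)) !(linear_fZ (lJ _)) !(quat_table qJ) !scalerDr !scalerA !scalerN.
rewrite !scalerBl !scalerDl.
tangent_ring.
Qed.

Lemma admissible_linear J B : admissible_basis Q J -> Q B -> linear B.
Proof. by move=> [qJ QJ] /QJ[a ->]; exact: lincomb_linear. Qed.

Lemma lincombE J a y : lincomb J a y = a ord0 *: J ord0 y + a 1 *: J 1 y + a ord_max *: J ord_max y.
Proof. by rewrite /lincomb sum3. Qed.

Lemma dot3C a b : dot3 a b = dot3 b a.
Proof. by apply: eq_bigr => i _; exact: mulrC. Qed.

Lemma crossC a b i : cross a b i = - cross b a i.
Proof. by move: i; apply: ord3P; rewrite /cross /=; ring. Qed.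

Lemma quat_anticomm J a b : quaternion_triple J -> forall y,
  lincomb J a (lincomb J b y) + lincomb J b (lincomb J a y) = - (2 * dot3 a b) *: y.
Proof.
move=> qJ y; rewrite !quat_mul// !lincombE !(crossC b a) (dot3C b a).
tangent_ring.
Qed.

Hypothesis Hp : exists y : Tp, y != 0.

Lemma scale_inj (r s : R) : (forall y : Tp, r *: y = s *: y) -> r = s.
Proof.
have [y y0] := Hp; move=> /(_ y)/eqP; rewrite -subr_eq0 -scalerBl scaler_eq0.
by rewrite (negPf y0) orbF subr_eq0 => /eqP.
Qed.

(** The relation B C + C B = - 2 <B, C> Id mentions no basis. As the tangent space is nonzero it
    determines the scalar, so all admissible bases define the same metric. *)
Lemma qdot_lincomb J a b : admissible_basis Q J ->
  qdot Q (lincomb J a) (lincomb J b) = dot3 a b.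
Proof.
move=> aJ; apply: the_eq; first by exists J, a, b.
move=> r [J' [a' [b' [[qJ' _] aE bE ->]]]]; have [qJ _] := aJ.
apply: scale_inj => y.
have := quat_anticomm a b qJ y; rewrite aE bE (quat_anticomm a' b' qJ' y) => /eqP.
rewrite !scaleNr eqr_opp -!scalerA => /eqP/scalerI; apply.
by rewrite pnatr_eq0.
Qed.

Lemma lincomb_Q J a : admissible_basis Q J -> Q (lincomb J a).
Proof. by move=> [_ QJ]; apply/QJ; exists a. Qed.

Lemma lincomb_inj J a b : admissible_basis Q J -> lincomb J a = lincomb J b -> a = b.
Proof.
move=> aJ ab; apply/funext => i.
have H (c : 'I_3 -> R) : dot3 (fun j => (j == i)%:R) c = c i.
  rewrite /dot3 (bigD1 i)//= eqxx mul1r big1 ?addr0// => j /negPf ->.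
  by rewrite mul0r.
by rewrite -(H a) -(H b) -!(qdot_lincomb _ _ aJ) ab.
Qed.

Lemma lincomb_delta J i : lincomb J (fun j => (j == i)%:R) = J i.
Proof.
apply/funext => y; rewrite /lincomb (bigD1 i)//= eqxx scale1r big1 ?addr0// => j /negPf ->.
by rewrite scale0r.
Qed.

Lemma basis_Q J i : admissible_basis Q J -> Q (J i).
Proof. by move=> aJ; rewrite -lincomb_delta; exact: lincomb_Q. Qed.

Lemma qdot_basis J i a : admissible_basis Q J -> qdot Q (J i) (lincomb J a) = a i.
Proof.
move=> aJ; rewrite -{1}lincomb_delta qdot_lincomb// /dot3 (bigD1 i)//= eqxx mul1r.
by rewrite big1 ?addr0// => j /negPf ->; rewrite mul0r.
Qed.

Lemma qdot_basisE J i j : admissible_basis Q J -> qdot Q (J i) (J j) = (i == j)%:R.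
Proof. by move=> aJ; rewrite -(lincomb_delta J j) qdot_basis. Qed.

Lemma Q_expand J B : admissible_basis Q J -> Q B ->
  B = lincomb J (fun i => qdot Q (J i) B).
Proof.
move=> aJ; have [_ QJ] := aJ; move=> /QJ[a ->]; congr lincomb.
by apply/funext => i; rewrite qdot_basis.
Qed.

Lemma qdot_anticomm J B C y : admissible_basis Q J -> Q B -> Q C ->
  B (C y) + C (B y) = - (2 * qdot Q B C) *: y.
Proof.
move=> aJ /(Q_expand aJ) -> /(Q_expand aJ) ->.
by have [qJ _] := aJ; rewrite qdot_lincomb// quat_anticomm.
Qed.

Lemma qdot_dot J B C : admissible_basis Q J -> Q B -> Q C ->
  qdot Q B C = dot3 (fun i => qdot Q (J i) B) (fun i => qdot Q (J i) C).
Proof.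
by move=> aJ QB QC; rewrite {1}(Q_expand aJ QB) {1}(Q_expand aJ QC) qdot_lincomb.
Qed.

Lemma qdotC J B C : admissible_basis Q J -> Q B -> Q C -> qdot Q B C = qdot Q C B.
Proof. by move=> aJ QB QC; rewrite (qdot_dot aJ QB QC) (qdot_dot aJ QC QB) dot3C. Qed.

Lemma Q_lincomb2 J B C (a : R) : admissible_basis Q J -> Q B -> Q C -> Q (a *: B + C).
Proof.
move=> aJ; have [_ QJ] := aJ; move=> /QJ[b ->] /QJ[c ->]; apply/QJ.
exists (fun i => a * b i + c i); apply/funext => y.
rewrite -[LHS]/(a *: lincomb J b y + lincomb J c y) !lincombE; tangent_ring.
Qed.

Lemma qdot_lin J B C B' (a : R) : admissible_basis Q J -> Q B -> Q C -> Q B' ->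
  qdot Q B' (a *: B + C) = a * qdot Q B' B + qdot Q B' C.
Proof.
move=> aJ; have [_ QJ] := aJ; move=> /QJ[b ->] /QJ[c ->] /QJ[b' ->].
have -> : a *: lincomb J b + lincomb J c = lincomb J (fun i => a * b i + c i).
  apply/funext => y; rewrite -[LHS]/(a *: lincomb J b y + lincomb J c y) !lincombE; tangent_ring.
by rewrite !qdot_lincomb// /dot3 !sum3; ring.
Qed.

Lemma Q0 J : admissible_basis Q J -> Q (0 : Tp -> Tp).
Proof.
move=> aJ; have [_ QJ] := aJ; apply/QJ; exists (fun=> 0).
by apply/funext => y; rewrite lincombE !scale0r !addr0.
Qed.

Lemma QZ J B (a : R) : admissible_basis Q J -> Q B -> Q (a *: B).
Proof. by move=> aJ QB; rewrite -[_ *: _]addr0; apply: (Q_lincomb2 _ aJ) => //; exact: Q0 aJ. Qed.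

Lemma QD J B C : admissible_basis Q J -> Q B -> Q C -> Q (B + C).
Proof. by move=> aJ QB QC; rewrite -[B]scale1r; exact: Q_lincomb2 aJ _ _. Qed.

Lemma qdotZ J B B' (a : R) : admissible_basis Q J -> Q B -> Q B' ->
  qdot Q B' (a *: B) = a * qdot Q B' B.
Proof.
move=> aJ QB QB'; rewrite -[a *: B]addr0 (qdot_lin _ aJ)//; last exact: Q0 aJ.
have -> : (0 : Tp -> Tp) = lincomb J (fun=> 0).
  by apply/funext => y; rewrite lincombE !scale0r !addr0.
rewrite (Q_expand aJ QB') qdot_lincomb// /dot3 !sum3; ring.
Qed.

Lemma qdotD J B C B' : admissible_basis Q J -> Q B -> Q C -> Q B' ->
  qdot Q B' (B + C) = qdot Q B' B + qdot Q B' C.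
Proof. by move=> aJ QB QC QB'; rewrite -[B]scale1r (qdot_lin _ aJ)// scale1r mul1r. Qed.

Lemma qdot_sqr J B y : admissible_basis Q J -> Q B -> B (B y) = - qdot Q B B *: y.
Proof.
move=> aJ /(Q_expand aJ) ->; have [qJ _] := aJ.
rewrite qdot_lincomb// quat_mul// lincombE /cross /=.
tangent_ring.
Qed.

Lemma Q_comp J B C : admissible_basis Q J -> Q B -> Q C -> qdot Q B C = 0 ->
  B \o C = lincomb J (cross (fun i => qdot Q (J i) B) (fun i => qdot Q (J i) C)).
Proof.
move=> aJ QB QC BC; apply/funext => y /=; have [qJ _] := aJ.
rewrite {1}(Q_expand aJ QB) {1}(Q_expand aJ QC) quat_mul//.
by rewrite -(qdot_dot aJ QB QC) BC scale0r subr0.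
Qed.

(* Completes a unit vector to an admissible basis, by the linear change of
   basis with rows a, b, cross a b. *)
Lemma rotate_basis J a b : admissible_basis Q J ->
  dot3 a a = 1 -> dot3 b b = 1 -> dot3 a b = 0 ->
  admissible_basis Q (fun i => if i == ord0 then lincomb J a else
     if i == 1 then lincomb J b else lincomb J (cross a b)).
Proof.
move=> aJ aa bb ab; have [qJ QJ] := aJ.
have ca : dot3 (cross a b) (cross a b) = 1.
  move: aa bb ab; rewrite /dot3 !sum3 /cross /=.
  move: (a ord0) (a 1) (a ord_max) (b ord0) (b 1) (b ord_max) => x y z u v w aa bb ab.
  (* Lagrange's identity for the squared norm of a cross product. *)
  transitivity ((x * x + y * y + z * z) * (u * u + v * v + w * w) - (x * u + y * v + z * w) ^+ 2); first by ring.
  by rewrite aa bb ab; ring.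
split; first split.
- by move=> i; case: ifP => _; [|case: ifP => _]; exact: lincomb_linear.
- have H d : dot3 d d = 1 -> forall x, lincomb J d (lincomb J d x) = - x.
    move=> dd x; rewrite quat_mul// dd lincombE /cross /=; tangent_ring.
  by move=> i x; case: ifP => _; [|case: ifP => _]; exact: H.
- by move=> x /=; rewrite quat_mul// ab scale0r subr0.
- move=> x /=; rewrite quat_mul// dot3C ab scale0r subr0 !lincombE !(crossC b a).
  tangent_ring.
- move=> B; split.
    move=> /QJ[d ->]; exists (fun i => if i == ord0 then dot3 d a else if i == 1 then dot3 d b
       else dot3 d (cross a b)).
    apply/funext => y; rewrite !lincombE /= !lincombE.
    have E i : d i = dot3 d a * a i + dot3 d b * b i + dot3 d (cross a b) * cross a b i.
      pose N : 'M[R]_3 := \matrix_(i, j) (if i == ord0 then a j else if i == 1 then b j else cross a b j).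
      have NN : N *m N^T = 1%:M.
        apply/matrixP => i0 j0; rewrite !mxE; transitivity (dot3 (N i0) (N j0)).
          by apply: eq_bigr => l _; rewrite [N^T _ _]mxE.
        have c1 : dot3 a (cross a b) = 0 by rewrite /dot3 sum3 /cross /=; ring.
        have c2 : dot3 b (cross a b) = 0 by rewrite /dot3 sum3 /cross /=; ring.
        have NE i1 : N i1 =1 (if i1 == ord0 then a else if i1 == 1 then b else cross a b).
          by move=> l; rewrite /N mxE; case: ifP => // _; case: ifP.
        have -> : dot3 (N i0) (N j0) = dot3 (if i0 == ord0 then a else if i0 == 1 then b else cross
          a b) (if j0 == ord0 then a else if j0 == 1 then b else cross a b).
          by apply: eq_bigr => l _; rewrite !NE.
        move: i0 j0; apply: ord3P; apply: ord3P; rewrite /= ?aa ?bb ?ab ?ca ?c1 ?c2 ?(dot3C b a) ?ab //.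
        - by rewrite dot3C c1.
        - by rewrite dot3C c2.
      (* For square matrices [N *m N^T = 1] implies [N^T *m N = 1], and the latter is the expansion
         of [d] along the orthonormal rows a, b, cross a b. *)
      have := mulmx1C NN => /matrixP NN'.
      transitivity (\sum_j d j * (N^T *m N) j i).
        rewrite (bigD1 i)//= NN' mxE eqxx mulr1 big1 ?addr0// => j ji.
        by rewrite NN' mxE (negPf ji) mulr0.
      by rewrite /dot3 !sum3 !mxE !sum3 !mxE /=; ring.
    rewrite (E ord0) (E 1) (E ord_max).
    tangent_ring.
  move=> [d ->]; apply/QJ.
  exists (fun i => d ord0 * a i + d 1 * b i + d ord_max * cross a b i).
  by apply/funext => y; rewrite !lincombE /= !lincombE; tangent_ring.
Qed.

Lemma orthogonal_unit a : dot3 a a = 1 -> exists b, dot3 b b = 1 /\ dot3 a b = 0.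
Proof.
move=> aa; have [n0|n0] := eqVneq (a ord0 ^+ 2 + a 1 ^+ 2) 0.
  have := sqr_ge0 (a ord0); have := sqr_ge0 (a 1) => h1 h0.
  have e0 : a ord0 = 0 by apply/eqP; rewrite -sqrf_eq0; apply/eqP; lra.
  exists (fun i => (i == ord0)%:R); rewrite /dot3 !sum3 /= e0; split; ring.
pose s := (Num.sqrt (a ord0 ^+ 2 + a 1 ^+ 2))^-1.
have sP : s ^+ 2 * (a ord0 ^+ 2 + a 1 ^+ 2) = 1.
  rewrite exprVn sqr_sqrtr; first by rewrite mulVf.
  by rewrite addr_ge0 ?sqr_ge0.
exists (fun i => if i == ord0 then - (s * a 1) else if i == 1 then s * a ord0 else 0).
by rewrite /dot3 !sum3 /=; split; [rewrite -sP|]; ring.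
Qed.

End QuaternionPoint.

(** * Quaternionic connections and their curvature *)

Section VfieldAlgebra.
Variables (R : realType) (X : Type) (k : nat) (A : set (chart R X k)).
Hypothesis As : smooth_atlas A.
Implicit Types (x : X) (U V : vfield A).

Lemma smooth_vfieldD x U V : smooth_vfield A U x -> smooth_vfield A V x ->
  smooth_vfield A (fun y => U y + V y) x.
Proof.
have [c xc] := atlas_cover As x.
move=> /(smooth_vfieldP As _ xc) sU /(smooth_vfieldP As _ xc) sV.
apply/(smooth_vfieldP As _ xc) => i.
apply: (smooth_fun_eq _ (smooth_funD (sU i) (sV i))).
by apply: near_ptT => y; rewrite tangent_evD.
Qed.

Lemma smooth_vfieldZ x f U : smooth_fun A f x -> smooth_vfield A U x ->
  smooth_vfield A (fun y => f y *: U y) x.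
Proof.
have [c xc] := atlas_cover As x.
move=> sf /(smooth_vfieldP As _ xc) sU.
apply/(smooth_vfieldP As _ xc) => i.
apply: (smooth_fun_eq _ (smooth_funM sf (sU i))).
by apply: near_ptT => y; rewrite tangent_evZ.
Qed.

Lemma smooth_vfield0 x : smooth_vfield A (fun y => 0 : tangent A y) x.
Proof.
have [c xc] := atlas_cover As x; apply/(smooth_vfieldP As _ xc) => i.
apply: (smooth_fun_eq _ (smooth_fun_cst 0)).
by apply: near_ptT => y; rewrite (@tangent_ev0 _ _ _ A).
Qed.

Lemma smooth_vfield_sum x (I : Type) (r : seq I) (F : I -> vfield A) :
  (forall i, smooth_vfield A (F i) x) ->
  smooth_vfield A (fun y => \sum_(i <- r) F i y) x.
Proof.
move=> sF; elim: r => [|i r IH].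
  apply: (smooth_vfield_eq _ (@smooth_vfield0 x)).
  by apply: near_ptT => y; rewrite big_nil.
apply: (smooth_vfield_eq _ (smooth_vfieldD (sF i) IH)).
by apply: near_ptT => y; rewrite big_cons.
Qed.

Lemma smooth_vfieldB x U V : smooth_vfield A U x -> smooth_vfield A V x ->
  smooth_vfield A (fun y => U y - V y) x.
Proof.
move=> sU sV.
have := smooth_vfieldD sU (smooth_vfieldZ (smooth_fun_cst (-1)) sV).
by apply: smooth_vfield_eq; apply: near_ptT => y; rewrite scaleN1r.
Qed.

End VfieldAlgebra.

Section Connection.
Variables (R : realType) (M : topologicalType) (m : nat) (A : set (chart R M m)).
Variable D : affine_connection A.
Hypothesis As : smooth_atlas A.
Hypothesis CD : is_connection (E := fun p => tangent A p) (smooth_vfield A) D.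
Implicit Types (p q : M) (U V Y Z : vfield A).

Lemma conn_linv p a (v w : tangent A p) Y : smooth_vfield A Y p ->
  D (a *: v + w) Y = a *: D v Y + D w Y.
Proof. by case: CD => H _ _ _ _ sY; exact: H. Qed.

Lemma connD p (v : tangent A p) Y Z : smooth_vfield A Y p -> smooth_vfield A Z p ->
  D v (fun q => Y q + Z q) = D v Y + D v Z.
Proof. by case: CD => _ H _ _ _ sY sZ; exact: H. Qed.

Lemma conn_leibniz p (v : tangent A p) f Y : smooth_fun A f p -> smooth_vfield A Y p ->
  D v (fun q => f q *: Y q) = dird v f *: Y p + f p *: D v Y.
Proof. by case: CD => _ _ H _ _ sf sY; exact: H. Qed.

Lemma conn_eq p (v : tangent A p) Y Z : near_pt A p (fun q => Y q = Z q) ->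
  smooth_vfield A Y p -> D v Y = D v Z.
Proof.
case: CD => _ _ _ H _ YZ sY; apply: H => //.
exact: smooth_vfield_eq YZ sY.
Qed.

Lemma conn_smooth p U Y : smooth_vfield A U p -> smooth_vfield A Y p ->
  smooth_vfield A (fun q => D (U q) Y) p.
Proof. by case: CD => _ _ _ _ H; exact: H. Qed.

Lemma conn0 p (v : tangent A p) : D v (fun=> 0) = 0.
Proof.
have s0 := @smooth_vfield0 _ _ _ _ As p.
have := connD v s0 s0; rewrite (_ : (fun q => 0 + 0) = fun=> 0).
  by move/eqP; rewrite -subr_eq subrr eq_sym => /eqP.
by apply: functional_extensionality_dep => q; rewrite addr0.
Qed.

Lemma connZ p (v : tangent A p) (a : R) Y : smooth_vfield A Y p ->
  D v (fun q => a *: Y q) = a *: D v Y.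
Proof.
move=> sY; rewrite (@conn_leibniz p v (fun=> a))//; last exact: smooth_fun_cst.
by rewrite dird_cst// scale0r add0r.
Qed.

Lemma conn_sum p (v : tangent A p) (I : Type) (r : seq I) (F : I -> vfield A) :
  (forall i, smooth_vfield A (F i) p) ->
  D v (fun q => \sum_(i <- r) F i q) = \sum_(i <- r) D v (F i).
Proof.
move=> sF; elim: r => [|i r IH].
  rewrite big_nil -[RHS](conn0 v); congr (D v).
  by apply: functional_extensionality_dep => q; rewrite big_nil.
rewrite big_cons -IH -connD//; last exact: smooth_vfield_sum.
by congr (D v); apply: functional_extensionality_dep => q; rewrite big_cons.
Qed.

Definition near_linear (B : forall q, tangent A q -> tangent A q) p :=
  near_pt A p (fun q => linear (B q)).

(** Tensoriality: when [Y] is expanded along the coordinate fields, the derivatives of its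
    coefficients cancel between the two terms. Only [Y p] remains, so the extension chosen in
    [endo_conn] does not matter. *)
Lemma endo_conn_expand p c (v : tangent A p) (B : forall q, tangent A q -> tangent A q) Y :
  chart_at A p c -> smooth_endo B p -> near_linear B p -> smooth_vfield A Y p ->
  D v (fun q => B q (Y q)) - B p (D v Y) =
  \sum_i Y p c 0 i *: (D v (fun q => B q (coord_field As c i q)) - B p (D v (coord_field As c i))).
Proof.
move=> pc sB lB sY.
have lBp := near_pt_self As lB.
have sYi := (smooth_vfieldP As _ pc).1 sY.
have sE i : smooth_vfield A (coord_field As c i) p by exact: smooth_coord_field.
have sYE i : smooth_vfield A (fun q => Y q c 0 i *: coord_field As c i q) p.
  by apply: smooth_vfieldZ.
have sYBE i : smooth_vfield A (fun q => Y q c 0 i *: B q (coord_field As c i q)) p.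
  by apply: smooth_vfieldZ => //; exact: sB.
have e1 : D v Y = \sum_i (dird v (fun q => Y q c 0 i) *: coord_field As c i p
    + Y p c 0 i *: D v (coord_field As c i)).
  rewrite -(@conn_eq p v (fun q => \sum_i Y q c 0 i *: coord_field As c i q)).
  - by rewrite conn_sum//; apply: eq_bigr => i _; rewrite conn_leibniz.
  - apply: (near_ptS (near_pt_chart As pc)) => q qc; exact: esym (tangent_sum As _ qc).
  - exact: smooth_vfield_sum.
have e2 : D v (fun q => B q (Y q)) = \sum_i (dird v (fun q => Y q c 0 i) *: B p (coord_field As c i p)
    + Y p c 0 i *: D v (fun q => B q (coord_field As c i q))).
  rewrite -(@conn_eq p v (fun q => \sum_i Y q c 0 i *: B q (coord_field As c i q))).
  - rewrite conn_sum//; apply: eq_bigr => i _; rewrite conn_leibniz//; exact: sB.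
  - apply: (near_ptS2 (near_pt_chart As pc) lB) => q qc lq.
    rewrite [in RHS](tangent_sum As (Y q) qc) (linear_f_sum _ _ lq).
    by apply: eq_bigr => i _; rewrite (linear_fZ lq).
  - exact: smooth_vfield_sum.
rewrite e1 e2 (linear_f_sum _ _ lBp) -sumrB; apply: eq_bigr => i _.
rewrite (linear_fD lBp) !(linear_fZ lBp); tangent_ring.
Qed.

Lemma endo_connE p (v : tangent A p) (B : forall q, tangent A q -> tangent A q) Y :
  smooth_endo B p -> near_linear B p -> smooth_vfield A Y p ->
  endo_conn D v B (Y p) = D v (fun q => B q (Y q)) - B p (D v Y).
Proof.
move=> sB lB sY; have [c pc] := atlas_cover As p.
have [sX Xp] := extensionP As (Y p).
by rewrite /endo_conn !(endo_conn_expand v pc sB lB)// Xp.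
Qed.

End Connection.

(** The facts from which everything up to the criterion for the Chern condition is derived.
    [qs_open] links the topology of [M] to its charts, and [qs_dim] makes tangent spaces nonzero;
    the sharper bound on the dimension appears separately, in the Ricci computation. *)
Record quaternionic_setting (R : realType) (M : topologicalType) (m : nat)
    (A : set (chart R M m)) (Q : forall p : M, set (tangent A p -> tangent A p))
    (D : affine_connection A) : Prop := QuaternionicSetting {
  qs_atlas : smooth_atlas A;
  qs_open : forall (W : set M) p, open W -> W p -> near_pt A p W;
  qs_dim : (0 < m)%N;
  qs_frame : forall p, exists W F, W p /\ admissible_frame Q W F;
  qs_conn : quaternionic_connection Q D }.

Section QSections.
Variables (R : realType) (M : topologicalType) (m : nat) (A : set (chart R M m)).
Variable Q : forall p : M, set (tangent A p -> tangent A p).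
Variable D : affine_connection A.
Hypothesis QS : quaternionic_setting Q D.
Let As := qs_atlas QS.
Let near_open := qs_open QS.
Let m_gt0 := qs_dim QS.
Let QF := qs_frame QS.
Let QC := qs_conn QS.
Implicit Types (p q : M) (U V Y Z : vfield A).
Local Notation endo := (forall q, tangent A q -> tangent A q).
Implicit Types (B C : endo).

Let CD : is_connection (E := fun p => tangent A p) (smooth_vfield A) D.
Proof. by case: QC. Qed.

Lemma Qbasis p : exists J : 'I_3 -> tangent A p -> tangent A p, admissible_basis Q J.
Proof.
by have [W [F [Wp [oW HF]]]] := QF p; exists (fun i => F i p); have [] := HF _ Wp.
Qed.

Lemma tangent_nonzero p : exists y : tangent A p, y != 0.
Proof.
have [c pc] := atlas_cover As p; exists (tangent_of As c p (delta_mx 0 (Ordinal m_gt0))).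
apply/eqP => /(congr1 (fun y : tangent A p => y c 0 (Ordinal m_gt0))).
by rewrite tangent_ofE// tangent_ev0 mxE !eqxx => /eqP; rewrite oner_eq0.
Qed.

Lemma Q_linear p (B : tangent A p -> tangent A p) : Q B -> linear B.
Proof. by have [J aJ] := Qbasis p; exact: admissible_linear aJ. Qed.

Definition Qsec B p := smooth_endo B p /\ near_pt A p (fun q => Q (B q)).

Lemma Qsec_linear B p : Qsec B p -> near_linear B p.
Proof. by move=> [_ QB]; apply: (near_ptS QB) => q; exact: Q_linear. Qed.

Lemma Qsec_at B p : Qsec B p -> Q (B p).
Proof. by move=> [_ QB]; exact: near_pt_self QB. Qed.

Lemma frame_Qsec W (F : 'I_3 -> endo) p i : admissible_frame Q W F -> W p -> Qsec (F i) p.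
Proof.
move=> [oW HF] Wp; split; first by have [_] := HF p Wp; apply.
apply: (near_ptS (near_open oW Wp)) => q Wq.
by have [aF _] := HF q Wq; exact: (basis_Q i aF).
Qed.

Lemma frame_basis W (F : 'I_3 -> endo) p : admissible_frame Q W F -> W p ->
  admissible_basis Q (fun i => F i p).
Proof. by move=> [_ HF] Wp; have [] := HF p Wp. Qed.

Lemma near_frame W (F : 'I_3 -> endo) p : admissible_frame Q W F -> W p -> near_pt A p W.
Proof. by move=> [oW _] Wp; exact: near_open. Qed.

Lemma smooth_endo_lincomb (I : finType) (F : I -> endo) (a : I -> M -> R) p :
  (forall i, smooth_endo (F i) p) -> (forall i, smooth_fun A (a i) p) ->
  smooth_endo (fun q y => \sum_i a i q *: F i q y) p.
Proof.
move=> sF sa Y sY; apply: smooth_vfield_sum => // i.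
by apply: smooth_vfieldZ => //; exact: sF.
Qed.

Lemma Qsec_lincomb W (F : 'I_3 -> endo) (a : 'I_3 -> M -> R) p :
  admissible_frame Q W F -> W p -> (forall i, smooth_fun A (a i) p) ->
  Qsec (fun q => lincomb (fun i => F i q) (fun i => a i q)) p.
Proof.
move=> aF Wp sa; split.
  by apply: smooth_endo_lincomb => // i; have [] := frame_Qsec i aF Wp.
apply: (near_ptS (near_frame aF Wp)) => q Wq.
exact: lincomb_Q (frame_basis aF Wq).
Qed.

(** The metric is read off from the anticommutator: B C + C B applied to a coordinate field is - 2
    <B, C> times that field, whose own component is 1. Hence the factor - 1/2. *)
Lemma smooth_qdot B C p : Qsec B p -> Qsec C p -> smooth_fun A (fun q => qdot Q (B q) (C q)) p.
Proof.
move=> SB SC; have [c pc] := atlas_cover As p.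
pose i0 := Ordinal m_gt0; pose E := coord_field As c i0.
have sE : smooth_vfield A E p by exact: smooth_coord_field.
have sBC : smooth_vfield A (fun q => B q (C q (E q)) + C q (B q (E q))) p.
  case: SB SC => [sB _] [sC _]; apply: smooth_vfieldD => //.
    by apply: sB; exact: sC.
  by apply: sC; exact: sB.
have := smooth_funM (smooth_fun_cst (- 2^-1)) ((smooth_vfieldP As _ pc).1 sBC i0).
apply: smooth_fun_eq; case: SB SC => [_ QB] [_ QC'].
apply: (near_ptS3 (near_pt_chart As pc) QB QC') => q qc QBq QCq.
have [J aJ] := Qbasis q.
rewrite (qdot_anticomm (tangent_nonzero q) (E q) aJ QBq QCq) tangent_evZ /E /coord_field tangent_ofE//.
by rewrite mxE !eqxx mulr1; field.
Qed.

Section EndoConn.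
Variables (p : M) (v : tangent A p).

Lemma Qsec_endo_connE B Y : Qsec B p -> smooth_vfield A Y p ->
  endo_conn D v B (Y p) = D v (fun q => B q (Y q)) - B p (D v Y).
Proof.
move=> SB; apply: endo_connE => //; last exact: Qsec_linear.
by case: SB.
Qed.

Lemma Qsec_conn_app B Y : Qsec B p -> smooth_vfield A Y p ->
  D v (fun q => B q (Y q)) = endo_conn D v B (Y p) + B p (D v Y).
Proof. by move=> SB sY; rewrite Qsec_endo_connE// subrK. Qed.

Lemma endo_conn_Q B : Qsec B p -> Q (endo_conn D v B).
Proof. by case: QC => _ _ H [sB QB]; exact: H. Qed.

Lemma endo_conn_lincomb W (F : 'I_3 -> endo) (a : 'I_3 -> M -> R) :
  admissible_frame Q W F -> W p -> (forall i, smooth_fun A (a i) p) ->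
  endo_conn D v (fun q => lincomb (fun i => F i q) (fun i => a i q)) =
  \sum_i (dird v (a i) *: F i p + a i p *: endo_conn D v (F i)).
Proof.
move=> aF Wp sa; apply/funext => y.
have [sX Xp] := extensionP As y; set X := extension y in sX Xp.
have sF i Z : smooth_vfield A Z p -> smooth_vfield A (fun q => F i q (Z q)) p.
  by move=> sZ; have [sFi _] := frame_Qsec i aF Wp; exact: sFi.
rewrite {1}/endo_conn /lincomb -/X (conn_sum As CD); last first.
  by move=> i; apply: smooth_vfieldZ => //; exact: sF.
rewrite fct_sumE -sumrB; apply: eq_bigr => i _.
rewrite (conn_leibniz CD) ?Xp; [|exact: sa|exact: sF].
rewrite -[RHS]/(dird v (a i) *: F i p y + a i p *: endo_conn D v (F i) y).
rewrite /endo_conn -/X; tangent_ring.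
Qed.

(** Obtained by differentiating (B C + C B) X = - 2 <B, C> X along [v]. The terms in D_v X cancel by
    the same relation at [p], and the others are anticommutators of [B] and [C] with their
    derivatives, that is, values of the metric. *)
Lemma qdot_metric B C : Qsec B p -> Qsec C p ->
  dird v (fun q => qdot Q (B q) (C q)) =
  qdot Q (endo_conn D v B) (C p) + qdot Q (B p) (endo_conn D v C).
Proof.
move=> SB SC; have [J aJ] := Qbasis p; have Hp := tangent_nonzero p.
have QB := Qsec_at SB; have QCp := Qsec_at SC.
have QDB := endo_conn_Q SB; have QDC := endo_conn_Q SC.
apply: (scale_inj Hp) => y.
have [sX Xp] := extensionP As y; set X := extension y in sX Xp.
have sBX : smooth_vfield A (fun q => B q (X q)) p by case: SB => sB _; exact: sB.
have sCX : smooth_vfield A (fun q => C q (X q)) p by case: SC => sC _; exact: sC.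
have sBCX : smooth_vfield A (fun q => B q (C q (X q))) p by case: SB => sB _; exact: sB.
have sCBX : smooth_vfield A (fun q => C q (B q (X q))) p by case: SC => sC _; exact: sC.
have sg := smooth_qdot SB SC.
have e : D v (fun q => B q (C q (X q)) + C q (B q (X q))) =
    D v (fun q => (- 2 * qdot Q (B q) (C q)) *: X q).
  apply: (conn_eq CD); last exact: smooth_vfieldD.
  case: SB SC => _ nB [_ nC]; apply: (near_ptS2 nB nC) => q QBq QCq.
  have [J' aJ'] := Qbasis q.
  by rewrite (qdot_anticomm (tangent_nonzero q) (X q) aJ' QBq QCq) mulNr.
move: e; rewrite (connD CD)// (conn_leibniz CD)//; last first.
  by apply: smooth_funM => //; exact: smooth_fun_cst.
rewrite (dirdM As)//; last exact: smooth_fun_cst.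
rewrite dird_cst// mul0r add0r.
rewrite (Qsec_conn_app SB sCX) (Qsec_conn_app SC sBX) (Qsec_conn_app SB sX) (Qsec_conn_app SC sX).
rewrite !Xp (linear_fD (Q_linear QB)) (linear_fD (Q_linear QCp)).
have h1 := qdot_anticomm Hp y aJ QDB QCp.
have h2 := qdot_anticomm Hp y aJ QB QDC.
have h3 := qdot_anticomm Hp (D v X) aJ QB QCp.
move=> h.
have {h1 h2 h3 h} h : (- 2) *: (dird v (fun q => qdot Q (B q) (C q)) *: y) =
    (- 2) *: ((qdot Q (endo_conn D v B) (C p) + qdot Q (B p) (endo_conn D v C)) *: y).
  transitivity (((endo_conn D v B (C p y) + C p (endo_conn D v B y)) + (B p (endo_conn D v C y) +
    endo_conn D v C (B p y)))
    + (B p (C p (D v X)) + C p (B p (D v X))) - (- 2 * qdot Q (B p) (C p)) *: D v X).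
    rewrite scalerA; apply: (canRL (addrK _)); rewrite -h; tangent_ring.
  by rewrite h1 h2 h3; tangent_ring.
by apply: scalerI h; rewrite oppr_eq0 pnatr_eq0.
Qed.

End EndoConn.

Lemma endo_conn_linv p (a : R) (v w : tangent A p) B : Qsec B p ->
  endo_conn D (a *: v + w) B = a *: endo_conn D v B + endo_conn D w B.
Proof.
move=> SB; apply/funext => y; have [sX _] := extensionP As y.
rewrite -[RHS]/(a *: endo_conn D v B y + endo_conn D w B y) /endo_conn.
rewrite !(conn_linv CD)//; last by case: SB => sB _; exact: sB.
rewrite (linear_lin (Q_linear (Qsec_at SB))); tangent_ring.
Qed.

(** Smoothness at one point is a statement about all fields smooth there. It spreads to nearby
    points through the finitely many images of coordinate fields, from which a linear [B] is
    recovered. *)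
Lemma smooth_endo_near B p : smooth_endo B p -> near_linear B p ->
  near_pt A p (smooth_endo B).
Proof.
move=> sB lB; have [c pc] := atlas_cover As p.
have sE i : smooth_vfield A (fun q => B q (coord_field As c i q)) p.
  by apply: sB; exact: smooth_coord_field.
have nE : near_pt A p (fun q => forall i, smooth_vfield A (fun q => B q (coord_field As c i q)) q).
  apply: (near_pt_forall (P := fun i => smooth_vfield A (fun q => B q (coord_field As c i q)))) => i.
  exact: smooth_vfield_near.
apply: (near_ptS3 (near_pt_chart As pc) nE (near_pt_near As lB)) => q qc sEq lBq Y sY.
apply: (smooth_vfield_eq (U := fun q => \sum_i Y q c 0 i *: B q (coord_field As c i q))).
  apply: (near_ptS2 (near_pt_chart As qc) lBq) => q' q'c lq.
  rewrite [in RHS](tangent_sum As (Y q') q'c) (linear_f_sum _ _ lq).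
  by apply: eq_bigr => i _; rewrite (linear_fZ lq).
apply: smooth_vfield_sum => // i; apply: smooth_vfieldZ => //.
exact: ((smooth_vfieldP As _ qc).1 sY).
Qed.

Lemma Qsec_near B p : Qsec B p -> near_pt A p (Qsec B).
Proof.
move=> SB; have [sB QB] := SB.
apply: (near_ptS2 (smooth_endo_near sB (Qsec_linear SB)) (near_pt_near As QB)).
by move=> q; split.
Qed.

Lemma endo_conn_smooth p U B : smooth_vfield A U p -> Qsec B p ->
  Qsec (fun q => endo_conn D (U q) B) p.
Proof.
move=> sU SB; split.
  move=> Y sY.
  apply: (smooth_vfield_eq (U := fun q => D (U q) (fun q => B q (Y q)) - B q (D (U q) Y))).
    apply: (near_ptS2 (Qsec_near SB) (smooth_vfield_near As sY)) => q SBq sYq.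
    by rewrite -Qsec_endo_connE.
  case: SB => sB _; apply: smooth_vfieldB => //.
    by apply: (conn_smooth CD) => //; exact: sB.
  by apply: sB; exact: (conn_smooth CD).
by apply: (near_ptS (Qsec_near SB)) => q SBq; exact: endo_conn_Q.
Qed.

Section Frame.
Variables (W : set M) (F : 'I_3 -> endo).
Arguments F : clear implicits.
Hypothesis aF : admissible_frame Q W F.

(** The matrix of connection 1-forms of Q in the frame: D_v F_j is the sum over i of
    [conn_form i j v] times F_i. Orthonormality of the frame makes it antisymmetric. *)
Definition conn_form i j p (v : tangent A p) : R :=
  qdot Q (F i p) (endo_conn D v (F j)).

Lemma endo_conn_frame p (v : tangent A p) j : W p ->
  endo_conn D v (F j) = lincomb (fun i => F i p) (fun i => conn_form i j v).
Proof.
move=> Wp; apply: (Q_expand (tangent_nonzero p) (frame_basis aF Wp)).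
by apply: endo_conn_Q; exact: (frame_Qsec _ aF Wp).
Qed.

Lemma conn_form_anti p (v : tangent A p) i j : W p -> conn_form i j v = - conn_form j i v.
Proof.
move=> Wp; have SF l := frame_Qsec l aF Wp.
have aJ := frame_basis aF Wp.
have := qdot_metric v (SF i) (SF j).
rewrite -(@dird_eq _ _ _ _ As p v (fun=> (i == j)%:R)).
- rewrite dird_cst// => /esym/eqP; rewrite addr_eq0 => /eqP h.
  rewrite /conn_form -[LHS]opprK -h; congr (- _).
  by rewrite (qdotC (tangent_nonzero p) aJ)//; [exact: endo_conn_Q|exact: (basis_Q j aJ)].
- apply: (near_ptS (near_frame aF Wp)) => q Wq.
  by rewrite (qdot_basisE (tangent_nonzero q) _ _ (frame_basis aF Wq)).
- exact: smooth_fun_cst.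
Qed.

Lemma conn_form_lin p (a : R) (v w : tangent A p) i j : W p ->
  conn_form i j (a *: v + w) = a * conn_form i j v + conn_form i j w.
Proof.
move=> Wp; have SF l := frame_Qsec l aF Wp; have aJ := frame_basis aF Wp.
rewrite /conn_form endo_conn_linv// (qdot_lin (tangent_nonzero p) _ aJ)//.
- exact: endo_conn_Q.
- exact: endo_conn_Q.
- exact: (basis_Q i aJ).
Qed.

Lemma conn_form_sum p (I : Type) (r : seq I) (v : I -> tangent A p) i j : W p ->
  conn_form i j (\sum_(l <- r) v l) = \sum_(l <- r) conn_form i j (v l).
Proof.
move=> Wp; have h0 : conn_form i j (0 : tangent A p) = 0.
  have := conn_form_lin 1 0 (0 : tangent A p) i j Wp; rewrite scale1r addr0 mul1r.
  by move/eqP; rewrite -subr_eq subrr eq_sym => /eqP.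
elim: r => [|l r IH]; first by rewrite !big_nil.
by rewrite !big_cons -IH -[v l]scale1r conn_form_lin// mul1r scale1r.
Qed.

Lemma conn_form_smooth p U i j : W p -> smooth_vfield A U p ->
  smooth_fun A (fun q => conn_form i j (U q)) p.
Proof.
move=> Wp sU; apply: smooth_qdot; first exact: (frame_Qsec _ aF Wp).
by apply: endo_conn_smooth => //; exact: (frame_Qsec _ aF Wp).
Qed.

End Frame.

End QSections.

(** * Curvature through vector fields with constant coordinates *)

Section ConstFields.
Variables (R : realType) (X : Type) (k : nat) (A : set (chart R X k)).
Hypothesis As : smooth_atlas A.
Variable c : chart R X k.

(* The vector field with constant coordinates [u] in the chart [c]. *)
Definition cfield (u : 'rV[R]_k) : vfield A := fun q => tangent_of As c q u.

Lemma cfieldE q u : chart_at A q c -> cfield u q c = u.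
Proof. exact: tangent_ofE. Qed.

Lemma cfield_id q (x : tangent A q) : chart_at A q c -> cfield (x c) q = x.
Proof. by move=> qc; apply: (tangent_eqP qc); rewrite cfieldE. Qed.

Lemma cfield_lin q a u v : cfield (a *: u + v) q = a *: cfield u q + cfield v q.
Proof.
have [qc|nqc] := pselect (chart_at A q c).
  by apply: (tangent_eqP qc); rewrite tangent_lin !cfieldE.
by rewrite /cfield /tangent_of; case: pselect => // _; rewrite scaler0 addr0.
Qed.

Lemma cfield_smooth q u : chart_at A q c -> smooth_vfield A (cfield u) q.
Proof. exact: smooth_tangent_of. Qed.

Lemma cfield_coord i : cfield (delta_mx 0 i) = coord_field As c i.
Proof. by []. Qed.

Lemma dird_cfield q u f : chart_at A q c -> smooth_fun A f q ->
  dird (cfield u q) f = \sum_i u 0 i * dird (coord_field As c i q) f.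
Proof. by move=> qc sf; rewrite (dird_expand As _ qc)// cfieldE. Qed.

Lemma cfield_commute q u v f : chart_at A q c -> smooth_fun A f q ->
  dird (cfield u q) (fun y => dird (cfield v y) f) =
  dird (cfield v q) (fun y => dird (cfield u y) f).
Proof.
move=> qc sf.
have H u1 u2 : dird (cfield u1 q) (fun y => dird (cfield u2 y) f) =
   \sum_j \sum_i u2 0 j * (u1 0 i * dird (coord_field As c i q) (fun y => dird (coord_field As c j y) f)).
  have sE j : smooth_fun A (fun y => dird (coord_field As c j y) f) q.
    exact: smooth_dird_coord_field.
  rewrite -(@dird_eq _ _ _ _ As q _ (fun y => \sum_j u2 0 j * dird (coord_field As c j y) f)).
  - rewrite (dird_sum As); last by move=> j; apply: smooth_funM => //; exact: smooth_fun_cst.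
    apply: eq_bigr => j _; rewrite (dirdM As)//; last exact: smooth_fun_cst.
    by rewrite dird_cst// mul0r add0r dird_cfield// mulr_sumr.
  - apply: (near_ptS2 (near_pt_chart As qc) (smooth_fun_near As sf)) => y yc sfy.
    by rewrite dird_cfield.
  - by apply: smooth_fun_sum => j; apply: smooth_funM => //; exact: smooth_fun_cst.
rewrite !H exchange_big; apply: eq_bigr => j _; apply: eq_bigr => i _.
by rewrite (coord_field_commute As i j qc sf) mulrCA.
Qed.

Lemma lie_bracket_cfield q u v : chart_at A q c -> lie_bracket A (cfield u) (cfield v) q = 0.
Proof.
move=> qc; apply: (tangent_eq_dird As qc) => l.
have sc := smooth_fun_coord As l qc.
rewrite (lie_bracketP As)//; [|exact: cfield_smooth..].
by rewrite (cfield_commute u v qc sc) subrr dird0v.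
Qed.

End ConstFields.

Section Curvature.
Variables (R : realType) (M : topologicalType) (m : nat) (A : set (chart R M m)).
Variable D : affine_connection A.
Hypothesis As : smooth_atlas A.
Hypothesis CD : is_connection (E := fun p => tangent A p) (smooth_vfield A) D.
Variables (c : chart R M m) (p : M).
Hypothesis pc : chart_at A p c.
Implicit Types (x y z : tangent A p) (Z : vfield A).
Local Notation cf x := (cfield As c (coords x c)).

(** The three vectors are extended with constant coordinates in [c]. The extensions of [x] and [y]
    commute, which is why there is no bracket term. *)
Definition curv x y z : tangent A p :=
  D x (fun q => D (cf y q) (cf z)) - D y (fun q => D (cf x q) (cf z)).

Let cfx x : cf x p = x. Proof. exact: cfield_id. Qed.
Let scf x : smooth_vfield A (cf x) p. Proof. exact: cfield_smooth. Qed.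
Let sDcf x Z : smooth_vfield A Z p -> smooth_vfield A (fun q => D (cf x q) Z) p.
Proof. by move=> sZ; exact: (conn_smooth CD). Qed.

Let cf_lin q a x y : cf (a *: x + y) q = a *: cf x q + cf y q.
Proof. by rewrite tangent_lin cfield_lin. Qed.

Lemma curv_anti x y z : curv x y z = - curv y x z.
Proof. by rewrite /curv opprB. Qed.

Lemma curv_lin1 a x x' y z : curv (a *: x + x') y z = a *: curv x y z + curv x' y z.
Proof.
rewrite /curv (conn_linv CD); last exact: sDcf.
rewrite (@conn_eq _ _ _ _ D CD _ y (fun q => D (cf (a *: x + x') q) (cf z))
   (fun q => a *: D (cf x q) (cf z) + D (cf x' q) (cf z))).
- rewrite (connD CD) ?(connZ As CD); [tangent_ring|exact: sDcf| |exact: sDcf].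
  by apply: smooth_vfieldZ => //; [exact: smooth_fun_cst|exact: sDcf].
- apply: (near_ptS (near_pt_chart As pc)) => q qc.
  by rewrite cf_lin (conn_linv CD)//; exact: cfield_smooth.
- exact: sDcf.
Qed.

(** In the expansion of D_v D_w Z the second derivatives of the coefficients are symmetric because
    constant fields commute, and the products of first derivatives are symmetric as a whole.
    Antisymmetrizing leaves only the values of the coefficients at [p]. *)
Lemma curvE x y Z : smooth_vfield A Z p ->
  D x (fun q => D (cf y q) Z) - D y (fun q => D (cf x q) Z) =
  \sum_i Z p c 0 i *: (D x (fun q => D (cf y q) (coord_field As c i)) -
                       D y (fun q => D (cf x q) (coord_field As c i))).
Proof.
move=> sZ; have sZi := (smooth_vfieldP As _ pc).1 sZ.
have sE i : smooth_vfield A (coord_field As c i) p by exact: smooth_coord_field.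
have sdZ (w : tangent A p) i : smooth_fun A (fun q => dird (cf w q) (fun q => Z q c 0 i)) p.
  by apply: smooth_dird => //; exact: scf.
have H (v w : tangent A p) : D v (fun q => D (cf w q) Z) = \sum_i
   (dird v (fun q => dird (cf w q) (fun q => Z q c 0 i)) *: coord_field As c i p
    + dird w (fun q => Z q c 0 i) *: D v (coord_field As c i)
    + (dird v (fun q => Z q c 0 i) *: D w (coord_field As c i)
       + Z p c 0 i *: D v (fun q => D (cf w q) (coord_field As c i)))).
  rewrite -(@conn_eq _ _ _ _ D CD _ v (fun q => \sum_i (dird (cf w q) (fun q => Z q c 0 i) *: coord_field As c i q
      + Z q c 0 i *: D (cf w q) (coord_field As c i)))).
  - rewrite (conn_sum As CD); last first.
      by move=> i; apply: smooth_vfieldD => //; apply: smooth_vfieldZ => //; exact: sDcf.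
    apply: eq_bigr => i _; rewrite (connD CD); last 2 first.
    + by apply: smooth_vfieldZ.
    + by apply: smooth_vfieldZ => //; exact: sDcf.
    rewrite !(conn_leibniz CD)//; last exact: sDcf.
    by rewrite !cfx.
  - have nZi : near_pt A p (fun q => forall i, smooth_fun A (fun q => Z q c 0 i) q).
      apply: (near_pt_forall (P := fun i => smooth_fun A (fun q => Z q c 0 i))) => i.
      exact: smooth_fun_near.
    apply: (near_ptS3 (near_pt_chart As pc) (smooth_vfield_near As sZ) nZi) => q qc sZq sZiq.
    rewrite -(@conn_eq _ _ _ _ D CD _ (cf w q) (fun q => \sum_i Z q c 0 i *: coord_field As c i q)).
    + rewrite (conn_sum As CD); last by move=> i; apply: smooth_vfieldZ => //; exact: smooth_coord_field.
      by apply: eq_bigr => i _; rewrite (conn_leibniz CD)//; exact: smooth_coord_field.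
    + apply: (near_ptS (near_pt_chart As qc)) => q' q'c; exact: esym (tangent_sum As _ q'c).
    + by apply: smooth_vfield_sum => // i; apply: smooth_vfieldZ => //; exact: smooth_coord_field.
  - apply: smooth_vfield_sum => // i; apply: smooth_vfieldD => //; apply: smooth_vfieldZ => //; exact: sDcf.
rewrite !H -sumrB; apply: eq_bigr => i _.
rewrite -[in dird x (fun q => dird (cf y q) _)](cfx x) -[in dird y (fun q => dird (cf x q) _)](cfx y).
rewrite (cfield_commute As (x c) (y c) pc (sZi i)).
tangent_ring.
Qed.

Lemma curv_tensor x y Z : smooth_vfield A Z p ->
  D x (fun q => D (cf y q) Z) - D y (fun q => D (cf x q) Z) = curv x y (Z p).
Proof. by move=> sZ; rewrite /curv !curvE// cfx. Qed.

Lemma curv_lin3 a x y z z' : curv x y (a *: z + z') = a *: curv x y z + curv x y z'.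
Proof.
rewrite /curv !curvE// !cfx scaler_sumr -big_split; apply: eq_bigr => i _ /=.
rewrite (_ : (a *: z + z') c 0 i = a * z c 0 i + z' c 0 i); first tangent_ring.
exact: etrans (tangent_evD _ _ _ _) (f_equal2 +%R (tangent_evZ _ _ _ _) erefl).
Qed.

(** For commuting fields vanishing torsion means D_X Y = D_Y X near [p]; exchanging the two inner
    fields in three of the second derivatives makes all six terms cancel. *)
Lemma curv_bianchi x y z : torsion_free D ->
  curv x y z + curv y z x + curv z x y = 0.
Proof.
move=> TD.
have sym q u v : chart_at A q c -> D (cfield As c u q) (cfield As c v) = D (cfield As c v q) (cfield As c u).
  move=> qc; apply/eqP; rewrite -subr_eq0 TD; [|exact: cfield_smooth..].
  by rewrite lie_bracket_cfield.
have symD (w : tangent A p) u v : D w (fun q => D (cfield As c u q) (cfield As c v)) =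
    D w (fun q => D (cfield As c v q) (cfield As c u)).
  apply: (conn_eq CD).
    by apply: (near_ptS (near_pt_chart As pc)) => q; exact: sym.
  by apply: (conn_smooth CD); exact: cfield_smooth.
rewrite /curv (symD x (z c) (y c)) (symD y (x c) (z c)) (symD z (y c) (x c)).
tangent_ring.
Qed.

End Curvature.

Section CurvatureQ.
Variables (R : realType) (M : topologicalType) (m : nat) (A : set (chart R M m)).
Variable Q : forall p : M, set (tangent A p -> tangent A p).
Variable D : affine_connection A.
Hypothesis QS : quaternionic_setting Q D.
Let As := qs_atlas QS.
Let QC := qs_conn QS.
Variables (W : set M) (F : 'I_3 -> forall q, tangent A q -> tangent A q).
Arguments F : clear implicits.
Hypothesis aF : admissible_frame Q W F.
Variables (c : chart R M m) (p : M).
Hypothesis pc : chart_at A p c.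
Hypothesis Wp : W p.
Implicit Types (x y z : tangent A p).
Local Notation cf x := (cfield As c (coords x c)).
Local Notation om := (conn_form Q D F).
Local Notation CurvM := (curv D As c).

(** The curvature matrix d omega + omega ^ omega of Q on commuting extensions of [x] and [y]; its
    entries are the k_ij. *)
Definition curv_form i j x y : R :=
  dird x (fun q => om i j (cf y q)) - dird y (fun q => om i j (cf x q))
  + \sum_l (om i l x * om l j y - om i l y * om l j x).

Let CD : is_connection (E := fun p => tangent A p) (smooth_vfield A) D.
Proof. by case: QC. Qed.

Let cfx x : cf x p = x. Proof. exact: cfield_id. Qed.
Let scf x : smooth_vfield A (cf x) p. Proof. exact: cfield_smooth. Qed.
Let sDcf x Z : smooth_vfield A Z p -> smooth_vfield A (fun q => D (cf x q) Z) p.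
Proof. by move=> sZ; exact: (conn_smooth CD). Qed.
Let SF i : Qsec Q (F i) p. Proof. exact: (frame_Qsec QS _ aF Wp). Qed.
Let sF i Z : smooth_vfield A Z p -> smooth_vfield A (fun q => F i q (Z q)) p.
Proof. by case: (SF i) => sFi _; exact: sFi. Qed.
Let som i j y : smooth_fun A (fun q => om i j (cf y q)) p.
Proof. exact: (conn_form_smooth QS aF). Qed.

Lemma conn_frame_app j (v : tangent A p) Z : smooth_vfield A Z p ->
  D v (fun q => F j q (Z q)) = \sum_i om i j v *: F i p (Z p) + F j p (D v Z).
Proof.
move=> sZ; rewrite (Qsec_conn_app QS)//; congr (_ + _).
by rewrite (endo_conn_frame QS aF).
Qed.

(** Two covariant derivatives of F_j Z are expanded by the Leibniz rule. In the antisymmetrization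
    the mixed terms, one derivative on the frame and one on Z, drop out, leaving the curvature of Q
    and F_j applied to that of TM. *)
Lemma curv_frame x y z j :
  CurvM x y (F j p z) - F j p (CurvM x y z) = \sum_i curv_form i j x y *: F i p z.
Proof.
have lF i : linear (F i p) by exact: (Q_linear QS (Qsec_at QS (SF i))).
have sFz : smooth_vfield A (fun q => F j q (cf z q)) p by exact: sF.
have := curv_tensor As CD pc x y sFz; rewrite cfx => <-.
have H (v w : tangent A p) : D v (fun q => D (cf w q) (fun q => F j q (cf z q))) =
   \sum_i (dird v (fun q => om i j (cf w q)) *: F i p z
       + om i j w *: (\sum_l om l i v *: F l p z + F i p (D v (cf z))))
   + (\sum_i om i j v *: F i p (D w (cf z)) + F j p (D v (fun q => D (cf w q) (cf z)))).
  rewrite -(@conn_eq _ _ _ _ D CD _ v (fun q => \sum_i om i j (cf w q) *: F i q (cf z q) + F j q (D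
    (cf w q) (cf z)))).
  - rewrite (connD CD); last 2 first.
    + by apply: smooth_vfield_sum => // i; apply: smooth_vfieldZ => //; exact: sF.
    + by apply: sF; exact: sDcf.
    congr (_ + _); last first.
      by rewrite conn_frame_app ?cfx//; exact: sDcf.
    rewrite (conn_sum As CD); last by move=> i; apply: smooth_vfieldZ => //; exact: sF.
    apply: eq_bigr => i _; rewrite (conn_leibniz CD)//; last exact: sF.
    by rewrite conn_frame_app ?cfx//; exact: scf.
  - apply: (near_ptS2 (near_frame QS aF Wp) (near_pt_chart As pc)) => q Wq qc.
    rewrite (Qsec_conn_app QS); last 2 first.
    + exact: (frame_Qsec QS _ aF Wq).
    + exact: cfield_smooth.
    by rewrite (endo_conn_frame QS aF).
  - apply: smooth_vfieldD => //; last by apply: sF; exact: sDcf.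
    by apply: smooth_vfield_sum => // i; apply: smooth_vfieldZ => //; exact: sF.
rewrite !H /curv (linear_fB (lF j)) /curv_form !sum3.
abstract_terms @dird; abstract_terms @conn_form; tangent_ring.
Qed.

Lemma curv_form_anti x y i j : curv_form i j x y = - curv_form j i x y.
Proof.
have anti := conn_form_anti QS aF.
have H (v w : tangent A p) : dird v (fun q => om i j (cf w q)) = - dird v (fun q => om j i (cf w q)).
  rewrite -(dirdN As v (som j i w)); apply: (dird_eq As v _ (som i j w)).
  by apply: (near_ptS (near_frame QS aF Wp)) => q Wq; exact: anti.
rewrite /curv_form !H !sum3 ![om i _ _](anti _ _ i _ Wp) ![om _ j _](anti _ _ _ j Wp).
abstract_terms @dird; abstract_terms @conn_form; ring.
Qed.

Lemma curv_form_antisym x y i j : curv_form i j x y = - curv_form i j y x.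
Proof. rewrite /curv_form !sum3; abstract_terms @dird; abstract_terms @conn_form; ring. Qed.

End CurvatureQ.

(** * The Ricci tensor of a quaternionic connection *)

Section Trace.
Variables (R : realType) (M : topologicalType) (m : nat) (A : set (chart R M m)).
Hypothesis As : smooth_atlas A.
Variables (c : chart R M m) (p : M).
Hypothesis pc : chart_at A p c.
Local Notation Tp := (tangent A p).
Implicit Types (f g : Tp -> Tp) (x y z : Tp).
Local Notation e i := (coord_field As c i p).

Definition tangent_trace f : R := \sum_i (f (e i)) c 0 i.
Local Notation tr := tangent_trace.

Lemma coord_field_delta i j : (e i) c 0 j = (j == i)%:R.
Proof. by rewrite tangent_ofE// mxE eqxx. Qed.

Lemma eq_trace f g : f =1 g -> tr f = tr g.
Proof. by move=> fg; apply: eq_bigr => i _; rewrite fg. Qed.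

Lemma traceD f g : tr (fun z => f z + g z) = tr f + tr g.
Proof. by rewrite -big_split; apply: eq_bigr => i _; rewrite tangent_evD. Qed.

Lemma traceN f : tr (fun z => - f z) = - tr f.
Proof. by rewrite -sumrN; apply: eq_bigr => i _; rewrite tangent_evN. Qed.

Lemma traceZ a f : tr (fun z => a *: f z) = a * tr f.
Proof. by rewrite mulr_sumr; apply: eq_bigr => i _; rewrite tangent_evZ. Qed.

Lemma coords_sum (I : Type) (r : seq I) (F : I -> Tp) i :
  (\sum_(j <- r) F j) c 0 i = \sum_(j <- r) (F j) c 0 i.
Proof.
elim: r => [|j r IH]; first by rewrite !big_nil tangent_ev0.
by rewrite !big_cons tangent_evD IH.
Qed.

Lemma trace_comp f g : linear f -> tr (fun z => f (g z)) = \sum_i \sum_j (g (e i)) c 0 j * (f (e j)) c 0 i.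
Proof.
move=> lf; apply: eq_bigr => i _; rewrite {1}(tangent_sum As (g (e i)) pc).
rewrite (linear_f_sum _ _ lf) coords_sum; apply: eq_bigr => j _.
by rewrite (linear_fZ lf) tangent_evZ.
Qed.

Lemma trace_comm f g : linear f -> linear g -> tr (fun z => f (g z)) = tr (fun z => g (f z)).
Proof.
move=> lf lg; rewrite trace_comp// trace_comp// exchange_big.
by apply: eq_bigr => i _; apply: eq_bigr => j _; rewrite mulrC.
Qed.

(** This evaluates the correction terms [k i j z u *: J i v] that appear when [r(z, u), J_j] v is
    traced over z. *)
Lemma trace_rank1 (w : Tp -> R) x : (forall a y z, w (a *: y + z) = a * w y + w z) ->
  tr (fun z => w z *: x) = w x.
Proof.
move=> lw; have w0 : w 0 = 0.
  by have := lw 1 0 0; rewrite scale1r addr0; lra.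
have wsum (I : Type) (r : seq I) (a : I -> R) (F : I -> Tp) : w (\sum_(j <- r) a j *: F j) =
  \sum_(j <- r) a j * w (F j).
  by elim: r => [|j r IH]; rewrite ?big_nil// !big_cons lw IH.
rewrite [in RHS](tangent_sum As x pc) wsum; apply: eq_bigr => i _.
by rewrite tangent_evZ mulrC.
Qed.

Lemma trace_id : tr id = m%:R.
Proof.
rewrite /tangent_trace (eq_bigr (fun=> 1)) ?sumr_const ?card_ord//.
by move=> i _; rewrite coord_field_delta eqxx.
Qed.

End Trace.

Section RicciAlgebra.
Variables (R : realType) (M : topologicalType) (m : nat) (A : set (chart R M m)).
Hypothesis As : smooth_atlas A.
Variables (c : chart R M m) (p : M).
Hypothesis pc : chart_at A p c.
Local Notation Tp := (tangent A p).
Implicit Types (x y z : Tp).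
Local Notation tr := (tangent_trace As c).

Variables (r : Tp -> Tp -> Tp -> Tp) (J : 'I_3 -> Tp -> Tp).
Variable k : 'I_3 -> 'I_3 -> Tp -> Tp -> R.
Hypothesis m4 : (4 < m)%N.
Hypothesis r1 : forall a x x' y z, r (a *: x + x') y z = a *: r x y z + r x' y z.
Hypothesis r3 : forall a x y z z', r x y (a *: z + z') = a *: r x y z + r x y z'.
Hypothesis ranti : forall x y z, r x y z = - r y x z.
Hypothesis bianchi : forall x y z, r x y z + r y z x + r z x y = 0.
Hypothesis qJ : quaternion_triple J.
Hypothesis rJ : forall x y z j, r x y (J j z) - J j (r x y z) = \sum_i k i j x y *: J i z.
Hypothesis kanti : forall i j x y, k i j x y = - k j i x y.
Hypothesis k1 : forall i j a x x' y, k i j (a *: x + x') y = a * k i j x y + k i j x' y.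
Hypothesis kanti' : forall i j x y, k i j x y = - k i j y x.

Let lJ i : linear (J i). Proof. by case: qJ. Qed.
Let lr x y : linear (r x y). Proof. by move=> a z z'; exact: r3. Qed.

Let rN1 x y z : r (- x) y z = - r x y z.
Proof.
have r0 : r 0 y z = 0.
  have := r1 1 0 0 y z; rewrite !scale1r addr0 => /eqP.
  by rewrite -subr_eq subrr eq_sym => /eqP.
by rewrite -scaleN1r -[-1 *: x]addr0 r1 r0 addr0 scaleN1r.
Qed.
Let kN1 i j x y : k i j (- x) y = - k i j x y.
Proof.
have k0 : k i j 0 y = 0.
  by have := k1 i j 1 0 0 y; rewrite scale1r addr0; lra.
by rewrite -scaleN1r -[_ *: x]addr0 k1 k0 addr0 mulN1r.
Qed.
Let kN2 i j x y : k i j x (- y) = - k i j x y.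
Proof. by rewrite kanti' kN1 -kanti'. Qed.
Let kii i x y : k i i x y = 0.
Proof. by have := kanti i i x y; move: (k i i x y) => t; lra. Qed.

(** Each J_i equals a product of the two others and minus the reversed product, and the two products
    have equal traces. *)
Let trJ i : tr (J i) = 0.
Proof.
have T z := quat_table qJ z.
have H i1 i2 i3 : (forall z, J i1 (J i2 z) = J i3 z) -> (forall z, J i2 (J i1 z) = - J i3 z) -> tr (J i3) = 0.
  move=> e1 e2; have := trace_comm As pc (lJ i1) (lJ i2).
  rewrite (eq_trace As c e1) (eq_trace As c e2) traceN.
  by change (tr (fun z => J i3 z)) with (tr (J i3)); lra.
move: i; apply: ord3P.
- by apply: (H 1 ord_max) => z; rewrite T.
- by apply: (H ord_max ord0) => z; rewrite T.
- by apply: (H ord0 1) => z; rewrite T.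
Qed.

(** Traced over the first argument of the curvature. The connection need not be metric, so this form
    is not symmetric in general; its skew part is what matters. *)
Definition ricci x y := tr (fun z => r z x y).
Local Notation Ric := ricci.

Lemma trace_curv x y : tr (r x y) = Ric y x - Ric x y.
Proof.
rewrite /ricci -traceN -traceD; apply: eq_trace => z.
have := bianchi x y z; rewrite (ranti y z x) => /eqP; rewrite -addrA addr_eq0 => /eqP ->.
by rewrite opprD opprK.
Qed.

(** Two evaluations of tr(J_i2 r J_i1): moving J_i1 cyclically to the front gives tr(J_i3 r), while
    commuting it past r gives - tr(J_i3 r) plus the terms in k. Hence the factor 2. *)
Let trJr i1 i2 i3 x y : (forall z, J i1 (J i2 z) = J i3 z) -> (forall z, J i2 (J i1 z) = - J i3 z) ->
  2 * tr (fun z => J i3 (r x y z)) =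
  \sum_i k i i1 x y * tr (fun z => J i2 (J i z)).
Proof.
move=> e1 e2.
have : tr (fun z => J i2 (r x y (J i1 z))) = tr (fun z => J i2 (J i1 (r x y z))) +
    \sum_i k i i1 x y * tr (fun z => J i2 (J i z)).
  rewrite !sum3 -!traceZ -!traceD; apply: eq_trace => z.
  have /(canRL (subrK _)) -> := rJ x y z i1.
  rewrite sum3 !(linear_fD (lJ i2)) !(linear_fZ (lJ i2)); tangent_ring.
have -> : tr (fun z => J i2 (r x y (J i1 z))) = tr (fun z => J i3 (r x y z)).
  rewrite (trace_comm As pc (f := fun z => J i2 (r x y z)) (g := J i1))//; last first.
    by move=> a z z'; rewrite /= r3 (linear_lin (lJ i2)).
  exact: eq_trace.
rewrite (eq_trace As c (fun z => e2 (r x y z))) traceN; lra.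
Qed.

Let trJJ i j : tr (fun z => J i (J j z)) = if i == j then - m%:R else 0.
Proof.
have T z := quat_table qJ z.
have trNJ l : tr (fun z => - J l z) = 0 by rewrite traceN -[tr _]/(tr (J l)) trJ oppr0.
have trNid : tr (fun z => - z) = - m%:R by rewrite traceN -[tr _]/(tr id) trace_id.
move: i j; apply: ord3P; apply: ord3P => /=.
- by rewrite (eq_trace As c (fun z => (T z).1.1.2)).
- by rewrite (eq_trace As c (fun z => (T z).1.1.1.1.1.1.1.1)) trJ.
- by rewrite (eq_trace As c (fun z => (T z).1.1.1.2)).
- by rewrite (eq_trace As c (fun z => (T z).1.1.1.1.1.1.1.2)).
- by rewrite (eq_trace As c (fun z => (T z).1.2)).
- by rewrite (eq_trace As c (fun z => (T z).1.1.1.1.1.1.2)) trJ.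
- by rewrite (eq_trace As c (fun z => (T z).1.1.1.1.2)) trJ.
- by rewrite (eq_trace As c (fun z => (T z).1.1.1.1.1.2)).
- by rewrite (eq_trace As c (fun z => (T z).2)).
Qed.

Lemma trace_Jr x y :
  (tr (fun z => J ord0 (r x y z)) = - (m%:R / 2) * k ord_max 1 x y) *
  (tr (fun z => J 1 (r x y z)) = - (m%:R / 2) * k ord0 ord_max x y) *
  (tr (fun z => J ord_max (r x y z)) = - (m%:R / 2) * k 1 ord0 x y).
Proof.
have T z := quat_table qJ z.
have h0 := @trJr 1 ord_max ord0 x y (fun z => (T z).1.1.1.1.1.1.2) (fun z => (T z).1.1.1.1.1.2).
have h1 := @trJr ord_max ord0 1 x y (fun z => (T z).1.1.1.1.2) (fun z => (T z).1.1.1.2).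
have h2 := @trJr ord0 1 ord_max x y (fun z => (T z).1.1.1.1.1.1.1.1) (fun z => (T z).1.1.1.1.1.1.1.2).
by move: h0 h1 h2; rewrite !sum3 !trJJ /= => h0 h1 h2; split; [split|]; lra.
Qed.

(* Trace of z |-> [r(z, u), J_j] v, combined with the Bianchi identity. *)
Lemma ricci_J x y j : Ric x (J j y) - Ric y (J j x) =
  - tr (fun z => J j (r x y z)) - \sum_i (k i j (J i x) y + k i j x (J i y)).
Proof.
have H u v : Ric u (J j v) = tr (fun z => J j (r z u v)) + \sum_i k i j (J i v) u.
  have E z : r z u (J j v) = J j (r z u v) + (k ord0 j z u *: J ord0 v + k 1 j z u *: J 1 v
      + k ord_max j z u *: J ord_max v).
    have /(canRL (subrK _)) -> := rJ z u v j; rewrite sum3; tangent_ring.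
  have rk i : tr (fun z => k i j z u *: J i v) = k i j (J i v) u.
    by apply: (trace_rank1 As pc (w := fun z => k i j z u)) => a y0 z0; exact: k1.
  by rewrite /ricci (eq_trace As c E) !traceD !rk sum3.
rewrite !H.
have B z : J j (r z x y) = J j (r z y x) + - J j (r x y z).
  rewrite -(linear_fN (lJ j)) -(linear_fD (lJ j)); congr (J j _).
  have := bianchi x y z; rewrite (ranti y z x) => h.
  by apply/eqP; rewrite -subr_eq0 -h; apply/eqP; tangent_ring.
rewrite (eq_trace As c B) traceD traceN !sum3 (kanti' _ _ x) (kanti' _ _ x) (kanti' _ _ x).
abstract_terms @tangent_trace; abstract_terms k; ring.
Qed.

(** The relations [e1], [e2], [e3] are linear in three curvature components. Eliminating two of them
    expresses the failure of invariance of the third through [S], with a coefficient h + 2 that is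
    nonzero, so each condition implies the other. *)
Lemma curv_J_invariant :
  (forall x y, k ord_max 1 (J ord0 x) (J ord0 y) = k ord_max 1 x y) <->
  (forall x y, tr (r (J ord0 x) (J ord0 y)) = tr (r x y)).
Proof.
have T z := quat_table qJ z.
pose h : R := m%:R / 2.
have RN1 x y : Ric (- x) y = - Ric x y.
  by rewrite /ricci -traceN; apply: eq_trace => z; rewrite ranti rN1 (ranti z x).
have RN2 x y : Ric x (- y) = - Ric x y.
  by rewrite /ricci -traceN; apply: eq_trace => z; rewrite (linear_fN (lr z x)).
pose S x y := Ric x y - Ric y x.
have trS x y : tr (r x y) = - S x y by rewrite trace_curv /S opprB.
(* By antisymmetry these three components determine all k_ij. *)
pose a := k 1 ord0; pose b := k ord_max ord0; pose d := k ord_max 1.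
have aN1 x y : a (- x) y = - a x y by exact: kN1.
have aN2 x y : a x (- y) = - a x y by exact: kN2.
have bN1 x y : b (- x) y = - b x y by exact: kN1.
have bN2 x y : b x (- y) = - b x y by exact: kN2.
have dN1 x y : d (- x) y = - d x y by exact: kN1.
have dN2 x y : d x (- y) = - d x y by exact: kN2.
have e1 x y : h * d x y = Ric x (J ord0 y) - Ric y (J ord0 x)
   + (a (J 1 x) y + a x (J 1 y)) + (b (J ord_max x) y + b x (J ord_max y)).
  by rewrite ricci_J trace_Jr !sum3 !kii /a /b /d /h; ring.
have e2 x y : h * b x y = - (Ric x (J 1 y) - Ric y (J 1 x))
   + (a (J ord0 x) y + a x (J ord0 y)) - (d (J ord_max x) y + d x (J ord_max y)).
  rewrite ricci_J trace_Jr !sum3 !kii !(kanti ord0) /a /b /d /h; ring.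
have e3 x y : h * a x y = (Ric x (J ord_max y) - Ric y (J ord_max x))
   - (b (J ord0 x) y + b x (J ord0 y)) - (d (J 1 x) y + d x (J 1 y)).
  rewrite ricci_J trace_Jr !sum3 !kii !(kanti ord0) !(kanti 1 ord_max) /a /b /d /h; ring.
(* Solving the three relations for the J_0-anti-invariant part of d: here
   n >= 2, that is h <> 2, is needed. *)
have key x y : (h * h - 4) * (d x y - d (J ord0 x) (J ord0 y)) =
   (h - 2) * (S (J ord0 x) y + S x (J ord0 y)).
  have E1 := e1 x y; have E1' := e1 (J ord0 x) (J ord0 y).
  have F1 := e3 (J 1 x) y; have F2 := e3 x (J 1 y).
  have F3 := e3 (J ord_max x) (J ord0 y); have F4 := e3 (J ord0 x) (J ord_max y).
  have G1 := e2 (J ord_max x) y; have G2 := e2 x (J ord_max y).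
  have G3 := e2 (J 1 x) (J ord0 y); have G4 := e2 (J ord0 x) (J 1 y).
  move: E1 E1' F1 F2 F3 F4 G1 G2 G3 G4.
  rewrite !T ?(RN1, RN2, aN1, aN2, bN1, bN2, dN1, dN2) ?opprK /S.
  abstract_terms Ric; abstract_terms a; abstract_terms b; abstract_terms d.
  move=> E1 E1' F1 F2 F3 F4 G1 G2 G3 G4.
  (* In h (E1 - E1') the eight values of [a] and [b] are replaced by means of F1 to F4 and G1 to G4.
     The new values of [a] and [b] cancel, as do those of [d] at arguments rotated by J_1 or J_2,
     and 4 (d(x, y) - d(J_0 x, J_0 y)) remains: this is the 4 in h^2 - 4. *)
  nra.
have hn2 : h - 2 != 0.
  rewrite subr_eq0 /h; apply/negP => /eqP e.
  have : (4 : R) < m%:R by rewrite ltr_nat.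
  by lra.
have hp2 : h + 2 != 0.
  by rewrite gt_eqF// ltr_pwDr// divr_ge0.
have key' x y : (h + 2) * (d x y - d (J ord0 x) (J ord0 y)) = S (J ord0 x) y + S x (J ord0 y).
  apply: (mulfI hn2); rewrite -key; ring.
have SN2 x y : S x (- y) = - S x y by rewrite /S RN1 RN2; ring.
split=> H x y.
  rewrite !trS; congr (- _).
  (* At (x, J_0 y) the right-hand side of [key'] is S(J_0 x, J_0 y) - S(x, y), since J_0 squares to
     - 1. *)
  by have := key' x (J ord0 y); rewrite /d H subrr mulr0 (T y) SN2; lra.
apply/esym/eqP; rewrite -subr_eq0; apply/eqP.
apply: (mulfI hp2); rewrite key' mulr0.
by have := H x (J ord0 y); rewrite !trS (T y) SN2; lra.
Qed.

End RicciAlgebra.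

(** * The connection on top-degree forms *)

Section AlternatingDet.
Variables (R : comNzRingType) (m : nat).
Implicit Types (N : 'M[R]_m) (u v : 'rV[R]_m).

Definition set_row N i u : 'M[R]_m := \matrix_(k, l) if k == i then u 0 l else N k l.

Lemma set_row_row N i : set_row N i (row i N) = N.
Proof. by apply/matrixP => k l; rewrite !mxE; case: eqP => // ->. Qed.

Lemma row_set_row N i u : row i (set_row N i u) = u.
Proof. by apply/rowP => l; rewrite !mxE eqxx. Qed.

Lemma row'_set_row N i u : row' i (set_row N i u) = row' i N.
Proof. by apply/matrixP => k l; rewrite !mxE eq_sym (negPf (neq_lift _ _)). Qed.

Lemma det_set_row_lin N i (a : R) u v :
  \det (set_row N i (a *: u + v)) = a * \det (set_row N i u) + \det (set_row N i v).
Proof.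
rewrite -[in RHS](mul1r (\det (set_row N i v))).
apply: (determinant_multilinear (i0 := i)); rewrite ?row_set_row ?scale1r ?row'_set_row//.
Qed.

Lemma det_set_row N i u : \det (set_row N i u) = \sum_l u 0 l * cofactor N i l.
Proof.
rewrite (expand_det_row _ i); apply: eq_bigr => l _; rewrite mxE eqxx; congr (_ * _).
rewrite /cofactor; congr (_ * \det _); apply/matrixP => k l'; rewrite !mxE.
by rewrite eq_sym (negPf (neq_lift _ _)).
Qed.

(** Expanding each determinant along its new row turns the sum into tr(N L adj N), and adj N * N is
    the scalar matrix det N. This is Jacobi's formula for the derivative of a determinant. *)
Lemma sum_det_set_row N (L : 'M[R]_m) :
  \sum_i \det (set_row N i (row i (N *m L))) = \tr L * \det N.
Proof.
transitivity (\tr (N *m L *m \adj N)).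
  rewrite /mxtrace; apply: eq_bigr => i _; rewrite det_set_row mxE.
  by apply: eq_bigr => l _; rewrite !mxE.
rewrite mxtrace_mulC mulmxA mul_adj_mx -scalemx1 -scalemxAl mul1mx mxtraceZ.
by rewrite mulrC.
Qed.

Variable G : 'M[R]_m -> R.
Hypothesis Glin : forall N i a u v,
  G (set_row N i (a *: u + v)) = a * G (set_row N i u) + G (set_row N i v).
Hypothesis Galt : forall N i j, i != j -> row i N = row j N -> G N = 0.

Lemma set_rowC N i j u v : i != j -> set_row (set_row N i u) j v = set_row (set_row N j v) i u.
Proof.
move=> ij; apply/matrixP => k l; rewrite !mxE; case: (eqVneq k j) => // ->.
by rewrite eq_sym (negPf ij).
Qed.

Lemma alternating_swap N i j : i != j -> G (xrow i j N) = - G N.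
Proof.
move=> ij; pose H u v := G (set_row (set_row N i u) j v).
have HD1 u u' v : H (u + u') v = H u v + H u' v.
  by rewrite /H !(set_rowC _ _ _ ij) -[u]scale1r Glin mul1r scale1r.
have HD2 u v v' : H u (v + v') = H u v + H u v'.
  by rewrite /H -[v]scale1r Glin mul1r scale1r.
have H0 u : H u u = 0.
  by apply: (Galt ij); rewrite row_set_row set_rowC// row_set_row.
have := H0 (row i N + row j N); rewrite HD1 !HD2 !H0 addr0 add0r.
have -> : H (row i N) (row j N) = G N by rewrite /H set_row_row set_row_row.
have -> : H (row j N) (row i N) = G (xrow i j N).
  rewrite /H; congr G; apply/matrixP => k l; rewrite !mxE.
  case: (eqVneq k j) => [->|kj]; first by rewrite tpermR.
  case: (eqVneq k i) => [->|ki]; first by rewrite tpermL.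
  by rewrite tpermD// eq_sym.
by move/eqP; rewrite addrC addr_eq0 => /eqP.
Qed.

Hypothesis G1 : G 1%:M = 0.

Lemma alternating_perm0 (s : {perm 'I_m}) : G (row_perm s 1%:M) = 0.
Proof.
have [ts -> dts] := prod_tpermP s; elim: ts dts => [_|t ts IH /= /andP[dt dts]].
  by rewrite big_nil row_perm1.
rewrite big_cons row_permM -[row_perm (tperm _ _) _]/(xrow _ _ _).
by rewrite alternating_swap// IH// oppr0.
Qed.

Lemma alternating_fun0 (f : 'I_m -> 'I_m) : G (\matrix_(i, j) (j == f i)%:R) = 0.
Proof.
have [/injectiveP fi|/injectivePn[i [j ij fij]]] := boolP (injectiveb f).
  rewrite -[RHS](alternating_perm0 (perm fi)); congr G; apply/matrixP => i j.
  by rewrite !mxE permE eq_sym.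
by apply: (Galt ij); apply/rowP => l; rewrite !mxE fij.
Qed.

(** Induction on the list of rows that need not be basis vectors: multilinearity expands one such
    row. When every row is a basis vector the matrix comes from a function on indices; if it is
    injective it is a permutation of the identity, otherwise two rows coincide. *)
Lemma alternating0 N : G N = 0.
Proof.
suff H (s : seq 'I_m) : forall N,
    (forall i, i \notin s -> exists j, row i N = delta_mx 0 j) -> G N = 0.
  by apply: (H (enum 'I_m)) => i; rewrite mem_enum.
elim: s => [|i s IH] {}N bN.
  have [i|f fP] := @boolp.choice 'I_m 'I_m (fun i j => row i N = delta_mx 0 j).
    by have [j jP] := bN i isT; exists j.
  rewrite -(alternating_fun0 f); congr G; apply/matrixP => i j.
  by have := congr1 (fun u : 'rV_m => u 0 j) (fP i); rewrite !mxE eqxx.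
have Gsum (I : Type) (t : seq I) (a : I -> R) (F : I -> 'rV_m) : G (set_row N i (\sum_(j <- t) a j *: F j)) =
    \sum_(j <- t) a j * G (set_row N i (F j)).
  elim: t => [|j t IHt]; last by rewrite !big_cons Glin IHt.
  rewrite !big_nil; have := Glin N i 1 0 0; rewrite scale1r addr0 mul1r => /eqP.
  by rewrite -subr_eq subrr eq_sym => /eqP.
rewrite -(set_row_row N i) (row_sum_delta (row i N)) Gsum big1// => j _.
rewrite IH ?mulr0// => l ls; have [->|li] := eqVneq l i.
  by exists j; rewrite row_set_row.
have [|j' jE] := bN l; first by rewrite inE negb_or li.
by exists j'; rewrite -jE; apply/rowP => l'; rewrite !mxE (negPf li).
Qed.

End AlternatingDet.

Lemma sum_deltar (R : pzRingType) m (F : 'I_m -> R) l : \sum_j F j * (l == j)%:R = F l.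
Proof.
by rewrite (bigD1 l)//= eqxx mulr1 big1 ?addr0// => j /negPf jl; rewrite eq_sym jl mulr0.
Qed.

Section TopForms.
Variables (R : realType) (M : topologicalType) (m : nat) (A : set (chart R M m)).
Variable D : affine_connection A.
Hypothesis As : smooth_atlas A.
Hypothesis CD : is_connection (E := fun p => tangent A p) (smooth_vfield A) D.
Variable c : chart R M m.
Implicit Types (p q : M).

Definition coord_mx q (y : 'I_m -> tangent A q) : 'M[R]_m := \matrix_(i, j) (y i) c 0 j.
Definition chart_det q (y : 'I_m -> tangent A q) : R := \det (coord_mx y).
Definition chart_frame q : 'I_m -> tangent A q := fun i => coord_field As c i q.

Definition christoffel q (v : tangent A q) : 'M[R]_m :=
  \matrix_(j, l) (D v (coord_field As c j)) c 0 l.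
(** Minus the connection form of the line bundle of top-degree forms in the trivialization
    [chart_det]. *)
Definition conn_trace q (v : tangent A q) : R := \tr (christoffel v).

Lemma coord_mx_subst q (y : 'I_m -> tangent A q) i x :
  coord_mx (subst_arg y i x) = set_row (coord_mx y) i (x c).
Proof. by apply/matrixP => k l; rewrite !mxE /subst_arg; case: eqP. Qed.

(** The difference of the two sides, read on matrices of coordinates, is multilinear and alternating
    and vanishes at the identity, so it vanishes everywhere. *)
Lemma alternating_det q (w : ('I_m -> tangent A q) -> R^o) y : chart_at A q c ->
  Defs.alternating w -> w y = w (chart_frame q) * chart_det y.
Proof.
move=> qc [wlin walt].
have yE (z : 'I_m -> tangent A q) : z = fun i => cfield As c (row i (coord_mx z)) q.
  apply/funext => i; apply: (tangent_eqP qc); rewrite cfieldE//.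
  by apply/rowP => j; rewrite !mxE.
pose G N := w (fun i => cfield As c (row i N) q) - w (chart_frame q) * \det N.
suff G0 N : G N = 0.
  by have /eqP := G0 (coord_mx y); rewrite subr_eq0 -yE => /eqP.
have rowE N0 i u : (fun k => cfield As c (row k (set_row N0 i u)) q) =
    subst_arg (fun k => cfield As c (row k N0) q) i (cfield As c u q).
  apply/funext => k; rewrite /subst_arg; case: eqP => [->|/eqP ki]; first by rewrite row_set_row.
  rewrite (_ : row k (set_row N0 i u) = row k N0)//.
  by apply/rowP => l; rewrite !mxE (negPf ki).
apply: alternating0.
- move=> N' i a u v; rewrite /G !rowE cfield_lin (wlin _ i a) det_set_row_lin.
  rewrite -[_ *: _]/(_ * _); ring.
- move=> N' i j ij Nij; rewrite /G (determinant_alternate ij) ?mulr0 ?subr0.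
    by apply: (walt _ i j ij); rewrite Nij.
  by move=> l; have := congr1 (fun u : 'rV_m => u 0 l) Nij; rewrite !mxE.
- rewrite /G det1 mulr1; apply/eqP; rewrite subr_eq0; apply/eqP; congr w.
  by apply/funext => i; rewrite row1.
Qed.

Lemma chart_det_frame q : chart_at A q c -> chart_det (chart_frame q) = 1.
Proof.
move=> qc; rewrite /chart_det -[RHS](det1 R m); congr (\det _).
by apply/matrixP => i j; rewrite !mxE tangent_ofE// mxE eqxx eq_sym.
Qed.

Lemma smooth_prod p (I : Type) (r : seq I) (F : I -> M -> R) :
  (forall i, smooth_fun A (F i) p) -> smooth_fun A (fun q => \prod_(i <- r) F i q) p.
Proof.
move=> sF; elim: r => [|i r IH].
  apply: (smooth_fun_eq _ (smooth_fun_cst 1)).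
  by apply: near_ptT => q; rewrite big_nil.
apply: (smooth_fun_eq _ (smooth_funM (sF i) IH)).
by apply: near_ptT => q; rewrite big_cons.
Qed.

Lemma smooth_det p (F : M -> 'M[R]_m) : (forall i j, smooth_fun A (fun q => F q i j) p) ->
  smooth_fun A (fun q => \det (F q)) p.
Proof.
move=> sF; rewrite /determinant; apply: smooth_fun_sum => s.
by apply: smooth_funM; [exact: smooth_fun_cst|exact: smooth_prod].
Qed.

Lemma dird_prod p (v : tangent A p) (F : 'I_m -> M -> R) (r : seq 'I_m) : uniq r ->
  (forall i, smooth_fun A (F i) p) ->
  dird v (fun q => \prod_(i <- r) F i q) =
  \sum_(i <- r) dird v (F i) * \prod_(j <- r | j != i) F j p.
Proof.
move=> + sF; elim: r => [_|i r IH /= /andP[ir ur]].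
  by rewrite big_nil -[RHS](dird_cst As v 1); congr dird; apply/funext => q; rewrite big_nil.
rewrite (_ : (fun q => _) = fun q => F i q * \prod_(j <- r) F j q); last first.
  by apply/funext => q; rewrite big_cons.
rewrite (dirdM As)//; last exact: smooth_prod.
rewrite big_cons IH// big_cons eqxx /=; congr (_ * _ + _).
  rewrite big_seq_cond [RHS]big_seq_cond; apply: eq_bigl => j.
  by case: (boolP (j \in r)) => //= jr; apply/esym; apply: contraNneq ir => <-.
rewrite mulr_sumr big_seq [RHS]big_seq; apply: eq_bigr => j jr.
rewrite big_cons ifT; first by rewrite mulrCA.
by apply: contraNneq ir => ->.
Qed.

Lemma dird_det p (v : tangent A p) (F : M -> 'M[R]_m) :
  (forall i j, smooth_fun A (fun q => F q i j) p) ->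
  dird v (fun q => \det (F q)) =
  \sum_i \det (set_row (F p) i (\row_j dird v (fun q => F q i j))).
Proof.
move=> sF; rewrite /determinant (dird_sum As); last first.
  by move=> s; apply: smooth_funM; [exact: smooth_fun_cst|exact: smooth_prod].
rewrite exchange_big; apply: eq_bigr => s _ /=.
rewrite (dirdM As); [|exact: smooth_fun_cst|exact: smooth_prod].
rewrite dird_cst// mul0r add0r dird_prod ?index_enum_uniq//.
rewrite mulr_sumr; apply: eq_bigr => i _; congr (_ * _).
rewrite [RHS](bigD1 i)//= !mxE eqxx; congr (_ * _).
by apply: eq_bigr => j /negPf ji; rewrite mxE ji.
Qed.

(** The coordinates of D_v X_i are the derivatives of those of X_i plus a Christoffel part. The
    first cancel against the derivative of the determinant; the second add up to the trace by
    [sum_det_set_row]. *)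
Lemma topform_conn_det q (v : tangent A q) (w : topform A) (h : M -> R) :
  chart_at A q c -> smooth_fun A h q ->
  near_pt A q (fun q' => forall y, w q' y = h q' * chart_det y) ->
  topform_conn D v w = fun y => (dird v h - h q * conn_trace v) * chart_det y.
Proof.
move=> qc sh wE; apply/funext => y; rewrite /topform_conn.
pose X i := extension (y i); have sX i : smooth_vfield A (X i) q by have [] := extensionP As (y i).
have Xq i : X i q = y i by have [] := extensionP As (y i).
have sXi i := (smooth_vfieldP As _ qc).1 (sX i).
have sd i j : smooth_fun A (fun q' => coord_mx (fun i => X i q') i j) q.
  by apply: (smooth_fun_eq _ (sXi i j)); apply: near_ptT => q'; rewrite mxE.
have sdet : smooth_fun A (fun q' => chart_det (fun i => X i q')) q by exact: smooth_det.
rewrite -(@dird_eq _ _ _ _ As q v (fun q' => h q' * chart_det (fun i => X i q'))); last 2 first.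
- by apply: (near_ptS wE) => q' ->.
- exact: smooth_funM.
rewrite (dirdM As)// dird_det//.
have XE : coord_mx (fun i => X i q) = coord_mx y by apply/matrixP => i j; rewrite !mxE Xq.
have wq := near_pt_self As wE.
have DX i : (D v (X i)) c = \row_j dird v (fun q' => coord_mx (fun i => X i q') i j)
     + row i (coord_mx y *m christoffel v).
  have sE j : smooth_vfield A (coord_field As c j) q by exact: smooth_coord_field.
  rewrite -(@conn_eq _ _ _ _ D CD _ v (fun q' => \sum_j X i q' c 0 j *: coord_field As c j q')); last 2 first.
  + apply: (near_ptS (near_pt_chart As qc)) => q' q'c; exact: esym (tangent_sum As _ q'c).
  + by apply: smooth_vfield_sum => // j; apply: smooth_vfieldZ.
  rewrite (conn_sum As CD); last by move=> j; apply: smooth_vfieldZ.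
  apply/rowP => l; rewrite coords_sum.
  under eq_bigr => j _ do rewrite (conn_leibniz CD)// tangent_evD !tangent_evZ coord_field_delta// Xq.
  rewrite big_split /=; rewrite !mxE; congr (_ + _).
    rewrite (sum_deltar (fun j => dird v (fun q' => X i q' c 0 j))).
    by congr dird; apply/funext => q'; rewrite mxE.
  by apply: eq_bigr => j _; rewrite !mxE.
rewrite -[chart_det (fun i => X i q)]/(\det (coord_mx (fun i => X i q))) XE.
rewrite -[X in _ + _ - X = _]/(\sum_i w q (subst_arg y i (D v (X i)))).
have wS i : w q (subst_arg y i (D v (X i))) =
    h q * (\det (set_row (coord_mx y) i (\row_j dird v (fun q0 => coord_mx (X^~ q0) i j))) +
      \det (set_row (coord_mx y) i (row i (coord_mx y *m christoffel v)))).
  rewrite wq /chart_det coord_mx_subst DX; congr (_ * _).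
  by rewrite -{1}[\row_j _]scale1r det_set_row_lin mul1r.
rewrite (eq_bigr _ (fun i _ => wS i)) -[X in _ = _ * X]/(\det (coord_mx y)).
rewrite -mulr_sumr big_split /= sum_det_set_row /conn_trace; ring.
Qed.

Lemma conn_trace_lin q (a : R) (v v' : tangent A q) : chart_at A q c ->
  conn_trace (a *: v + v') = a * conn_trace v + conn_trace v'.
Proof.
move=> qc; rewrite /conn_trace -mxtraceZ -mxtraceD; congr (\tr _).
apply/matrixP => j l; rewrite !mxE (conn_linv CD); last exact: smooth_coord_field.
exact: etrans (tangent_evD _ _ _ _) (f_equal2 +%R (tangent_evZ _ _ _ _) erefl).
Qed.

Lemma conn_trace_expand q (v : tangent A q) : chart_at A q c ->
  conn_trace v = \sum_k v c 0 k * conn_trace (coord_field As c k q).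
Proof.
move=> qc; have t0 : conn_trace (0 : tangent A q) = 0.
  by have := conn_trace_lin 1 (0 : tangent A q) 0 qc; rewrite scale1r addr0; lra.
rewrite {1}(tangent_sum As v qc); elim: (index_enum _) => [|k r IH]; first by rewrite !big_nil.
by rewrite !big_cons conn_trace_lin// IH.
Qed.

Lemma christoffel_smooth q (V : vfield A) j l : chart_at A q c -> smooth_vfield A V q ->
  smooth_fun A (fun q' => christoffel (V q') j l) q.
Proof.
move=> qc sV; have sE : smooth_vfield A (coord_field As c j) q by exact: smooth_coord_field.
have /(smooth_vfieldP As _ qc) := conn_smooth CD sV sE.
by move=> /(_ l); apply: smooth_fun_eq; apply: near_ptT => q'; rewrite mxE.
Qed.

Lemma conn_trace_smooth q (V : vfield A) : chart_at A q c -> smooth_vfield A V q ->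
  smooth_fun A (fun q' => conn_trace (V q')) q.
Proof. by move=> qc sV; apply: smooth_fun_sum => j; exact: christoffel_smooth. Qed.

Section AtPoint.
Variable p : M.
Hypothesis pc : chart_at A p c.

(** The quadratic terms in the Christoffel matrices contribute traces of the two products in
    opposite orders, which cancel; only the exterior derivative of [conn_trace] is left. *)
Lemma trace_curvE (x y : tangent A p) :
  tangent_trace As c (curv D As c x y) =
  dird x (fun q => conn_trace (cfield As c (y c) q)) -
  dird y (fun q => conn_trace (cfield As c (x c) q)).
Proof.
have sE j : smooth_vfield A (coord_field As c j) p by exact: smooth_coord_field.
have scf (z : tangent A p) : smooth_vfield A (cfield As c (z c)) p by exact: cfield_smooth.
have sG (z : tangent A p) j l : smooth_fun A (fun q => christoffel (cfield As c (z c) q) j l) p.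
  exact: christoffel_smooth.
have H (u v : tangent A p) : \sum_j (D u (fun q => D (cfield As c (v c) q) (coord_field As c j))) c 0 j =
    dird u (fun q => conn_trace (cfield As c (v c) q)) + \tr (christoffel v *m christoffel u).
  rewrite (dird_sum As)// -big_split; apply: eq_bigr => j _ /=.
  have sGE l : smooth_vfield A (fun q => christoffel (cfield As c (v c) q) j l *: coord_field As c l q) p.
    exact: smooth_vfieldZ.
  rewrite -(@conn_eq _ _ _ _ D CD _ u (fun q => \sum_l christoffel (cfield As c (v c) q) j l *:
    coord_field As c l q)); last 2 first.
  - apply: (near_ptS (near_pt_chart As pc)) => q qc.
    rewrite [RHS](tangent_sum As _ qc); apply: eq_bigr => l _; by rewrite mxE.
  - exact: smooth_vfield_sum.
  rewrite (conn_sum As CD)// coords_sum.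
  under eq_bigr => l _ do rewrite (conn_leibniz CD)// tangent_evD !tangent_evZ coord_field_delta//.
  rewrite big_split /= (sum_deltar (fun l => dird u (fun q => christoffel (cfield As c (v c) q) j l))).
  congr (_ + _); rewrite mxE; apply: eq_bigr => l _; rewrite [christoffel u l j]mxE.
  by rewrite cfield_id.
have curvE' j : curv D As c x y (coord_field As c j p) =
    D x (fun q => D (cfield As c (y c) q) (coord_field As c j)) -
    D y (fun q => D (cfield As c (x c) q) (coord_field As c j)).
  by rewrite /curv tangent_ofE// cfield_coord.
rewrite /tangent_trace; under eq_bigr => j _ do rewrite curvE' tangent_evD tangent_evN.
rewrite big_split /= sumrN !H mxtrace_mulC; ring.
Qed.

(** The invariant formula for an exterior derivative: for general fields the derivatives of their
    components are compensated by the bracket term. *)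
Lemma conn_trace_d (U V : vfield A) : smooth_vfield A U p -> smooth_vfield A V p ->
  dird (U p) (fun q => conn_trace (V q)) - dird (V p) (fun q => conn_trace (U q))
    - conn_trace (lie_bracket A U V p)
  = tangent_trace As c (curv D As c (U p) (V p)).
Proof.
move=> sU sV; rewrite trace_curvE.
pose th k q := conn_trace (coord_field As c k q).
have sth k : smooth_fun A (th k) p.
  by apply: conn_trace_smooth => //; exact: smooth_coord_field.
have E (u : tangent A p) (W : vfield A) : smooth_vfield A W p ->
   dird u (fun q => conn_trace (W q)) =
   \sum_k (dird u (fun q => W q c 0 k) * th k p + W p c 0 k * dird u (th k)).
  move=> sW; have sWk := (smooth_vfieldP As _ pc).1 sW.
  rewrite -(@dird_eq _ _ _ _ As p u (fun q => \sum_k W q c 0 k * th k q)).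
  - rewrite (dird_sum As); last by move=> k; exact: smooth_funM.
    by apply: eq_bigr => k _; rewrite (dirdM As).
  - by apply: (near_ptS (near_pt_chart As pc)) => q qc; rewrite [RHS]conn_trace_expand.
  - by apply: smooth_fun_sum => k; exact: smooth_funM.
have cst0 (u : tangent A p) (z : tangent A p) k : dird u (fun q => cfield As c (z c) q c 0 k) = 0.
  rewrite -(@dird_eq _ _ _ _ As p u (fun=> z c 0 k)) ?dird_cst//; last exact: smooth_fun_cst.
  by apply: (near_ptS (near_pt_chart As pc)) => q qc; rewrite cfieldE.
have scf (z : tangent A p) : smooth_vfield A (cfield As c (z c)) p by exact: cfield_smooth.
rewrite !E// conn_trace_expand// -!sumrB; apply: eq_bigr => k _.
have -> : lie_bracket A U V p c 0 k = dird (U p) (fun q => V q c 0 k) - dird (V p) (fun q => U q c 0 k).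
  rewrite -(dird_coord As (lie_bracket A U V p) k pc) (lie_bracketP As sU sV (smooth_fun_coord As k pc)).
  have dc (u : tangent A p) (W : vfield A) : smooth_vfield A W p ->
      dird u (fun y => dird (W y) (fun y0 => c y0 0 k)) = dird u (fun q => W q c 0 k).
    move=> sW; have sd := smooth_dird As sW (smooth_fun_coord As k pc).
    refine (dird_eq As u _ sd).
    by apply: (near_ptS (near_pt_chart As pc)) => q qc; rewrite dird_coord.
  by rewrite (dc (U p) V sV) (dc (V p) U sU).
rewrite !cst0 (cfield_id As (U p) pc) (cfield_id As (V p) pc) -[conn_trace _]/(th k p).
abstract_terms @dird; abstract_terms @fun_of_matrix; abstract_terms th; ring.
Qed.

(** On a line bundle the curvature is the exterior derivative of the connection form, here -
    [conn_trace]; the derivatives of the coefficient [h] cancel by the definition of the bracket. *)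
Lemma topform_curvature (U V : vfield A) (w : topform A) :
  smooth_vfield A U p -> smooth_vfield A V p -> smooth_topform w p ->
  curvature (E := fun q => ('I_m -> tangent A q) -> R^o) (topform_conn D) U V w p
    = (- tangent_trace As c (curv D As c (U p) (V p)) : R) *: w p.
Proof.
move=> sU sV [walt sw]; pose h q : R := w q (chart_frame q).
have sh : smooth_fun A h p by apply: sw => i; exact: smooth_coord_field.
have wE : near_pt A p (fun q => forall y, w q y = h q * chart_det y).
  apply: (near_ptS2 (near_pt_chart As pc) walt) => q qc wq y; exact: alternating_det.
have sD (W : vfield A) : smooth_vfield A W p ->
    smooth_fun A (fun q => dird (W q) h - h q * conn_trace (W q)) p.
  move=> sW; apply: smooth_funB; first exact: smooth_dird.
  by apply: smooth_funM => //; exact: conn_trace_smooth.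
have wDE (W : vfield A) : near_pt A p (fun q => forall y, topform_conn D (W q) w y =
    (dird (W q) h - h q * conn_trace (W q)) * chart_det y).
  apply: (near_ptS3 (near_pt_chart As pc) (smooth_fun_near As sh) (near_pt_near As wE)) => q qc shq wEq y.
  by rewrite (topform_conn_det (W q) qc shq wEq).
apply/funext => y; rewrite /curvature.
have -> : topform_conn D (U p) (fun q => topform_conn D (V q) w) = _ := topform_conn_det (U p) pc (sD V sV) (wDE V).
have -> : topform_conn D (V p) (fun q => topform_conn D (U q) w) = _ := topform_conn_det (V p) pc (sD U sU) (wDE U).
have -> := topform_conn_det (lie_bracket A U V p) pc sh wE.
rewrite -[LHS]/(_ - _ - _) -[RHS]/(_ * w p y) (near_pt_self As wE) -conn_trace_d//.
have sth (W : vfield A) : smooth_vfield A W p -> smooth_fun A (fun q => conn_trace (W q)) p.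
  exact: conn_trace_smooth.
have sdh (W : vfield A) : smooth_vfield A W p -> smooth_fun A (fun q => dird (W q) h) p.
  by move=> sW; exact: smooth_dird.
rewrite !(dirdB As) ?(dirdM As); try (by []); try (exact: sth); try (exact: sdh);
  try (by apply: smooth_funM => //; exact: sth).
rewrite (lie_bracketP As)//.
abstract_terms @dird; abstract_terms @conn_trace; abstract_terms chart_det; abstract_terms h; ring.
Qed.

Lemma smooth_chart_det : smooth_topform (fun q (y : 'I_m -> tangent A q) => chart_det y : R^o) p.
Proof.
split.
  apply: (near_ptS (near_pt_chart As pc)) => q qc; split.
    move=> y i a u v; rewrite /chart_det !coord_mx_subst tangent_lin.
    exact: det_set_row_lin.
  move=> y i j ij yij; rewrite /chart_det (determinant_alternate ij)// => l.
  by rewrite !mxE yij.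
move=> Y sY; apply: smooth_det => i j.
have := (smooth_vfieldP As _ pc).1 (sY i) j.
by apply: smooth_fun_eq; apply: near_ptT => q; rewrite mxE.
Qed.

(** Uniqueness of the scalar is tested on the smooth form [chart_det], which takes the value 1 on
    the coordinate frame. *)
Lemma topform_curvE (x y : tangent A p) :
  topform_curv D x y = - tangent_trace As c (curv D As c x y).
Proof.
apply: the_eq => [U V w sU sV sw Ux Vy|r' /= H].
  by rewrite topform_curvature// Ux Vy.
have [sU Ux] := extensionP As x; have [sV Vy] := extensionP As y.
have := H _ _ _ sU sV smooth_chart_det Ux Vy.
rewrite topform_curvature ?Ux ?Vy//; last exact: smooth_chart_det.
move/(congr1 (fun w => w (chart_frame p))).
rewrite -[LHS]/(_ * chart_det _) -[RHS]/(_ * chart_det _) chart_det_frame//.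
by rewrite !mulr1 => ->.
Qed.

End AtPoint.

End TopForms.

(** * The twistor space *)

Section Stereographic.
Variable R : realType.
Implicit Types (a : 'I_3 -> R) (b : 'rV[R]_2).

(* Inverse of the stereographic projection of the unit sphere from (-1, 0, 0). *)
Definition sphere_of b (i : 'I_3) : R :=
  let s := b 0 0 ^+ 2 + b 0 1 ^+ 2 in
  if i == ord0 then (1 - s) / (1 + s)
  else if i == 1 then 2 * b 0 0 / (1 + s) else 2 * b 0 1 / (1 + s).

Lemma sphere_den b : 1 + (b 0 0 ^+ 2 + b 0 1 ^+ 2) != 0.
Proof. by rewrite gt_eqF// ltr_pwDl// addr_ge0 ?sqr_ge0. Qed.

Lemma lift3 : (lift ord0 (0 : 'I_2) = 1 :> 'I_3) * (lift ord0 (1 : 'I_2) = ord_max :> 'I_3).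
Proof. by split; exact: val_inj. Qed.

Lemma ord2P (P : 'I_2 -> Prop) : P 0 -> P 1 -> forall i, P i.
Proof.
move=> P0 P1 [[|[|//]] i2].
- by rewrite (_ : Ordinal i2 = 0)//; exact: val_inj.
- by rewrite (_ : Ordinal i2 = 1)//; exact: val_inj.
Qed.

Lemma sphere_of_unit b : dot3 (sphere_of b) (sphere_of b) = 1.
Proof. have := sphere_den b; rewrite /dot3 sum3 /sphere_of /= => d; by field. Qed.

Lemma sphere_of_pole b : 1 + sphere_of b ord0 = 2 / (1 + (b 0 0 ^+ 2 + b 0 1 ^+ 2)).
Proof. have := sphere_den b; rewrite /sphere_of /= => d; by field. Qed.

Lemma sphere_of_neq b : sphere_of b ord0 != -1.
Proof.
have d := sphere_den b; rewrite -subr_eq0 opprK addrC sphere_of_pole.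
by rewrite mulf_neq0 ?invr_eq0// pnatr_eq0.
Qed.

Lemma stereo_sphere_of b i : sphere_of b (lift ord0 i) / (1 + sphere_of b ord0) = b 0 i.
Proof.
have d := sphere_den b; rewrite sphere_of_pole.
by move: i; apply: ord2P; rewrite ?lift3 /sphere_of /=; field.
Qed.

Lemma sphere_of_stereo a : dot3 a a = 1 -> a ord0 != -1 ->
  forall i, sphere_of (\row_j (a (lift ord0 j) / (1 + a ord0))) i = a i.
Proof.
move=> aa a0; have d : 1 + a ord0 != 0 by rewrite -subr_eq0 opprK addrC in a0.
have E : 1 + ((a 1 / (1 + a ord0)) ^+ 2 + (a ord_max / (1 + a ord0)) ^+ 2) = 2 / (1 + a ord0).
  move: aa; rewrite /dot3 sum3 => aa.
  transitivity (((1 + a ord0) ^+ 2 + (a 1 * a 1 + a ord_max * a ord_max)) / (1 + a ord0) ^+ 2); first by field.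
  have -> : a 1 * a 1 + a ord_max * a ord_max = 1 - a ord0 * a ord0 by rewrite -aa; ring.
  by field.
have E' : (a 1 / (1 + a ord0)) ^+ 2 + (a ord_max / (1 + a ord0)) ^+ 2 = 2 / (1 + a ord0) - 1.
  by rewrite -E; ring.
by apply: ord3P; rewrite /sphere_of /= !mxE !lift3 ?E ?E'; field; rewrite d.
Qed.

End Stereographic.

Section Submx.
Variable R : realType.

Lemma smooth_lsubmx k l (u : 'rV[R]_(k + l)) : smooth_at (fun v : 'rV[R]_(k + l) => lsubmx v) u.
Proof.
apply/smooth_at_coordP => i; apply: smooth_at_near_eq (smooth_at_id_coord (lshift l i) u).
by apply: filterE => v; rewrite mxE.
Qed.

Lemma smooth_rsubmx k l (u : 'rV[R]_(k + l)) : smooth_at (fun v : 'rV[R]_(k + l) => rsubmx v) u.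
Proof.
apply/smooth_at_coordP => i; apply: smooth_at_near_eq (smooth_at_id_coord (rshift k i) u).
by apply: filterE => v; rewrite mxE.
Qed.

Lemma near_lsubmx k l (u : 'rV[R]_(k + l)) v (P : 'rV[R]_k -> Prop) : lsubmx u = v ->
  (\forall x \near v, P x) -> \forall x \near u, P (lsubmx x).
Proof.
move=> <-; apply: (differentiable_continuous (smooth_at_diff (smooth_lsubmx u))).
Qed.

Lemma smooth_sphere_of (b : 'rV[R]_2) i : smooth_at (fun v : 'rV[R]_2 => sphere_of v i : R^o) b.
Proof.
have sb j : smooth_at (fun v : 'rV[R]_2 => v 0 j : R^o) b by exact: smooth_at_id_coord.
have sq j : smooth_at (fun v : 'rV[R]_2 => v 0 j ^+ 2 : R^o) b.
  by apply: smooth_at_near_eq (smooth_atM (sb j) (sb j)); apply: filterE => v.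
have ss : smooth_at (fun v : 'rV[R]_2 => v 0 0 ^+ 2 + v 0 1 ^+ 2 : R^o) b by exact: smooth_atD.
have s1 : smooth_at (fun v : 'rV[R]_2 => (1 + (v 0 0 ^+ 2 + v 0 1 ^+ 2))^-1 : R^o) b.
  by apply: smooth_atV (sphere_den b); apply: smooth_atD => //; exact: smooth_at_cst.
move: i; apply: ord3P; rewrite /sphere_of /=.
- apply: smooth_atM => //; apply: smooth_atD; first exact: smooth_at_cst.
  apply: smooth_at_near_eq (smooth_atM (smooth_at_cst (-1 : R^o) b) ss).
  by apply: filterE => v; rewrite mulN1r.
- by apply: smooth_atM => //; apply: smooth_atM => //; exact: smooth_at_cst.
- by apply: smooth_atM => //; apply: smooth_atM => //; exact: smooth_at_cst.
Qed.

End Submx.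

Section TwistorAtlas.
Variables (R : realType) (M : topologicalType) (m : nat) (A : set (chart R M m)).
Variable Q : forall p : M, set (tangent A p -> tangent A p).
Variable D : affine_connection A.
Hypothesis QS : quaternionic_setting Q D.
Let As := qs_atlas QS.
Implicit Types (p q : M) (z : twistor Q).
Local Notation endo := (forall q, tangent A q -> tangent A q).
Local Notation Z := (twistor Q).
Local Notation AZ := (@twistor_atlas R M m A Q).

Lemma twistor_Q z : Q (tJ (t := z)). Proof. by case: z. Qed.
Lemma twistor_unit z : qdot Q (tJ (t := z)) (tJ (t := z)) = 1. Proof. by case: z. Qed.

(* Coordinates of the tautological section in a local frame. *)
Definition tw_coef (F : 'I_3 -> endo) (i : 'I_3) z : R := qdot Q (F i (tpr z)) (tJ (t := z)).

Section OneFrame.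
Variables (W : set M) (F : 'I_3 -> endo).
Arguments F : clear implicits.
Hypothesis aF : admissible_frame Q W F.

Lemma tw_coef_unit z : W (tpr z) ->
  dot3 (fun i => tw_coef F i z) (fun i => tw_coef F i z) = 1.
Proof.
move=> Wz; rewrite -(qdot_dot (tangent_nonzero QS _) (frame_basis aF Wz)).
- exact: twistor_unit.
- exact: twistor_Q.
- exact: twistor_Q.
Qed.

Lemma tw_expand z : W (tpr z) ->
  tJ (t := z) = lincomb (fun i => F i (tpr z)) (fun i => tw_coef F i z).
Proof.
by move=> Wz; apply: (Q_expand (tangent_nonzero QS _) (frame_basis aF Wz)); exact: twistor_Q.
Qed.

(** The type of [tJ] depends on the base point, so points of Z are compared through real
    coefficients in a frame; once the base points are identified, the remaining fields are
    proofs. *)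
Lemma twistor_eq z z' : W (tpr z) -> tpr z = tpr z' ->
  (forall i, tw_coef F i z = tw_coef F i z') -> z = z'.
Proof.
move=> Wz zz' aa'; have Wz' : W (tpr z') by rewrite -zz'.
have := tw_expand Wz; have := tw_expand Wz'; move: Wz Wz' zz' aa'.
case: z => p B hQ h1; case: z' => p' B' hQ' h1' /= Wp Wp' pp'; move: B' hQ' h1' Wp'.
case: _ / pp' => B' hQ' h1' Wp' aa' E' E.
have BB' : B = B'.
  by rewrite E E'; congr lincomb; apply/funext => i; exact: aa'.
by move: hQ h1 {E aa'}; rewrite BB' => hQ h1; congr Twistor; exact: Prop_irrelevance.
Qed.

Lemma twistor_exists q (a : 'I_3 -> R) : W q -> dot3 a a = 1 ->
  exists z, tpr z = q /\ forall i, tw_coef F i z = a i.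
Proof.
move=> Wq aa; have aJ := frame_basis aF Wq; have Hq := tangent_nonzero QS q.
have hQ : Q (lincomb (fun i => F i q) a) by exact: lincomb_Q.
have h1 : qdot Q (lincomb (fun i => F i q) a) (lincomb (fun i => F i q) a) = 1.
  by rewrite (qdot_lincomb Hq _ _ aJ).
by exists (Twistor hQ h1); split => // i; rewrite /tw_coef /= (qdot_basis Hq _ _ aJ).
Qed.

Section OneChart.
Variable c : chart R M m.
Hypothesis Ac : A c.
Let C := twistor_chart Q c W F.

Lemma twistor_chart_atlas : AZ C. Proof. by exists c, W, F. Qed.

Lemma twistor_chartl z : lsubmx (C z) = c (tpr z).
Proof. by rewrite /C /= row_mxKl. Qed.

Lemma twistor_chartr z : rsubmx (C z) =
  \row_(i < 2) (tw_coef F (lift ord0 i) z / (1 + tw_coef F ord0 z)).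
Proof. by rewrite /C /= row_mxKr. Qed.

Lemma twistor_chart_coef z i : cdom C z -> sphere_of (rsubmx (C z)) i = tw_coef F i z.
Proof.
move=> [cz Wz a0]; rewrite twistor_chartr.
exact: (sphere_of_stereo (a := fun i => tw_coef F i z)) (tw_coef_unit Wz) a0 i.
Qed.

Lemma twistor_chart_inj z z' : cdom C z -> cdom C z' -> C z = C z' -> z = z'.
Proof.
move=> Cz Cz' CC; have [cz Wz _] := Cz; have [cz' Wz' _] := Cz'.
apply: twistor_eq => //.
  by apply: (atlas_inj As) Ac cz cz' _; rewrite -!twistor_chartl CC.
by move=> i; rewrite -!twistor_chart_coef// CC.
Qed.

Lemma twistor_chart_onto q (b : 'rV[R]_2) : cdom c q -> W q ->
  exists z, [/\ cdom C z, tpr z = q & C z = row_mx (c q) b].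
Proof.
move=> cq Wq; have [z [zq za]] := twistor_exists Wq (sphere_of_unit b).
have dz : cdom C z.
  split; rewrite ?zq//; rewrite -[X in X != _]/(tw_coef F ord0 z) za.
  exact: sphere_of_neq.
exists z; split => //.
rewrite -(hsubmxK (C z)) twistor_chartl zq; congr row_mx.
by apply/rowP => i; rewrite twistor_chartr mxE !za stereo_sphere_of.
Qed.

Lemma twistor_cinv z : chart_at AZ z C -> \forall u \near C z,
  [/\ cdom C (cinv C z u), C (cinv C z u) = u,
      tpr (cinv C z u) = cinv c (tpr z) (lsubmx u) &
      forall i, tw_coef F i (cinv C z u) = sphere_of (rsubmx u) i].
Proof.
move=> [_ Cz]; have [cz Wz a0] := Cz.
have pc : chart_at A (tpr z) c by [].
have nW := near_frame QS aF Wz.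
apply: filterS2 (near_lsubmx (twistor_chartl z) (near_cinv As pc))
  (near_lsubmx (twistor_chartl z) (nW c pc)) => u [cu ucu] Wu.
have [z' [dz' z'q Cz']] := twistor_chart_onto (rsubmx u) cu Wu.
have [d e] : cdom C (cinv C z u) /\ C (cinv C z u) = u.
  apply: (@the_spec _ z [set y | cdom C y /\ C y = u]); exists z'; split => //.
  by rewrite Cz' ucu hsubmxK.
split => //; last by move=> i; rewrite -twistor_chart_coef// e.
rewrite -[in RHS]e twistor_chartl (cinvK As)//; by case: d.
Qed.

End OneChart.

End OneFrame.

Lemma AZ_chart C : AZ C -> exists c W F, [/\ A c, admissible_frame Q W F & C = twistor_chart Q c W F].
Proof. by []. Qed.

Lemma frame_change W F W' F' z i : admissible_frame Q W F -> admissible_frame Q W' F' ->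
  W (tpr z) -> W' (tpr z) ->
  tw_coef F' i z = \sum_j qdot Q (F' i (tpr z)) (F j (tpr z)) * tw_coef F j z.
Proof.
move=> aF aF' Wz W'z; rewrite {1}/tw_coef.
have aJ := frame_basis aF Wz; have Hq := tangent_nonzero QS (tpr z).
have QF' : Q (F' i (tpr z)) by exact: (basis_Q i (frame_basis aF' W'z)).
rewrite (qdot_dot Hq aJ QF' (twistor_Q z)); apply: eq_bigr => j _.
by congr (_ * _); apply: (qdotC Hq aJ) => //; exact: (basis_Q j aJ).
Qed.

(* Smoothness at z read in one chart; smooth_fun requires it in all charts. *)
Let smooth_in (g : Z -> R) (C : chart R Z (m + 2)) z := smooth_at (fun u => g (cinv C z u) : R^o) (C z).

Let smooth_in_tpr C z f : chart_at AZ z C -> smooth_fun A f (tpr z) ->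
  smooth_in (fun z => f (tpr z)) C z.
Proof.
move=> zC sf; have [AC Cz] := zC; have [c [W [F [Ac aF CE]]]] := AZ_chart AC.
subst C; have [cz Wz _] := Cz; have pc : chart_at A (tpr z) c by [].
apply: (smooth_at_near_eq (f := fun u => f (cinv c (tpr z) (lsubmx u)) : R^o)).
  by apply: filterS (twistor_cinv aF Ac zC) => u [_ _ -> _].
apply: (smooth_at_comp (h := fun v => f (cinv c (tpr z) v) : R^o)); last exact: smooth_lsubmx.
by rewrite twistor_chartl; exact: sf.
Qed.

(** In the frame of the chart itself the coefficient is a component of [sphere_of]. Another frame
    changes it by a matrix of functions on M, smooth by [smooth_qdot]. *)
Let smooth_in_coef C z W F i : chart_at AZ z C -> admissible_frame Q W F -> W (tpr z) ->
  smooth_in (tw_coef F i) C z.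
Proof.
move=> zC aF' W'z; have [AC Cz] := zC; have [c [W0 [F0 [Ac aF CE]]]] := AZ_chart AC.
subst C; have [cz Wz _] := Cz; have pc : chart_at A (tpr z) c by [].
have sF0 j : smooth_in (tw_coef F0 j) (twistor_chart Q c W0 F0) z.
  apply: (smooth_at_near_eq (f := fun u => sphere_of (rsubmx u) j : R^o)).
    by apply: filterS (twistor_cinv aF Ac zC) => u [_ _ _ ->].
  apply: (smooth_at_comp (h := fun v => sphere_of v j : R^o)); last exact: smooth_rsubmx.
  exact: smooth_sphere_of.
have sg j : smooth_fun A (fun q => qdot Q (F i q) (F0 j q)) (tpr z).
  by apply: (smooth_qdot QS); [exact: (frame_Qsec QS _ aF' W'z)|exact: (frame_Qsec QS _ aF Wz)].
apply: (smooth_at_near_eq (f := fun u => \sum_j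
   (fun z => qdot Q (F i (tpr z)) (F0 j (tpr z))) (cinv (twistor_chart Q c W0 F0) z u) *
   tw_coef F0 j (cinv (twistor_chart Q c W0 F0) z u) : R^o)); last first.
  apply: smooth_at_sum => j; apply: smooth_atM; last exact: sF0.
  by have := smooth_in_tpr zC (sg j).
have nW' := near_frame QS aF' W'z.
have H := near_lsubmx (twistor_chartl W0 F0 c z) (nW' c pc).
apply: filterS2 (twistor_cinv aF Ac zC) H => u [d e tE aE] Wu.
have [_ W0u _] := d; rewrite (frame_change i aF aF') ?tE//.
by rewrite -tE.
Qed.

Let near_in_tpr C z P : chart_at AZ z C -> near_pt A (tpr z) P ->
  \forall u \near C z, P (tpr (cinv C z u)).
Proof.
move=> zC nP; have [AC Cz] := zC; have [c [W [F [Ac aF CE]]]] := AZ_chart AC.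
subst C; have [cz Wz _] := Cz; have pc : chart_at A (tpr z) c by [].
have H := near_lsubmx (twistor_chartl W F c z) (nP c pc).
by apply: filterS2 (twistor_cinv aF Ac zC) H => u [_ _ -> _].
Qed.

Lemma rotate_frame W F (a b : 'I_3 -> R) : admissible_frame Q W F ->
  dot3 a a = 1 -> dot3 b b = 1 -> dot3 a b = 0 ->
  admissible_frame Q W (fun i q => lincomb (fun i => F i q)
     (if i == ord0 then a else if i == 1 then b else cross a b)).
Proof.
move=> aF aa bb ab; have [oW HF] := aF; split => // q Wq; split.
  have := rotate_basis (frame_basis aF Wq) aa bb ab.
  rewrite (_ : (fun i => if i == ord0 then _ else _) = fun i => lincomb (fun i => F i q)
     (if i == ord0 then a else if i == 1 then b else cross a b))//.
  by apply/funext => i; case: ifP => // _; case: ifP.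
move=> i; have sc (a' : 'I_3 -> R) j : smooth_fun A (fun=> a' j) q by exact: smooth_fun_cst.
by have [] := Qsec_lincomb QS aF Wq (sc (if i == ord0 then a else if i == 1 then b else cross a b)).
Qed.

(* Any unit vector J of Q_p is the first vector of a local admissible frame; in
   such a frame the tautological section is (1, 0, 0) at J. *)
Lemma adapted_frame z : exists W F, [/\ W (tpr z), admissible_frame Q W F &
  F ord0 (tpr z) = tJ (t := z)].
Proof.
have [W [F [Wz aF]]] := qs_frame QS (tpr z).
have aa := tw_coef_unit aF Wz; have [b [bb ab]] := orthogonal_unit aa.
exists W, (fun i q => lincomb (fun i => F i q)
  (if i == ord0 then fun i => tw_coef F i z else if i == 1 then b else cross (fun i => tw_coef F i z) b)).
split => //; first exact: rotate_frame.
exact: esym (tw_expand aF Wz).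
Qed.

Lemma adapted_coef W F z i : admissible_frame Q W F -> W (tpr z) ->
  F ord0 (tpr z) = tJ (t := z) -> tw_coef F i z = (i == ord0)%:R.
Proof.
move=> aF Wz Fz; rewrite /tw_coef -Fz.
exact: (qdot_basisE (tangent_nonzero QS _) i ord0 (frame_basis aF Wz)).
Qed.

(** In an adapted frame [z] has coefficients (1, 0, 0), antipodal to the centre (-1, 0, 0) of the
    projection, so it lies in the domain of the chart. *)
Lemma adapted_neq W F z : admissible_frame Q W F -> W (tpr z) ->
  F ord0 (tpr z) = tJ (t := z) -> tw_coef F ord0 z != -1.
Proof.
move=> aF Wz Fz; rewrite (adapted_coef _ aF)// eqxx.
by apply/negP => /eqP h; have : (1 : R) = -1 by []; lra.
Qed.

Lemma adapted_chart_at W F c z : chart_at A (tpr z) c -> admissible_frame Q W F -> W (tpr z) ->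
  F ord0 (tpr z) = tJ (t := z) -> chart_at AZ z (twistor_chart Q c W F).
Proof.
move=> [Ac cz] aF Wz Fz; split; first exact: twistor_chart_atlas.
by split => //; exact: (adapted_neq aF Wz Fz).
Qed.

Lemma twistor_cinv_at C z : chart_at AZ z C -> cinv C z (C z) = z.
Proof.
move=> [AC Cz]; have [c [W [F [Ac aF CE]]]] := AZ_chart AC; subst C.
by apply: the_eq => // y [Cy yz]; exact: twistor_chart_inj yz.
Qed.

(** The coordinates of a second chart are smooth functions read in the first: coordinates of the
    base point, and quotients of coefficients of the tautological section. The denominator stays
    nonzero nearby by continuity, which also settles the domains. *)
Lemma twistor_smooth_atlas : smooth_atlas AZ.
Proof.
have nz C z W F : chart_at AZ z C -> admissible_frame Q W F -> W (tpr z) ->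
    tw_coef F ord0 z != -1 -> smooth_at (fun u => 1 + tw_coef F ord0 (cinv C z u) : R^o) (C z) /\
    1 + tw_coef F ord0 (cinv C z (C z)) != 0.
  move=> zC aF Wz a0; split.
    by apply: smooth_atD; [exact: smooth_at_cst|exact: (@smooth_in_coef C z W F ord0 zC aF Wz)].
  by rewrite twistor_cinv_at// addrC -(opprK 1) subr_eq0.
split.
- move=> C z z' AC; have [c [W [F [Ac aF CE]]]] := AZ_chart AC; subst C.
  exact: twistor_chart_inj.
- move=> C z zC; have [AC Cz] := zC; have [c [W [F [Ac aF CE]]]] := AZ_chart AC; subst C.
  by apply: filterS (twistor_cinv aF Ac zC) => u [d e _ _]; exists (cinv (twistor_chart Q c W F) z u).
- move=> z C C' zC zC'; have [AC' Cz'] := zC'; have [c [W [F [Ac aF CE]]]] := AZ_chart AC'; subst C'.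
  have [cz Wz a0] := Cz'; have pc : chart_at A (tpr z) c by [].
  have n1 := near_in_tpr zC (near_pt_chart As pc).
  have n2 := near_in_tpr zC (near_frame QS aF Wz).
  have [s1 d1] := nz _ _ _ _ zC aF Wz a0.
  have n3 : \forall u \near C z, 1 + tw_coef F ord0 (cinv C z u) != 0.
    have cs : (fun u => 1 + tw_coef F ord0 (cinv C z u)) u @[u --> C z] --> 1 + tw_coef F ord0 (cinv C z (C z)).
      exact: differentiable_continuous (smooth_at_diff s1).
    exact: cvgr_neq0 cs d1.
  apply: filterS3 n1 n2 n3 => u [Ac' cu] Wu au; split => //.
  by move: au; rewrite addrC -{1}(opprK 1) subr_eq0.
- move=> z C C' zC zC'; have [AC' Cz'] := zC'; have [c [W [F [Ac aF CE]]]] := AZ_chart AC'; subst C'.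
  have [cz Wz a0] := Cz'; have pc : chart_at A (tpr z) c by [].
  have [s1 d1] := nz _ _ _ _ zC aF Wz a0.
  apply/smooth_at_coordP => i; case: (split_ordP i) => j ->.
    have := smooth_in_tpr zC (smooth_fun_coord As j pc); apply: smooth_at_near_eq.
    by apply: filterE => u; rewrite /transition row_mxEl.
  have := smooth_atM (smooth_in_coef (lift ord0 j) zC aF Wz) (smooth_atV s1 d1).
  by apply: smooth_at_near_eq; apply: filterE => u; rewrite /transition row_mxEr mxE.
- move=> z; have [W [F [Wz aF Fz]]] := adapted_frame z; have [c pc] := atlas_cover As (tpr z).
  by exists (twistor_chart Q c W F); exact: adapted_chart_at.
Qed.

Lemma smooth_fun_tpr z f : smooth_fun A f (tpr z) -> smooth_fun AZ (fun z => f (tpr z)) z.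
Proof. by move=> sf C zC; exact: smooth_in_tpr. Qed.

Lemma smooth_tw_coef W F z i : admissible_frame Q W F -> W (tpr z) -> smooth_fun AZ (tw_coef F i) z.
Proof. by move=> aF Wz C zC; exact: (@smooth_in_coef C z W F). Qed.

Lemma near_pt_tpr z P : near_pt A (tpr z) P -> near_pt AZ z (fun z => P (tpr z)).
Proof. by move=> nP C zC; exact: near_in_tpr. Qed.

End TwistorAtlas.

(** * Push-forward of tangent vectors as derivations *)

Section Push.
Variables (R : realType) (X Y : Type) (k l : nat).
Variables (A : set (chart R X k)) (B : set (chart R Y l)).
Hypotheses (As : smooth_atlas A) (Bs : smooth_atlas B).
Variables (F : X -> Y) (x : X) (y : Y).
Hypothesis Fx : F x = y.

(** Continuity and smoothness at a point, phrased by pulling back neighbourhoods and functions, so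
    that the target may be the twistor space. *)
Definition smooth_map := (forall P, near_pt B y P -> near_pt A x (fun q => P (F q))) /\
  (forall f, smooth_fun B f y -> smooth_fun A (fun q => f (F q)) x).

Lemma smooth_map_chart C : chart_at B y C -> near_pt A x (fun q => cdom C (F q)) ->
  (forall i, smooth_fun A (fun q => C (F q) 0 i) x) -> smooth_map.
Proof.
move=> yC nC sC; have [c xc] := atlas_cover As x.
pose g u := C (F (cinv c x u)).
have sg : smooth_at g (c x) by apply/smooth_at_coordP => i; exact: (sC i c xc).
have gx : g (c x) = C y by rewrite /g (cinvK_at As xc) Fx.
have gcont := differentiable_continuous (smooth_at_diff sg).
have gnear (P : 'rV[R]_l -> Prop) : (\forall u \near C y, P u) -> \forall u \near c x, P (g u).
  by rewrite -gx => nP; exact: gcont nP.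
have [BC _] := yC.
split => [P nP|f sf].
  apply/(near_ptE As _ xc).
  apply: filterS2 (gnear _ (nP C yC)) (nC c xc) => u; rewrite /g => h d.
  by rewrite (cinvK Bs) in h.
apply/(smooth_funE As _ xc).
apply: (smooth_at_near_eq (f := fun u => f (cinv C y (g u)) : R^o)).
  by apply: filterS (nC c xc) => u d; rewrite /g (cinvK Bs).
apply: (smooth_at_comp (h := fun v => f (cinv C y v) : R^o)) => //.
by rewrite gx; exact: sf.
Qed.

Hypothesis sF : smooth_map.

(** Replaces the comparison of coordinates in all pairs of charts by the action on functions; later
    push-forwards are computed in this form only. *)
Lemma is_pushP (v : tangent A x) (w : tangent B y) : is_push F v w <->
  forall f, smooth_fun B f y -> dird w f = dird v (fun q => f (F q)).
Proof.
have [nF sF'] := sF.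
have sg c C : chart_at A x c -> chart_at B y C -> smooth_at (fun u => C (F (cinv c x u))) (c x).
  by move=> xc yC; apply/smooth_at_coordP => i; exact: (sF' _ (smooth_fun_coord Bs i yC) c xc).
split=> [pw f sf|H c C xc yC].
  have [c xc] := atlas_cover As x; have [C yC] := atlas_cover Bs y; have [BC _] := yC.
  have gx : C y = C (F (cinv c x (c x))) by rewrite (cinvK_at As xc) Fx.
  rewrite (dirdE Bs w yC sf) (dirdE As v xc (sF' _ sf)) (pw c C xc yC).
  rewrite -(near_eq_derive (f := fun u => f (cinv C y (C (F (cinv c x u)))) : R^o)); last first.
    by apply: filterS (nF _ (near_pt_chart Bs yC) c xc) => u [_ d]; rewrite (cinvK Bs).
  have dh : differentiable (fun u => f (cinv C y u) : R^o) (C y) by exact: smooth_at_diff (sf C yC).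
  apply: etrans (deriveE _ dh) _; apply: esym.
  exact: derive_comp_at _ (smooth_at_diff (sg c C xc yC)) dh gx.
apply/rowP => i; rewrite -(dird_coord Bs w i yC) H; last exact: (smooth_fun_coord Bs i yC).
rewrite (dirdE As v xc (sF' _ (smooth_fun_coord Bs i yC))).
have d := smooth_at_diff (sg c C xc yC).
have E1 := derive_coord (v c) i d.
have E2 : 'D_(v c) (fun u => C (F (cinv c x u))) (c x) = 'd (fun u => C (F (cinv c x u))) (c x) (v c).
  exact: deriveE.
by rewrite -E2 E1.
Qed.

Lemma push_exists (v : tangent A x) : exists w : tangent B y, is_push F v w.
Proof.
have [nF sF'] := sF.
have [c xc] := atlas_cover As x; have [C yC] := atlas_cover Bs y.
have sg : smooth_at (fun u => C (F (cinv c x u))) (c x).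
  by apply/smooth_at_coordP => i; exact: (sF' _ (smooth_fun_coord Bs i yC) c xc).
have gx : C y = C (F (cinv c x (c x))) by rewrite (cinvK_at As xc) Fx.
exists (tangent_of Bs C y ('d (fun u => C (F (cinv c x u))) (c x) (v c))).
apply/is_pushP => f sf; have [BC _] := yC.
rewrite (dirdE Bs _ yC sf) tangent_ofE// (dirdE As v xc (sF' _ sf)).
rewrite -(near_eq_derive (f := fun u => f (cinv C y (C (F (cinv c x u)))) : R^o)); last first.
  by apply: filterS (nF _ (near_pt_chart Bs yC) c xc) => u [_ d]; rewrite (cinvK Bs).
have dh : differentiable (fun u => f (cinv C y u) : R^o) (C y) by exact: smooth_at_diff (sf C yC).
apply: etrans (deriveE _ dh) _; apply: esym.
exact: derive_comp_at _ (smooth_at_diff sg) dh gx.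
Qed.

Lemma tangent_eq_funs (v w : tangent B y) : (forall f, smooth_fun B f y -> dird v f = dird w f) -> v = w.
Proof.
move=> vw; have [C yC] := atlas_cover Bs y.
by apply: (tangent_eq_dird Bs yC) => i; apply: vw; exact: smooth_fun_coord.
Qed.

End Push.

Section DirdAlgebra.
Variables (R : realType) (X : Type) (k : nat) (A : set (chart R X k)).
Hypothesis As : smooth_atlas A.
Variable x : X.
Implicit Types (v : tangent A x) (f g : X -> R).

Lemma smooth_near_neq f r : smooth_fun A f x -> f x != r -> near_pt A x (fun y => f y != r).
Proof.
move=> sf fr c xc; have cf : (fun u => f (cinv c x u)) u @[u --> c x] --> f (cinv c x (c x)).
  exact: differentiable_continuous (smooth_at_diff (sf c xc)).
have d : f (cinv c x (c x)) != r by rewrite (cinvK_at As xc).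
by apply: (cf (fun y => y != r)); apply: (open_nbhs_nbhs (A := [set y | y != r])); split => //; exact: openC.
Qed.

Lemma dird_div v f g : smooth_fun A f x -> smooth_fun A g x -> g x != 0 ->
  dird v (fun y => f y / g y) = (dird v f - f x / g x * dird v g) / g x.
Proof.
move=> sf sg g0; have sV := smooth_funV As sg g0.
have sq : smooth_fun A (fun y => f y / g y) x by exact: smooth_funM.
have : dird v (fun y => f y / g y * g y) = dird v f.
  apply: (dird_eq As v); last exact: smooth_funM.
  by apply: near_ptS (smooth_near_neq sg g0) _ => y gy; rewrite divfK.
rewrite (dirdM As v sq sg) => <-; move: g0; generalize (g x) (f x); abstract_terms @dird.
by move=> r' s' g0; field.
Qed.

Lemma dird_dot (n : nat) v (a b : 'I_n -> X -> R) : (forall i, smooth_fun A (a i) x) ->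
  (forall i, smooth_fun A (b i) x) ->
  dird v (fun y => \sum_i a i y * b i y) = \sum_i (dird v (a i) * b i x + a i x * dird v (b i)).
Proof.
move=> sa sb; rewrite (dird_sum As v); last by move=> i; exact: smooth_funM.
by apply: eq_bigr => i _; rewrite (dirdM As v (sa i) (sb i)).
Qed.

Lemma smooth_fun_dot (n : nat) (a b : 'I_n -> X -> R) : (forall i, smooth_fun A (a i) x) ->
  (forall i, smooth_fun A (b i) x) -> smooth_fun A (fun y => \sum_i a i y * b i y) x.
Proof. by move=> sa sb; apply: smooth_fun_sum => i; exact: smooth_funM. Qed.

Lemma dird_dot_cst (n : nat) v (a b : 'I_n -> X -> R) r : (forall i, smooth_fun A (a i) x) ->
  (forall i, smooth_fun A (b i) x) -> near_pt A x (fun y => \sum_i a i y * b i y = r) ->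
  \sum_i (dird v (a i) * b i x + a i x * dird v (b i)) = 0.
Proof.
move=> sa sb ab; rewrite -dird_dot//; apply: etrans (dird_cst As v r).
by apply: (dird_eq As v ab); exact: smooth_fun_dot.
Qed.

End DirdAlgebra.

(** * Tangent vectors of Z through the projection and the frame coefficients *)

Section TwistorTangent.
Variables (R : realType) (M : topologicalType) (m : nat) (A : set (chart R M m)).
Variable Q : forall p : M, set (tangent A p -> tangent A p).
Variable D : affine_connection A.
Hypothesis QS : quaternionic_setting Q D.
Let As := qs_atlas QS.
Let AZs := twistor_smooth_atlas QS.
Implicit Types (p q : M) (z : twistor Q).
Local Notation endo := (forall q, tangent A q -> tangent A q).
Local Notation Z := (twistor Q).
Local Notation AZ := (@twistor_atlas R M m A Q).
Local Notation TZ := (tangent AZ).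

Lemma smooth_map_tpr z : smooth_map AZ A (@tpr R M m A Q) z (tpr z).
Proof. by split=> [P nP|f sf]; [exact: (near_pt_tpr QS nP)|exact: (smooth_fun_tpr QS sf)]. Qed.

Lemma pi_push_dird z (v : TZ z) f : smooth_fun A f (tpr z) ->
  dird (pi_push v) f = dird v (fun z' => f (tpr z')).
Proof.
have H := is_pushP AZs As (erefl (tpr z)) (smooth_map_tpr z) v.
have : is_push (@tpr R M m A Q) v (pi_push v).
  apply: (@the_spec _ _ [set w | is_push (@tpr R M m A Q) v w]).
  exact: (push_exists AZs As (erefl (tpr z)) (smooth_map_tpr z)).
by move=> /H; exact.
Qed.

Lemma pi_push_eq z (v : TZ z) (x : tangent A (tpr z)) :
  (forall f, smooth_fun A f (tpr z) -> dird x f = dird v (fun z' => f (tpr z'))) -> pi_push v = x.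
Proof. by move=> H; apply: (tangent_eq_funs As) => f sf; rewrite pi_push_dird// H. Qed.

Lemma pi_push_lin z (a : R) (v w : TZ z) : pi_push (a *: v + w) = a *: pi_push v + pi_push w.
Proof.
apply: pi_push_eq => f sf; rewrite (dird_lin As)// !pi_push_dird// (dird_lin AZs)//.
exact: (smooth_fun_tpr QS sf).
Qed.

Lemma pi_push_coord z (v : TZ z) c i : chart_at A (tpr z) c ->
  (pi_push v) c 0 i = dird v (fun z' => c (tpr z') 0 i).
Proof.
by move=> pc; rewrite -(pi_push_dird v (smooth_fun_coord As i pc)) (dird_coord As _ _ pc).
Qed.

Lemma tw_coef_sum W F z : admissible_frame Q W F -> W (tpr z) ->
  near_pt AZ z (fun z' => \sum_i tw_coef F i z' * tw_coef F i z' = 1).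
Proof.
move=> aF Wz; apply: near_ptS (near_pt_tpr QS (near_frame QS aF Wz)) _ => z' Wz'.
exact: (tw_coef_unit QS aF Wz').
Qed.

(** The tautological section has constant norm, so its derivative is orthogonal to it. *)
Lemma dird_tw_coef_orth W F z (v : TZ z) : admissible_frame Q W F -> W (tpr z) ->
  \sum_i tw_coef F i z * dird v (tw_coef F i) = 0.
Proof.
move=> aF Wz; have sa i := smooth_tw_coef QS i aF Wz.
have := dird_dot_cst AZs v sa sa (tw_coef_sum aF Wz).
rewrite (eq_bigr (fun i => 2 * (tw_coef F i z * dird v (tw_coef F i)))); last by move=> i _; ring.
by rewrite -mulr_sumr => /eqP; rewrite mulf_eq0 pnatr_eq0 => /eqP.
Qed.

Lemma dird_adapted W F z (v : TZ z) : admissible_frame Q W F -> W (tpr z) ->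
  F ord0 (tpr z) = tJ (t := z) -> dird v (tw_coef F ord0) = 0.
Proof.
move=> aF Wz Fz; have a i := adapted_coef QS i aF Wz Fz.
have e (r0 r1 r2 : R) : true%:R * r0 + false%:R * r1 + false%:R * r2 = 0 -> r0 = 0.
  by rewrite mul1r !mul0r !addr0.
apply: e; apply: etrans (dird_tw_coef_orth v aF Wz); apply: esym.
by apply: etrans (sum3 _) _; rewrite (a ord0) (a 1) (a ord_max).
Qed.

Section Stereo.
Variables (W : set M) (F : 'I_3 -> endo).
Arguments F : clear implicits.
Hypothesis aF : admissible_frame Q W F.
Variable z : Z.
Hypotheses (Wz : W (tpr z)) (a0 : tw_coef F ord0 z != -1).

Lemma stereo_den : 1 + tw_coef F ord0 z != 0.
Proof. by move: a0; rewrite -subr_eq0 opprK addrC. Qed.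

Lemma smooth_stereo_den : smooth_fun AZ (fun z' => 1 + tw_coef F ord0 z') z.
Proof.
apply: smooth_funD; [exact: smooth_fun_cst|exact: (smooth_tw_coef QS _ aF Wz)].
Qed.

Lemma smooth_stereo j :
  smooth_fun AZ (fun z' => tw_coef F (lift ord0 j) z' / (1 + tw_coef F ord0 z')) z.
Proof.
apply: smooth_funM; first exact: (smooth_tw_coef QS _ aF Wz).
by apply: (smooth_funV AZs smooth_stereo_den); exact: stereo_den.
Qed.

Lemma dird_stereo (v : TZ z) j :
  dird v (fun z' => tw_coef F (lift ord0 j) z' / (1 + tw_coef F ord0 z')) =
  (dird v (tw_coef F (lift ord0 j)) - tw_coef F (lift ord0 j) z / (1 + tw_coef F ord0 z)
     * dird v (tw_coef F ord0)) / (1 + tw_coef F ord0 z).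
Proof.
rewrite (dird_div AZs v (smooth_tw_coef QS _ aF Wz) smooth_stereo_den stereo_den).
rewrite (dirdD AZs v (smooth_fun_cst (A := AZ) (x := z) 1) (smooth_tw_coef QS ord0 aF Wz)).
by rewrite (dird_cst AZs) add0r.
Qed.

Variable c : chart R M m.
Hypothesis pc : chart_at A (tpr z) c.
Let C := twistor_chart Q c W F.

Lemma stereo_chart_at : chart_at AZ z C.
Proof. by have [Ac cz] := pc; split; [exact: twistor_chart_atlas|]. Qed.

Lemma twistor_chart_lshift z' i : C z' 0 (lshift 2 i) = c (tpr z') 0 i.
Proof. by rewrite /C /= row_mxEl. Qed.

Lemma twistor_chart_rshift z' j : C z' 0 (rshift m j) =
  tw_coef F (lift ord0 j) z' / (1 + tw_coef F ord0 z').
Proof. by rewrite /C /= row_mxEr mxE. Qed.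

Lemma tangent_lshift (v : TZ z) i : v C 0 (lshift 2 i) = (pi_push v) c 0 i.
Proof.
rewrite (pi_push_coord v i pc) -(dird_coord AZs v _ stereo_chart_at).
by congr dird; apply/funext => z'; exact: twistor_chart_lshift.
Qed.

Lemma tangent_rshift (v : TZ z) j : v C 0 (rshift m j) =
  (dird v (tw_coef F (lift ord0 j)) - tw_coef F (lift ord0 j) z / (1 + tw_coef F ord0 z)
     * dird v (tw_coef F ord0)) / (1 + tw_coef F ord0 z).
Proof.
rewrite -dird_stereo -(dird_coord AZs v _ stereo_chart_at).
by congr dird; apply/funext => z'; exact: twistor_chart_rshift.
Qed.

Lemma twistor_tangent_eq (v w : TZ z) : pi_push v = pi_push w ->
  (forall i, dird v (tw_coef F i) = dird w (tw_coef F i)) -> v = w.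
Proof.
move=> e ea; apply: (tangent_eqP stereo_chart_at); apply/rowP => i.
by case: (split_ordP i) => j ->; rewrite ?tangent_lshift ?tangent_rshift ?e ?ea.
Qed.

End Stereo.

Lemma smooth_vfield_twistor W F c z (U : vfield AZ) : admissible_frame Q W F -> W (tpr z) ->
  tw_coef F ord0 z != -1 -> chart_at A (tpr z) c ->
  (forall i, smooth_fun AZ (fun z' => (pi_push (U z')) c 0 i) z) ->
  (forall i, smooth_fun AZ (fun z' => dird (U z') (tw_coef F i)) z) -> smooth_vfield AZ U z.
Proof.
move=> aF Wz a0 pc sc sa; have zC := stereo_chart_at aF Wz a0 pc.
apply/(smooth_vfieldP AZs _ zC) => i.
have nC : near_pt AZ z (fun z' => [/\ chart_at A (tpr z') c, W (tpr z') & tw_coef F ord0 z' != -1]).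
  apply: near_ptS (near_pt_chart AZs zC) _ => z' [_ [cz' Wz' az']].
  by split => //; split => //; have [] := pc.
have sd := smooth_stereo_den aF Wz.
have sdV := smooth_funV AZs sd (stereo_den a0).
case: (split_ordP i) => j ->.
  apply: (smooth_fun_eq _ (sc j)).
  by apply: near_ptS nC _ => z' [pc' Wz' az']; rewrite (tangent_lshift aF Wz' az' pc').
have sH := smooth_stereo aF Wz a0 j.
have s1 := smooth_funM (smooth_funB (sa (lift ord0 j)) (smooth_funM sH (sa ord0))) sdV.
apply: (smooth_fun_eq _ s1).
by apply: near_ptS nC _ => z' [pc' Wz' az']; rewrite (tangent_rshift aF Wz' az' pc').
Qed.

Lemma twistor_tangent_exists W F z x (b : 'I_3 -> R) : admissible_frame Q W F -> W (tpr z) ->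
  F ord0 (tpr z) = tJ (t := z) -> b ord0 = 0 ->
  exists w : TZ z, pi_push w = x /\ forall i, dird w (tw_coef F i) = b i.
Proof.
move=> aF Wz Fz b0; have [c pc] := atlas_cover As (tpr z).
have a i := adapted_coef QS i aF Wz Fz.
have a0 := adapted_neq QS aF Wz Fz.
pose C := twistor_chart Q c W F.
(* At coefficients (1, 0, 0) the fibre coordinate a_j / (1 + a_0) has derivative a_j' / 2, hence the
   division by 2. *)
pose w := tangent_of AZs C z (row_mx (x c) (\row_j (b (lift ord0 j) / 2))).
have zC : chart_at AZ z C by exact: stereo_chart_at.
have wC : w C = row_mx (x c) (\row_j (b (lift ord0 j) / 2)) by exact: tangent_ofE.
exists w; split.
  apply: (tangent_eqP pc); apply/rowP => i.
  by rewrite -(tangent_lshift aF Wz a0 pc) wC row_mxEl.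
have w0 : dird w (tw_coef F ord0) = 0 by exact: (dird_adapted w aF Wz Fz).
have wj j : dird w (tw_coef F (lift ord0 j)) = b (lift ord0 j).
  have := tangent_rshift aF Wz a0 pc w j; rewrite wC row_mxEr mxE w0 !a /= => h.
  have : b (lift ord0 j) / 2 * 2 = dird w (tw_coef F (lift ord0 j)) / 2 * 2 by rewrite h; field.
  by rewrite !divfK ?pnatr_eq0.
by apply: ord3P; rewrite ?w0// -lift3 wj.
Qed.

End TwistorTangent.

Section LincombSum.
Variables (R : realType) (M : topologicalType) (m : nat) (A : set (chart R M m)) (p : M).

Lemma lincomb_conn (J : 'I_3 -> tangent A p -> tangent A p) (d f : 'I_3 -> R) (o : 'I_3 -> 'I_3 -> R) :
  \sum_i (d i *: (J i : _ -> _) + f i *: (lincomb J (o^~ i) : _ -> _)) =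
  lincomb J (fun i => d i + \sum_j o i j * f j).
Proof.
apply/funext => y; rewrite sum3 lincombE !sum3.
pose g i := d i *: J i y + f i *: lincomb J (o^~ i) y.
rewrite -[LHS]/(g ord0 + g 1 + g ord_max) /g !lincombE; tangent_ring.
Qed.

End LincombSum.

(** * The pulled back connection *)

Section PullbackConnection.
Variables (R : realType) (M : topologicalType) (m : nat) (A : set (chart R M m)).
Variable Q : forall p : M, set (tangent A p -> tangent A p).
Variable D : affine_connection A.
Hypothesis QS : quaternionic_setting Q D.
Let AZs := twistor_smooth_atlas QS.
Implicit Types (p q : M) (z : twistor Q).
Local Notation endo := (forall q, tangent A q -> tangent A q).
Local Notation Z := (twistor Q).
Local Notation AZ := (@twistor_atlas R M m A Q).
Local Notation TZ := (tangent AZ).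
Local Notation psec := (pullback_section Q).
Implicit Types (s t : psec).

Definition sec_coef (F : 'I_3 -> endo) (i : 'I_3) s z : R := qdot Q (F i (tpr z)) (s z).

Definition pconn_comp (F : 'I_3 -> endo) z (v : TZ z) s (i : 'I_3) : R :=
  dird v (sec_coef F i s) + \sum_j conn_form Q D F i j (pi_push v) * sec_coef F j s z.

Lemma smooth_comp W F i s z : admissible_frame Q W F -> W (tpr z) ->
  smooth_pullbackQ s z -> smooth_fun AZ (sec_coef F i s) z.
Proof. by move=> aF Wz [_ sF]; exact: (sF W F Wz aF i). Qed.

Lemma pullback_at s z : smooth_pullbackQ s z -> Q (s z).
Proof. by move=> [/(near_pt_self AZs)]. Qed.

Section OneFrame.
Variables (W : set M) (F : 'I_3 -> endo).
Arguments F : clear implicits.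
Hypothesis aF : admissible_frame Q W F.
Variables (z : Z) (s : psec) (v : TZ z).
Arguments s : clear implicits.
Hypotheses (Wz : W (tpr z)) (ss : smooth_pullbackQ s z).

Let Hq := tangent_nonzero QS (tpr z).
Let aJ := frame_basis aF Wz.

Lemma pullback_conn_lincomb :
  \sum_i (dird v (sec_coef F i s) *: (F i (tpr z) : endo_at z)
    + sec_coef F i s z *: (endo_conn D (pi_push v) (F i) : endo_at z)) =
  lincomb (fun i => F i (tpr z)) (pconn_comp F v s).
Proof.
rewrite -(lincomb_conn (fun i => F i (tpr z)) (fun i => dird v (sec_coef F i s))
  (fun i => sec_coef F i s z) (fun i j => conn_form Q D F i j (pi_push v))).
by apply: eq_bigr => i _; rewrite (endo_conn_frame QS aF (pi_push v) i Wz).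
Qed.

(** Compatibility with the metric, tested against a section pulled back from M. The left-hand side
    and the first term on the right do not involve [F]; this yields independence of the frame. *)
Lemma pullback_metric (B : endo) : Qsec Q B (tpr z) ->
  dird v (fun z' => qdot Q (B (tpr z')) (s z')) =
  qdot Q (endo_conn D (pi_push v) B) (s z) +
  qdot Q (B (tpr z)) (lincomb (fun i => F i (tpr z)) (pconn_comp F v s)).
Proof.
move=> SB; pose b i q := qdot Q (F i q) (B q).
have SF i : Qsec Q (F i) (tpr z) by exact: (frame_Qsec QS i aF Wz).
have sb i : smooth_fun A (b i) (tpr z) by exact: (smooth_qdot QS (SF i) SB).
have sbZ i : smooth_fun AZ (fun z' => b i (tpr z')) z by exact: (smooth_fun_tpr QS (sb i)).
have sf i : smooth_fun AZ (sec_coef F i s) z by exact: (smooth_comp i aF Wz ss).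
have -> : dird v (fun z' => qdot Q (B (tpr z')) (s z')) =
    dird v (fun z' => \sum_i b i (tpr z') * sec_coef F i s z').
  apply: esym; apply: (dird_eq AZs v); last exact: smooth_fun_dot.
  have [nQ _] := ss; have [_ nB] := SB.
  apply: near_ptS3 nQ (near_pt_tpr QS nB) (near_pt_tpr QS (near_frame QS aF Wz)) _.
  move=> z' Qs QB Wz'.
  exact: (esym (qdot_dot (tangent_nonzero QS (tpr z')) (frame_basis aF Wz') QB Qs)).
rewrite (dird_dot AZs v sbZ sf).
have QB : Q (B (tpr z)) by exact: (Qsec_at QS SB).
have QEB : Q (endo_conn D (pi_push v) B) by exact: (endo_conn_Q QS).
rewrite (qdot_dot Hq aJ QEB (pullback_at ss)).
rewrite (qdot_dot Hq aJ QB (lincomb_Q _ aJ)).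
have e i : qdot Q (F i (tpr z)) (endo_conn D (pi_push v) B) =
    dird v (fun z' => b i (tpr z')) - \sum_l conn_form Q D F l i (pi_push v) * b l (tpr z).
  rewrite -(pi_push_dird QS v (sb i)) (qdot_metric QS (pi_push v) (SF i) SB).
  rewrite (endo_conn_frame QS aF (pi_push v) i Wz).
  rewrite (qdot_dot Hq aJ (lincomb_Q _ aJ) QB) /dot3.
  rewrite (eq_bigr (fun l => conn_form Q D F l i (pi_push v) * b l (tpr z))).
    by apply/esym; rewrite addrAC subrr add0r.
  by move=> l _; rewrite (qdot_basis Hq).
rewrite /dot3 !sum3 !e !(qdot_basis Hq _ _ aJ) /pconn_comp !sum3.
rewrite -/(b _ (tpr z)) -/(b 1 (tpr z)) -/(b ord_max (tpr z)).
rewrite -!/(sec_coef F _ s z).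
by abstract_terms @dird; abstract_terms @conn_form; abstract_terms @sec_coef; move: (b) => b'; ring.
Qed.

End OneFrame.

Section Conn.
Variables (z : Z) (s : psec) (v : TZ z).
Arguments s : clear implicits.
Hypothesis ss : smooth_pullbackQ s z.

(** Two frames give the same vector because, by [pullback_metric], its products with the vectors of
    an orthonormal basis are determined without reference to the frame used to differentiate. *)
Lemma pullback_connE W F : admissible_frame Q W F -> W (tpr z) ->
  pullback_conn D v s = lincomb (fun i => F i (tpr z)) (pconn_comp F v s).
Proof.
move=> aF Wz; have aJ := frame_basis aF Wz; have Hq := tangent_nonzero QS (tpr z).
apply: the_eq.
  by exists W, F; split => //; rewrite -(pullback_conn_lincomb aF s v Wz).
move=> B [W' [F' [Wz' aF' ->]]].
apply: etrans (pullback_conn_lincomb aF' s v Wz') _.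
have aJ' := frame_basis aF' Wz'.
rewrite (Q_expand Hq aJ (lincomb_Q _ aJ')) (Q_expand Hq aJ (lincomb_Q (pconn_comp F v s) aJ)).
congr lincomb; apply/funext => i.
have SF := frame_Qsec QS i aF Wz.
have := pullback_metric aF v Wz ss SF; rewrite (pullback_metric aF' v Wz' ss SF).
exact: addrI.
Qed.

Lemma pullback_conn_Q : Q (pullback_conn D v s).
Proof.
have [W [F [Wz aF]]] := qs_frame QS (tpr z).
by rewrite (pullback_connE aF Wz); exact: (lincomb_Q _ (frame_basis aF Wz)).
Qed.

Lemma pullback_conn_comp W F i : admissible_frame Q W F -> W (tpr z) ->
  qdot Q (F i (tpr z)) (pullback_conn D v s) = pconn_comp F v s i.
Proof.
move=> aF Wz; rewrite (pullback_connE aF Wz).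
exact: (qdot_basis (tangent_nonzero QS _) _ _ (frame_basis aF Wz)).
Qed.

End Conn.

Definition tauto : psec := fun z => tJ (t := z).

Lemma smooth_tauto z : smooth_pullbackQ tauto z.
Proof.
split; first by apply: near_ptT => z'; exact: twistor_Q.
by move=> W F Wz aF i; exact: (smooth_tw_coef QS i aF Wz).
Qed.

(* The derivative of the tautological section is the vertical component of v in
   the splitting of TZ induced by D. *)
Definition vpart z (v : TZ z) : endo_at z := pullback_conn D v tauto.

Lemma vpart_comp W F z (v : TZ z) i : admissible_frame Q W F -> W (tpr z) ->
  qdot Q (F i (tpr z)) (vpart v) =
  dird v (tw_coef F i) + \sum_j conn_form Q D F i j (pi_push v) * tw_coef F j z.
Proof. by move=> aF Wz; exact: (pullback_conn_comp v (smooth_tauto z) i aF Wz). Qed.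

(** Differentiating <tau, tau> = 1: the connection forms contribute nothing since they are
    antisymmetric. *)
Lemma vpart_Theta z (v : TZ z) : Theta (vpart v).
Proof.
have Qv := pullback_conn_Q v (smooth_tauto z); split=> //.
have [W [F [Wz aF]]] := qs_frame QS (tpr z).
have aJ := frame_basis aF Wz; have Hq := tangent_nonzero QS (tpr z).
rewrite (qdot_dot Hq aJ Qv (twistor_Q z)) /dot3.
under eq_bigr do rewrite (vpart_comp v _ aF Wz) -/(tw_coef F _ z).
have := dird_tw_coef_orth QS v aF Wz; rewrite !sum3.
have o i j := conn_form_anti QS aF (pi_push v) i j Wz.
have oo i : conn_form Q D F i i (pi_push v) = 0 by have := o i i; abstract_terms @conn_form; move=> r; lra.
rewrite !oo (o 1 ord0) (o ord_max ord0) (o ord_max 1) => h.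
rewrite -[RHS]h.
by abstract_terms @dird; abstract_terms @conn_form; abstract_terms @tw_coef; ring.
Qed.

End PullbackConnection.

(** * The complex structure of the twistor space *)

Section CurveDerivative.
Variable R : realType.

(** This is a stereographic coordinate of (J + t B) / |J + t B|, after clearing the common factor |J
    + t B|. As B is orthogonal to J, that norm is sqrt(1 + c t^2) with c = |B|^2, whose derivative
    at 0 vanishes. *)
Lemma stereo_curve_derive (a0 b0 a b c : R) : 1 + a0 != 0 ->
  is_derive (0 : R^o) (1 : R^o)
    (fun t : R^o => (a + t * b) / (Num.sqrt (1 + t * t * c) + a0 + t * b0) : R^o)
    ((b - a / (1 + a0) * b0) / (1 + a0)).
Proof.
move=> d0.
have d1 : is_derive (0 : R^o) (1 : R^o) (id : R^o -> R^o) 1 by exact: is_derive_id.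
have dc (r : R) : is_derive (0 : R^o) (1 : R^o) (cst r : R^o -> R^o) 0 by exact: is_derive_cst.
have dl (r s : R) : is_derive (0 : R^o) (1 : R^o) (fun t : R^o => r + t * s : R^o) s.
  have := is_deriveD (dc r) (is_deriveM d1 (dc s)).
  by rewrite scaler0 add0r add0r [_ *: _]mulr1.
have s1 : is_derive (0 : R^o) (1 : R^o) (fun t : R^o => 1 + t * t * c : R^o) 0.
  have := is_deriveD (dc 1) (is_deriveM (is_deriveM d1 d1) (dc c)).
  by rewrite !scale0r !scaler0 addr0 scaler0 !add0r.
have e0 : Num.sqrt (1 + 0 * 0 * c) = 1 by rewrite mul0r mul0r addr0 sqrtr1.
have s2 : is_derive (0 : R^o) (1 : R^o) (fun t : R^o => Num.sqrt (1 + t * t * c) : R^o) 0.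
  have h := @is_derive1_sqrt R (1 + 0 * 0 * c).
  have /h h' : 0 < 1 + 0 * 0 * c by rewrite mul0r mul0r addr0.
  by have := @is_derive1_comp R Num.sqrt (fun t => 1 + t * t * c) 0 _ _ h' s1; rewrite mulr0; exact.
have s3 : is_derive (0 : R^o) (1 : R^o) (fun t : R^o => Num.sqrt (1 + t * t * c) + a0 + t * b0 : R^o) b0.
  have := is_deriveD s2 (dl a0 b0); rewrite add0r.
  by rewrite (_ : _ + _ = fun t : R^o => Num.sqrt (1 + t * t * c) + a0 + t * b0 : R^o)//;
    apply/funext => t; rewrite [LHS]addrA.
have n0 : (fun t : R^o => Num.sqrt (1 + t * t * c) + a0 + t * b0 : R^o) 0 != 0.
  by rewrite e0 mul0r addr0.
apply: (is_derive_eq (is_deriveM (dl a b) (@is_deriveV R (fun t : R => Num.sqrt (1 + t * t * c) +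
  a0 + t * b0) 0 b0 1 n0 s3))).
pose q := Num.sqrt (1 + 0 * 0 * c) + a0 + 0 * b0.
transitivity ((a + 0 * b) * (- q ^- 2 * b0) + q^-1 * b); first by [].
by rewrite /q e0; field.
Qed.

Lemma is_derive_rV k (g : R -> 'rV[R]_k) (D : 'rV[R]_k) :
  (forall i, is_derive (0 : R^o) (1 : R^o) (fun t => g t 0 i : R^o) (D 0 i)) ->
  is_derive (0 : R^o) (1 : R^o) g D.
Proof.
move=> gD.
have dg : differentiable (g : R^o -> 'rV[R]_k) 0.
  apply: differentiable_rV => i; apply/derivable1_diffP; exact: (@ex_derive _ _ _ _ _ _ _ (gD i)).
apply: DeriveDef; first exact: diff_derivable.
apply/rowP => i; rewrite (derive_coord _ _ dg).
exact: (@derive_val _ _ _ _ _ _ _ (gD i)).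
Qed.

End CurveDerivative.

Section PrescribedDerivative.
Variables (R : realType) (X : Type) (k : nat) (A : set (chart R X k)).
Hypothesis As : smooth_atlas A.
Variables (p : X) (x : tangent A p).

Lemma exists_dird (r : R) : (x = 0 -> r = 0) ->
  exists l : X -> R, [/\ smooth_fun A l p, l p = 0 & dird x l = r].
Proof.
move=> x0; have [c pc] := atlas_cover As p.
have [E|n0] := eqVneq (x c) 0.
  exists (fun=> 0); split => //; first exact: smooth_fun_cst.
  rewrite (dird_cst As) x0//; apply: (tangent_eqP pc).
  by apply/rowP => i; rewrite tangent_ev0 E mxE.
have [i xi] : exists i, x c 0 i != 0.
  apply/existsP; apply: contra_neqT n0; rewrite negb_exists => /forallP h.
  by apply/rowP => i; rewrite mxE; apply/eqP; move: (h i); rewrite negbK.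
pose g y := c y 0 i - c p 0 i; pose a := r / x c 0 i.
have sc := smooth_fun_coord As i pc.
have sg : smooth_fun A g p by apply: smooth_funB => //; exact: smooth_fun_cst.
exists (fun y => a * g y); split.
- by apply: smooth_funM => //; exact: smooth_fun_cst.
- by rewrite /g subrr mulr0.
- rewrite (dirdM As x (smooth_fun_cst a) sg) (dird_cst As) mul0r add0r.
  rewrite (dirdB As x sc (smooth_fun_cst _)) (dird_cst As) subr0 (dird_coord As x i pc).
  by rewrite /a divfK.
Qed.

(** Take inverse stereographic projection of (l_1, l_2) with l_1, l_2 vanishing at [p]: the last two
    components 2 l / (1 + s) then have derivative 2 l', so l' is prescribed as d / 2. A zero [x]
    admits only zero derivatives, whence the second hypothesis. *)
Lemma sphere_section (d : 'I_3 -> R) : d ord0 = 0 -> (x = 0 -> forall i, d i = 0) ->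
  exists b : 'I_3 -> X -> R, [/\ forall i, smooth_fun A (b i) p,
    forall y, dot3 (b^~ y) (b^~ y) = 1, forall i, b i p = (i == ord0)%:R &
    forall i, dird x (b i) = d i].
Proof.
move=> d0 x0.
have lin (r0 r1 r2 : R) : r0 * 1 + 1 * r0 + (r1 * 0 + 0 * r1) + (r2 * 0 + 0 * r2) = 0 -> r0 = 0.
  by move=> h; lra.
have xd i : x = 0 -> d i / 2 = 0 by move=> /x0 ->; rewrite mul0r.
have [l1 [s1 l10 d1]] := @exists_dird (d 1 / 2) (xd 1).
have [l2 [s2 l20 d2]] := @exists_dird (d ord_max / 2) (xd ord_max).
pose u y : 'rV[R]_2 := \row_j (if j == 0 then l1 y else l2 y).
pose s y := l1 y * l1 y + l2 y * l2 y.
have ss : smooth_fun A s p by apply: smooth_funD; exact: smooth_funM.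
have sd : smooth_fun A (fun y => 1 + s y) p by apply: smooth_funD => //; exact: smooth_fun_cst.
have sp : s p = 0 by rewrite /s l10 l20 !mul0r addr0.
have dp : 1 + s p != 0 by rewrite sp addr0 oner_eq0.
have sdV := smooth_funV As sd dp.
pose b i y := sphere_of (u y) i.
have be y : [/\ b ord0 y = (1 - s y) / (1 + s y), b 1 y = 2 * l1 y / (1 + s y) &
    b ord_max y = 2 * l2 y / (1 + s y)].
  by rewrite /b /sphere_of /= !mxE /= /s.
have e0 : b ord0 = fun y => (1 - s y) / (1 + s y) by apply/funext => y; have [] := be y.
have e1 : b 1 = fun y => 2 * l1 y / (1 + s y) by apply/funext => y; have [] := be y.
have e2 : b ord_max = fun y => 2 * l2 y / (1 + s y) by apply/funext => y; have [] := be y.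
have s2l l : smooth_fun A l p -> smooth_fun A (fun y => 2 * l y) p.
  by move=> sl; apply: smooth_funM => //; exact: smooth_fun_cst.
have sb i : smooth_fun A (b i) p.
  move: i; apply: ord3P; rewrite ?e0 ?e1 ?e2.
  - by apply: smooth_funM => //; apply: smooth_funB => //; exact: smooth_fun_cst.
  - by apply: smooth_funM => //; exact: s2l.
  - by apply: smooth_funM => //; exact: s2l.
have bp i : b i p = (i == ord0)%:R.
  move: i; apply: ord3P; rewrite ?e0 ?e1 ?e2 sp ?l10 ?l20 /= ?mulr0 ?mul0r//.
  by rewrite subr0 addr0 divr1.
have bb y : dot3 (b^~ y) (b^~ y) = 1 by exact: sphere_of_unit.
have dl l r : smooth_fun A l p -> l p = 0 -> dird x l = r / 2 ->
    dird x (fun y => 2 * l y / (1 + s y)) = r.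
  move=> sl l0 dlr; rewrite (dird_div As x (s2l l sl) sd dp).
  rewrite (dirdM As x (smooth_fun_cst 2) sl) (dird_cst As) l0 dlr sp.
  by rewrite mul0r add0r mulr0 !mul0r subr0 addr0 divr1 mulrC divfK.
have db0 : dird x (b ord0) = 0.
  have nb : near_pt A p (fun y => \sum_i b i y * b i y = 1) by apply: near_ptT => y; exact: bb.
  have := dird_dot_cst As x sb sb nb; rewrite sum3 !bp /=.
  exact: lin.
exists b; split => //; apply: ord3P; first by rewrite d0.
- by rewrite e1; exact: dl.
- by rewrite e2; exact: dl.
Qed.

End PrescribedDerivative.

(** * Vertical vectors and horizontal lifts *)

Section VertHor.
Variables (R : realType) (M : topologicalType) (m : nat) (A : set (chart R M m)).
Variable Q : forall p : M, set (tangent A p -> tangent A p).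
Variable D : affine_connection A.
Hypothesis QS : quaternionic_setting Q D.
Let As := qs_atlas QS.
Let AZs := twistor_smooth_atlas QS.
Implicit Types (p q : M) (z : twistor Q).
Local Notation endo := (forall q, tangent A q -> tangent A q).
Local Notation Z := (twistor Q).
Local Notation AZ := (@twistor_atlas R M m A Q).
Local Notation TZ := (tangent AZ).
Local Notation vp := (vpart D).
Local Notation om := (conn_form Q D).

Lemma vpart_dird W F z (v : TZ z) i : admissible_frame Q W F -> W (tpr z) ->
  dird v (tw_coef F i) = qdot Q (F i (tpr z)) (vp v) - \sum_j om F i j (pi_push v) * tw_coef F j z.
Proof. by move=> aF Wz; rewrite (vpart_comp QS v i aF Wz) addrK. Qed.

Lemma twistor_tangent_ext z (v w : TZ z) : pi_push v = pi_push w -> vp v = vp w -> v = w.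
Proof.
move=> pvw vvw; have [W [F [Wz aF Fz]]] := adapted_frame QS z.
have [c pc] := atlas_cover As (tpr z).
have a0 := adapted_neq QS aF Wz Fz.
apply: (twistor_tangent_eq QS aF Wz a0 pc pvw) => i.
by rewrite !(vpart_dird _ i aF Wz) pvw vvw.
Qed.

(** The equation D_w tau = B is solved for the derivatives of the coefficients. The one along J must
    be 0, and it is: B is orthogonal to J and the diagonal connection forms vanish. *)
Lemma twistor_split z (x : tangent A (tpr z)) (B : endo_at z) : Theta B ->
  exists w : TZ z, pi_push w = x /\ vp w = B.
Proof.
move=> [QB BJ]; have [W [F [Wz aF Fz]]] := adapted_frame QS z.
have aJ := frame_basis aF Wz; have Hq := tangent_nonzero QS (tpr z).
pose b i := qdot Q (F i (tpr z)) B - \sum_j om F i j x * tw_coef F j z.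
have b0 : b ord0 = 0.
  rewrite /b Fz -(qdotC Hq aJ QB (twistor_Q z)) BJ sum3 !(adapted_coef QS _ aF Wz Fz).
  have o := conn_form_anti QS aF x ord0 ord0 Wz.
  have o0 : om F ord0 ord0 x = 0 by move: o; abstract_terms @conn_form; move=> r; lra.
  by rewrite o0 mul0r /= !mulr0 !addr0 oppr0 addr0.
have [w [wx wb]] := twistor_tangent_exists QS x aF Wz Fz b0.
exists w; split => //.
have Qw : Q (vp w) by have [] := vpart_Theta QS w.
rewrite (Q_expand Hq aJ Qw) [RHS](Q_expand Hq aJ QB); congr lincomb; apply/funext => i.
by rewrite (vpart_comp QS w i aF Wz) wb wx /b subrK.
Qed.

Lemma vpart_lin z (a : R) (v w : TZ z) : vp (a *: v + w) = a *: vp v + vp w.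
Proof.
have [W [F [Wz aF]]] := qs_frame QS (tpr z).
have aJ := frame_basis aF Wz; have Hq := tangent_nonzero QS (tpr z).
have Qv (u : TZ z) : Q (vp u) by have [] := vpart_Theta QS u.
rewrite (Q_expand Hq aJ (Qv (a *: v + w))) [RHS](Q_expand Hq aJ (Q_lincomb2 a aJ (Qv v) (Qv w))).
congr lincomb; apply/funext => i.
rewrite (qdot_lin Hq a aJ (Qv v) (Qv w) (basis_Q i aJ)) !(vpart_comp QS _ i aF Wz).
rewrite (dird_lin AZs a v w (smooth_tw_coef QS i aF Wz)) !sum3 (pi_push_lin QS).
rewrite !(conn_form_lin QS aF a (pi_push v) (pi_push w) _ _ Wz).
by abstract_terms @dird; abstract_terms @conn_form; abstract_terms @tw_coef; ring.
Qed.

Lemma mk_twistorE z0 p (B : tangent A p -> tangent A p) (hQ : Q B) (h1 : qdot Q B B = 1) :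
  mk_twistor z0 B = Twistor hQ h1.
Proof.
apply: the_eq; first by exists hQ, h1.
by move=> z [hQ' [h1' ->]]; congr Twistor; exact: Prop_irrelevance.
Qed.

(** The vector over 0 with D tau = B is shown to be the velocity of the normalized curve in every
    chart; uniqueness of derivatives in one chart then identifies it with [vert B]. *)
Lemma vertP z (B : endo_at z) : Theta B -> pi_push (vert B) = 0 /\ vp (vert B) = B.
Proof.
move=> tB; have [w [wx wB]] := twistor_split 0 tB; have [QB BJ] := tB.
suff -> : vert B = w by [].
have Hq := tangent_nonzero QS (tpr z).
pose b2 := qdot Q B B.
have [W0 [F0 [Wz0 aF0]]] := qs_frame QS (tpr z).
have aJ0 := frame_basis aF0 Wz0.
have QC (t : R) : Q ((tJ (t := z) : endo_at z) + t *: B).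
  by apply: (QD aJ0); [exact: twistor_Q|exact: (QZ _ aJ0)].
have CC (t : R) : qdot Q ((tJ (t := z) : endo_at z) + t *: B) ((tJ (t := z) : endo_at z) + t *: B) = 1 + t * t * b2.
  have QJ := twistor_Q z; have QtB : Q (t *: B) by exact: (QZ _ aJ0).
  have JB : qdot Q (tJ (t := z)) B = 0 by rewrite (qdotC Hq aJ0).
  rewrite (qdotD Hq aJ0 QJ QtB (QC t)) (qdotC Hq aJ0 (QC t) QJ) (qdotC Hq aJ0 (QC t) QtB).
  rewrite (qdotD Hq aJ0 QJ QtB QJ) (qdotD Hq aJ0 QJ QtB QtB) (twistor_unit z).
  rewrite (qdotZ Hq _ aJ0 QB QJ) JB (qdotC Hq aJ0 QtB QJ) (qdotZ Hq _ aJ0 QB QJ) JB.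
  rewrite (qdotZ Hq _ aJ0 QB QtB) (qdotC Hq aJ0 QtB QB) (qdotZ Hq _ aJ0 QB QB) -/b2; ring.
have b2ge : 0 <= b2.
  rewrite /b2 (qdot_dot Hq aJ0 QB QB); apply: sumr_ge0 => i _; exact: sqr_ge0.
have pos (t : R) : 0 < 1 + t * t * b2.
  by rewrite ltr_pwDl// mulr_ge0// sqr_ge0.
pose C (t : R) : endo_at z := (Num.sqrt (1 + t * t * b2))^-1 *: ((tJ (t := z) : endo_at z) + t *: B).
have hQ t : Q (C t) by exact: (QZ _ aJ0).
have h1 t : qdot Q (C t) (C t) = 1.
  rewrite /C (qdotZ Hq _ aJ0 (QC t) (hQ t)) (qdotC Hq aJ0 (hQ t) (QC t)).
  rewrite (qdotZ Hq _ aJ0 (QC t) (QC t)) CC mulrA -invfM -expr2 sqr_sqrtr ?mulVf ?gt_eqF//.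
  exact: ltW.
have curveE (t : R) : mk_twistor z ((Num.sqrt (qdot Q ((tJ (t := z) : endo_at z) + t *: B)
       ((tJ (t := z) : endo_at z) + t *: B)))^-1 *: ((tJ (t := z) : endo_at z) + t *: B)) =
    Twistor (hQ t) (h1 t).
  by rewrite CC; exact: mk_twistorE.
pose curve t : Z := Twistor (hQ t) (h1 t).
have deriv Ch : chart_at AZ z Ch -> is_derive (0 : R^o) (1 : R^o) (fun t => Ch (curve t)) (w Ch).
  move=> [AC Cz]; have [c [W [F [Ac aF CE]]]] := AZ_chart AC; subst Ch.
  have [cz Wz a0] := Cz; have pc : chart_at A (tpr z) c by [].
  have aJ := frame_basis aF Wz.
  apply: is_derive_rV => i; case: (split_ordP i) => j ->.
    rewrite (tangent_lshift QS aF Wz a0 pc) wx tangent_ev0.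
    rewrite (_ : (fun t => _) = cst (c (tpr z) 0 j)); first exact: is_derive_cst.
    by apply/funext => t; exact: twistor_chart_lshift.
  pose b i := qdot Q (F i (tpr z)) B.
  have wb l : dird w (tw_coef F l) = b l.
    rewrite (vpart_dird w l aF Wz) wx wB big1 ?subr0// => l' _.
    have := conn_form_lin QS aF 1 (0 : tangent A (tpr z)) 0 l l' Wz.
    rewrite scale1r addr0 mul1r => h; have -> : om F l l' (0 : tangent A (tpr z)) = 0.
      by move: h; abstract_terms @conn_form => r; lra.
    by rewrite mul0r.
  rewrite (tangent_rshift QS aF Wz a0 pc) !wb.
  rewrite (_ : (fun t => _) = fun t : R^o => (tw_coef F (lift ord0 j) z + t * b (lift ord0 j)) /
     (Num.sqrt (1 + t * t * b2) + tw_coef F ord0 z + t * b ord0)).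
    exact: (stereo_curve_derive _ _ _ _ (stereo_den a0)).
  apply/funext => t; rewrite twistor_chart_rshift.
  have e l : tw_coef F l (curve t) = (Num.sqrt (1 + t * t * b2))^-1 * (tw_coef F l z + t * b l).
    have QF := basis_Q l aJ; have QJ := twistor_Q z; have QtB : Q (t *: B) by exact: (QZ _ aJ0).
    rewrite /tw_coef /= /C (qdotZ Hq _ aJ (QC t) QF) (qdotD Hq aJ QJ QtB QF).
    by rewrite (qdotZ Hq _ aJ QB QF).
  rewrite !e; have n0 : Num.sqrt (1 + t * t * b2) != 0 by rewrite gt_eqF// sqrtr_gt0.
  move: n0; generalize (Num.sqrt (1 + t * t * b2)) => r r0.
  have -> : 1 + r^-1 * (tw_coef F ord0 z + t * b ord0) =
            r^-1 * (r + tw_coef F ord0 z + t * b ord0).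
    by rewrite -addrA [in RHS]mulrDr mulVf.
  rewrite invfM invrK mulrACA mulVf// mul1r//.
have der1 Ch (y : 'rV[R]_(m + 2)) : chart_at AZ z Ch ->
    is_derive (0 : R^o) (1 : R^o) (fun t => Ch (curve t)) y -> y = w Ch.
  move=> zC hy; rewrite -(@derive_val _ _ _ _ _ _ _ hy).
  by apply: derive_val; exact: deriv.
pose cv (t : R) := mk_twistor z ((Num.sqrt (qdot Q ((tJ (t := z) : endo_at z) + t *: B)
       ((tJ (t := z) : endo_at z) + t *: B)))^-1 *: ((tJ (t := z) : endo_at z) + t *: B)).
have cvE : curve = cv by apply/funext => t; exact: esym (curveE t).
rewrite cvE in deriv der1.
apply: the_eq => [Ch zC|y Hy]; first exact: (deriv Ch zC).
have [Ch zC] := atlas_cover AZs z.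
exact: (tangent_eqP zC (der1 Ch _ zC (Hy Ch zC))).
Qed.

Lemma mk_twistor_spec z0 p (B : tangent A p -> tangent A p) : Q B -> qdot Q B B = 1 ->
  tpr (mk_twistor z0 B) = p /\ forall F i, tw_coef F i (mk_twistor z0 B) = qdot Q (F i p) B.
Proof. by move=> hQ h1; rewrite (mk_twistorE z0 hQ h1). Qed.

Lemma mk_twistor_id z : mk_twistor z (tJ (t := z)) = z.
Proof.
rewrite (mk_twistorE z (twistor_Q z) (twistor_unit z)).
by case: z => p B hQ h1; congr Twistor; exact: Prop_irrelevance.
Qed.

Section UnitSection.
Variables (z : Z) (x : tangent A (tpr z)) (B : endo).
Arguments B : clear implicits.
Hypotheses (SB : Qsec Q B (tpr z)) (Bz : B (tpr z) = tJ (t := z)).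
Hypothesis uB : near_pt A (tpr z) (fun q => qdot Q (B q) (B q) = 1).
Let G q := mk_twistor z (B q).

Let Gz : G (tpr z) = z.
Proof. by rewrite /G Bz mk_twistor_id. Qed.

Let nG : near_pt A (tpr z) (fun q => tpr (G q) = q /\
  forall F i, tw_coef F i (G q) = qdot Q (F i q) (B q)).
Proof.
have [_ nQ] := SB.
by apply: near_ptS2 nQ uB _ => q QB uq; exact: mk_twistor_spec.
Qed.

Let smooth_unit_section : smooth_map A AZ G (tpr z) z.
Proof.
have [W [F [Wz aF Fz]]] := adapted_frame QS z.
have [c pc] := atlas_cover As (tpr z).
have zC := adapted_chart_at QS pc aF Wz Fz.
have sb i : smooth_fun A (fun q => qdot Q (F i q) (B q)) (tpr z).
  by apply: (smooth_qdot QS) => //; exact: (frame_Qsec QS _ aF Wz).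
have b0 : qdot Q (F ord0 (tpr z)) (B (tpr z)) != -1.
  by rewrite Bz; exact: (adapted_neq QS aF Wz Fz).
apply: (smooth_map_chart As AZs Gz zC).
  have H : near_pt A (tpr z) (fun q => [/\ cdom c q, W q & qdot Q (F ord0 q) (B q) != -1]).
    apply: near_ptS3 (near_pt_chart As pc) (near_frame QS aF Wz)
      (smooth_near_neq As (sb ord0) b0) _ => q [Ac cq] Wq bq //.
  apply: near_ptS2 nG H _ => q [tq aq] [cq Wq bq].
  by split; rewrite ?tq//; have := aq F ord0; rewrite /tw_coef => ->.
have sd : smooth_fun A (fun q => 1 + qdot Q (F ord0 q) (B q)) (tpr z).
  by apply: smooth_funD => //; exact: smooth_fun_cst.
have d0 : 1 + qdot Q (F ord0 (tpr z)) (B (tpr z)) != 0.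
  by rewrite addrC -(opprK 1) subr_eq0.
move=> i; case: (split_ordP i) => j ->.
  apply: (smooth_fun_eq _ (smooth_fun_coord As j pc)).
  by apply: near_ptS nG _ => q [tq _]; rewrite twistor_chart_lshift tq.
apply: (smooth_fun_eq _ (smooth_funM (sb (lift ord0 j)) (smooth_funV As sd d0))).
by apply: near_ptS nG _ => q [_ aq]; rewrite twistor_chart_rshift !aq.
Qed.

Lemma unit_section_push_exists : exists w : TZ z, is_push (fun q => mk_twistor z (B q)) x w.
Proof. exact: (push_exists As AZs Gz smooth_unit_section). Qed.

(** The pullback of the tautological section by the map q |-> B_q is B itself, so its derivative
    along the image of [x] is D_x B. *)
Lemma unit_section_push (w : TZ z) : is_push (fun q => mk_twistor z (B q)) x w ->
  pi_push w = x /\ vp w = endo_conn D x B.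
Proof.
move=> /(is_pushP As AZs Gz smooth_unit_section) H.
have wx : pi_push w = x.
  apply: (pi_push_eq QS) => f sf; rewrite H; last exact: (smooth_fun_tpr QS sf).
  by apply: (dird_eq As x) => //; apply: near_ptS nG _ => q [->].
split => //.
have [W [F [Wz aF]]] := qs_frame QS (tpr z).
have aJ := frame_basis aF Wz; have Hq := tangent_nonzero QS (tpr z).
have Qw : Q (vp w) by have [] := vpart_Theta QS w.
have QE : Q (endo_conn D x B) by exact: (endo_conn_Q QS).
rewrite (Q_expand Hq aJ Qw) [RHS](Q_expand Hq aJ QE); congr lincomb; apply/funext => i.
have SF := frame_Qsec QS i aF Wz.
rewrite (vpart_comp QS w i aF Wz) wx H; last exact: (smooth_tw_coef QS i aF Wz).
have -> : dird x (fun q => tw_coef F i (G q)) = dird x (fun q => qdot Q (F i q) (B q)).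
  apply: esym; apply: (dird_eq As x); last exact: (smooth_qdot QS SF SB).
  by apply: near_ptS nG _ => q [_ ->].
rewrite (qdot_metric QS x SF SB) (endo_conn_frame QS aF x i Wz).
rewrite (qdot_dot Hq aJ (lincomb_Q _ aJ) (Qsec_at QS SB)) /dot3 !sum3 !(qdot_basis Hq _ _ aJ) Bz.
rewrite -!/(tw_coef F _ z).
rewrite (conn_form_anti QS aF x i ord0 Wz) (conn_form_anti QS aF x i 1 Wz).
rewrite (conn_form_anti QS aF x i ord_max Wz).
by abstract_terms @conn_form; abstract_terms @tw_coef; abstract_terms @qdot; move=> *; ring.
Qed.

End UnitSection.

(* A section of the sphere bundle with prescribed 1-jet, written through the
   stereographic parametrization so that it stays of unit norm. *)
Lemma parallel_section z (x : tangent A (tpr z)) : exists B : endo,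
  [/\ Qsec Q B (tpr z), B (tpr z) = tJ (t := z),
     near_pt A (tpr z) (fun q => qdot Q (B q) (B q) = 1) & endo_conn D x B = 0].
Proof.
have [W [F [Wz aF Fz]]] := adapted_frame QS z.
have aJ := frame_basis aF Wz; have Hq := tangent_nonzero QS (tpr z).
have o0 : om F ord0 ord0 x = 0.
  by have := conn_form_anti QS aF x ord0 ord0 Wz; abstract_terms @conn_form; move=> r; lra.
have ox0 : x = 0 -> forall i, - om F i ord0 x = 0.
  move=> -> i; have := conn_form_lin QS aF 1 (0 : tangent A (tpr z)) 0 i ord0 Wz.
  by rewrite scale1r addr0 mul1r; abstract_terms @conn_form => r; lra.
have o0' : - om F ord0 ord0 x = 0 by rewrite o0 oppr0.
have [b [sb bb bp db]] := sphere_section As (d := fun i => - om F i ord0 x) o0' ox0.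
exists (fun q => lincomb (fun i => F i q) (b^~ q)); split.
- exact: (Qsec_lincomb QS aF Wz sb).
- rewrite -Fz -[RHS](lincomb_delta (fun i => F i (tpr z)) ord0); congr lincomb.
  by apply/funext => i; rewrite bp.
- apply: near_ptS (near_frame QS aF Wz) _ => q Wq.
  by rewrite (qdot_lincomb (tangent_nonzero QS q) _ _ (frame_basis aF Wq)).
rewrite (endo_conn_lincomb QS x aF Wz sb).
rewrite (eq_bigr (fun i => dird x (b i) *: (F i (tpr z) : _ -> _) +
   b i (tpr z) *: (lincomb (fun i => F i (tpr z)) (fun l => om F l i x) : _ -> _))); last first.
  by move=> i _; rewrite (endo_conn_frame QS aF x i Wz).
rewrite (lincomb_conn (fun i => F i (tpr z)) (fun i => dird x (b i)) (b^~ (tpr z)) (fun l i => om F l i x)).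
apply/funext => y; rewrite lincombE !sum3 !db !bp /=.
by rewrite !mulr0 !addr0 !mulr1 !addNr !scale0r !addr0.
Qed.

(** A parallel section shows that a lift exists. For whichever section [B] the lift comes from, its
    invariants are [x] and D_x B = 0, so the choice of [B] is immaterial. *)
Lemma horP z (x : tangent A (tpr z)) : pi_push (hor D x) = x /\ vp (hor D x) = 0.
Proof.
pose P (w : TZ z) := exists B : endo,
    [/\ smooth_endo B (tpr z),
        near_pt A (tpr z) (fun q => Q (B q) /\ qdot Q (B q) (B q) = 1),
        B (tpr z) = tJ (t := z), endo_conn D x B = 0
      & is_push (fun q => mk_twistor z (B q)) x w].
have [B [sB nB Bz DB pw]] : P (hor D x).
  apply: (@the_spec _ 0 [set w | P w]).
  have [B [SB Bz uB DB]] := parallel_section x.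
  have [w pw] := unit_section_push_exists x SB Bz uB.
  have [sB nQ] := SB.
  by exists w, B; split => //; apply: near_ptS2 nQ uB _ => q.
have SB : Qsec Q B (tpr z) by split => //; apply: near_ptS nB _ => q [].
have uB : near_pt A (tpr z) (fun q => qdot Q (B q) (B q) = 1) by apply: near_ptS nB _ => q [].
have [hx hB] := unit_section_push SB Bz uB pw.
by rewrite DB in hB.
Qed.

End VertHor.

Section TwistorJ.
Variables (R : realType) (M : topologicalType) (m : nat) (A : set (chart R M m)).
Variable Q : forall p : M, set (tangent A p -> tangent A p).
Variable D : affine_connection A.
Hypothesis QS : quaternionic_setting Q D.
Let As := qs_atlas QS.
Let AZs := twistor_smooth_atlas QS.
Implicit Types (p q : M) (z : twistor Q).
Local Notation endo := (forall q, tangent A q -> tangent A q).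
Local Notation Z := (twistor Q).
Local Notation AZ := (@twistor_atlas R M m A Q).
Local Notation TZ := (tangent AZ).
Local Notation vp := (vpart D).
Local Notation om := (conn_form Q D).

Lemma cross_orth (a b : 'I_3 -> R) : dot3 a (cross a b) = 0.
Proof. rewrite /dot3 sum3 /cross /=; ring. Qed.

Lemma Theta_orth z (B : endo_at z) : Theta B -> qdot Q (tJ (t := z)) B = 0.
Proof.
move=> [QB BJ]; have [W [F [Wz aF]]] := qs_frame QS (tpr z).
by rewrite (qdotC (tangent_nonzero QS _) (frame_basis aF Wz) (twistor_Q z) QB).
Qed.

Lemma Theta_J_comp W F z (B : endo_at z) i : admissible_frame Q W F -> W (tpr z) -> Theta B ->
  qdot Q (F i (tpr z)) (tJ (t := z) \o B) =
  cross (fun j => tw_coef F j z) (fun j => qdot Q (F j (tpr z)) B) i.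
Proof.
move=> aF Wz tB; have aJ := frame_basis aF Wz; have Hq := tangent_nonzero QS (tpr z).
rewrite (Q_comp Hq aJ (twistor_Q z) (proj1 tB) (Theta_orth tB)).
exact: (qdot_basis Hq).
Qed.

Lemma Theta_J z (B : endo_at z) : Theta B -> Theta (tJ (t := z) \o B : endo_at z).
Proof.
move=> tB; have [W [F [Wz aF]]] := qs_frame QS (tpr z).
have aJ := frame_basis aF Wz; have Hq := tangent_nonzero QS (tpr z).
have E := Q_comp Hq aJ (twistor_Q z) (proj1 tB) (Theta_orth tB).
have QJB : Q (tJ (t := z) \o B) by rewrite E; exact: (lincomb_Q _ aJ).
split => //; rewrite (qdotC Hq aJ QJB (twistor_Q z)) (qdot_dot Hq aJ (twistor_Q z) QJB).
rewrite -[RHS](cross_orth (fun j => tw_coef F j z) (fun j => qdot Q (F j (tpr z)) B)).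
by apply: eq_bigr => i _; rewrite (Theta_J_comp i aF Wz tB).
Qed.

(** Every v equals [vert (vpart v) + hor (pi_push v)], both sides having the same two invariants;
    hence the defining relation of [twistor_J] can be satisfied, and any solution has the stated
    invariants. *)
Lemma twistor_JP z (v : TZ z) : pi_push (twistor_J Q D z v) = tJ (t := z) (pi_push v) /\
  vp (twistor_J Q D z v) = tJ (t := z) \o vp v.
Proof.
have push (B : endo_at z) x : Theta B ->
    pi_push (vert B + hor D x) = x /\ vp (vert B + hor D x) = B.
  move=> tB; have [v1 v2] := vertP QS tB; have [h1 h2] := horP QS x.
  have := pi_push_lin QS 1 (vert B) (hor D x); have := vpart_lin QS 1 (vert B) (hor D x).
  by rewrite !scale1r v1 v2 h1 h2 addr0 add0r.
pose P (w : TZ z) := exists (B : endo_at z) x,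
    [/\ Theta B, v = vert B + hor D x
      & w = vert (tJ (t := z) \o B : endo_at z) + hor D (tJ (t := z) x)].
have [B [x [tB vE wE]]] : P (twistor_J Q D z v).
  apply: (@the_spec _ 0 [set w | P w]).
  have tv := vpart_Theta QS v; have [p1 p2] := push _ (pi_push v) tv.
  exists (vert (tJ (t := z) \o vp v : endo_at z) + hor D (tJ (t := z) (pi_push v))).
  exists (vp v), (pi_push v); split => //.
  by apply: (twistor_tangent_ext QS); rewrite ?p1 ?p2.
have [p1 p2] := push _ x tB; have [p3 p4] := push _ (tJ (t := z) x) (Theta_J tB).
by rewrite wE vE p1 p2 p3 p4.
Qed.

Section Smooth.
Variables (W : set M) (F : 'I_3 -> endo) (c : chart R M m) (z : Z).
Arguments F : clear implicits.
Hypotheses (aF : admissible_frame Q W F) (Wz : W (tpr z)) (pc : chart_at A (tpr z) c).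

Lemma conn_form_expand p (x : tangent A p) i j : W p -> chart_at A p c ->
  om F i j x = \sum_l x c 0 l * om F i j (coord_field As c l p).
Proof.
move=> Wp pc'; rewrite {1}(tangent_sum As x pc') (conn_form_sum QS aF _ _ _ _ Wp).
apply: eq_bigr => l _.
have := conn_form_lin QS aF 1 (0 : tangent A p) 0 i j Wp.
have := conn_form_lin QS aF (x c 0 l) (coord_field As c l p) 0 i j Wp.
rewrite scale1r !addr0 mul1r => ->; move: (conn_form Q D F i j 0) => r h.
have -> : r = 0 by lra.
by rewrite addr0.
Qed.

Let near_frame_chart : near_pt AZ z (fun z' => W (tpr z') /\ chart_at A (tpr z') c).
Proof.
apply: near_ptS2 (near_pt_tpr QS (near_frame QS aF Wz)) (near_pt_tpr QS (near_pt_chart As pc)) _.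
by move=> z' ? ?.
Qed.

(** The vector varies with the point of Z, not just with its projection, so smoothness on M does not
    apply directly; expanding it along coordinate fields separates its components from functions on
    the base. *)
Lemma smooth_conn_form_push (x : forall z', tangent A (tpr z')) i j :
  (forall l, smooth_fun AZ (fun z' : Z => x z' c 0 l) z) ->
  smooth_fun AZ (fun z' => om F i j (x z')) z.
Proof.
move=> sx.
have so l : smooth_fun AZ (fun z' => om F i j (coord_field As c l (tpr z'))) z.
  apply: (smooth_fun_tpr QS (f := fun q => om F i j (coord_field As c l q))).
  by apply: (conn_form_smooth QS aF _ _ Wz); exact: smooth_coord_field.
apply: (smooth_fun_eq _ (smooth_fun_dot sx so)).
by apply: near_ptS near_frame_chart _ => z' [Wz' pc']; rewrite (conn_form_expand _ i j Wz' pc').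
Qed.

Lemma smooth_push_coord (U : vfield AZ) l : smooth_vfield AZ U z ->
  smooth_fun AZ (fun z' => (pi_push (U z')) c 0 l) z.
Proof.
move=> sU; have sc := smooth_fun_tpr QS (smooth_fun_coord As l pc).
apply: (smooth_fun_eq _ (smooth_dird AZs sU sc)).
by apply: near_ptS near_frame_chart _ => z' [Wz' pc']; rewrite (pi_push_coord QS _ _ pc').
Qed.

Lemma smooth_vpart_comp (U : vfield AZ) i : smooth_vfield AZ U z ->
  smooth_fun AZ (fun z' => qdot Q (F i (tpr z')) (vp (U z'))) z.
Proof.
move=> sU; have sa j := smooth_tw_coef QS j aF Wz.
have so j : smooth_fun AZ (fun z' => om F i j (pi_push (U z'))) z.
  by apply: smooth_conn_form_push => l; exact: smooth_push_coord.
apply: (smooth_fun_eq _ (smooth_funD (smooth_dird AZs sU (sa i)) (smooth_fun_dot so sa))).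
by apply: near_ptS near_frame_chart _ => z' [Wz' pc']; rewrite (vpart_comp QS _ i aF Wz').
Qed.

End Smooth.

(** The Chern condition evaluates the curvature on the rotated fields, and the curvature formula is
    proved for smooth ones. Smoothness is checked on both invariants: J is a combination of the
    frame with smooth coefficients, and it acts on the vertical part by a cross product. *)
Lemma smooth_twistor_J z (U : vfield AZ) : smooth_vfield AZ U z ->
  smooth_vfield AZ (fun z' => twistor_J Q D z' (U z')) z.
Proof.
move=> sU; have [W [F [Wz aF Fz]]] := adapted_frame QS z.
have [c pc] := atlas_cover As (tpr z).
have a0 := adapted_neq QS aF Wz Fz.
have nWc : near_pt AZ z (fun z' => W (tpr z') /\ chart_at A (tpr z') c).
  by apply: near_ptS2 (near_pt_tpr QS (near_frame QS aF Wz)) (near_pt_tpr QS (near_pt_chart As pc)) _.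
have sa j := smooth_tw_coef QS j aF Wz.
have sP i : smooth_fun AZ (fun z' => (pi_push (twistor_J Q D z' (U z'))) c 0 i) z.
  have sFE k l : smooth_fun AZ (fun z' => (F k (tpr z') (coord_field As c l (tpr z'))) c 0 i) z.
    apply: (smooth_fun_tpr QS (f := fun q => (F k q (coord_field As c l q)) c 0 i)).
    have [sF _] := frame_Qsec QS k aF Wz.
    have /(smooth_vfieldP As _ pc) sFE := sF _ (smooth_coord_field As l pc).
    exact: sFE.
  have s1 := fun k => smooth_fun_dot (fun l => smooth_push_coord aF Wz pc l sU) (sFE k).
  apply: (smooth_fun_eq _ (smooth_fun_dot sa s1)).
  apply: near_ptS nWc _ => z' [Wz' pc'].
  rewrite (proj1 (twistor_JP (U z'))) (tw_expand QS aF Wz') lincombE sum3.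
  have lF k : linear (F k (tpr z')) by exact: (Q_linear QS (basis_Q k (frame_basis aF Wz'))).
  have e k : F k (tpr z') (pi_push (U z')) = \sum_l (pi_push (U z')) c 0 l *: F k (tpr z')
    (coord_field As c l (tpr z')).
    rewrite {1}(tangent_sum As (pi_push (U z')) pc') (linear_f_sum _ _ (lF k)).
    by apply: eq_bigr => l _; rewrite (linear_fZ (lF k)).
  have e' k : (F k (tpr z') (pi_push (U z'))) c 0 i = \sum_l (pi_push (U z')) c 0 l * (F k (tpr z')
    (coord_field As c l (tpr z'))) c 0 i.
    rewrite e coords_sum; apply: eq_bigr => l _.
    by rewrite tangent_evZ.
  by rewrite !tangent_evD !tangent_evZ !e'.
apply: (smooth_vfield_twistor QS aF Wz a0 pc sP) => i.
have so j : smooth_fun AZ (fun z' => om F i j (pi_push (twistor_J Q D z' (U z')))) z.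
  exact: (@smooth_conn_form_push W F c z aF Wz pc (fun z' => pi_push (twistor_J Q D z' (U z'))) i j sP).
have sv (j : 'I_3) := smooth_vpart_comp aF Wz pc j sU.
pose vj j z' := qdot Q (F j (tpr z')) (vp (U z')).
have sx : smooth_fun AZ (fun z' => cross (fun j => tw_coef F j z') (fun j => vj j z') i) z.
  by move: i {so}; apply: ord3P; rewrite /cross /=; apply: smooth_funB; apply: smooth_funM; rewrite /vj; auto.
apply: (smooth_fun_eq _ (smooth_funB sx (smooth_fun_dot so sa))).
apply: near_ptS nWc _ => z' [Wz' pc'].
rewrite (vpart_dird QS _ i aF Wz') (proj2 (twistor_JP (U z'))).
by rewrite (Theta_J_comp i aF Wz' (vpart_Theta QS (U z'))).
Qed.

End TwistorJ.

(** * The connection on Theta and its curvature *)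

Section ThetaConnection.
Variables (R : realType) (M : topologicalType) (m : nat) (A : set (chart R M m)).
Variable Q : forall p : M, set (tangent A p -> tangent A p).
Variable D : affine_connection A.
Hypothesis QS : quaternionic_setting Q D.
Let As := qs_atlas QS.
Let AZs := twistor_smooth_atlas QS.
Implicit Types (p q : M) (z : twistor Q).
Local Notation endo := (forall q, tangent A q -> tangent A q).
Local Notation Z := (twistor Q).
Local Notation AZ := (@twistor_atlas R M m A Q).
Local Notation TZ := (tangent AZ).
Local Notation psec := (pullback_section Q).
Local Notation vp := (vpart D).
Local Notation om := (conn_form Q D).
Local Notation N := (Theta_conn Q D).
Implicit Types (s t : psec).

Lemma conn_form_diag W F p (v : tangent A p) i : admissible_frame Q W F -> W p -> om F i i v = 0.
Proof.
move=> aF Wp; have := conn_form_anti QS aF v i i Wp; move: (conn_form Q D F i i v) => r; lra.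
Qed.

Section OneFrame.
Variables (W : set M) (F : 'I_3 -> endo).
Arguments F : clear implicits.
Hypothesis aF : admissible_frame Q W F.
Local Notation "s # i" := (sec_coef F i s) (at level 30).
Local Notation d v s := (pconn_comp D F v s).

Lemma Q_ext z (B C : endo_at z) : W (tpr z) -> Q B -> Q C ->
  (forall i, qdot Q (F i (tpr z)) B = qdot Q (F i (tpr z)) C) -> B = C.
Proof.
move=> Wz QB QC BC; have aJ := frame_basis aF Wz; have Hq := tangent_nonzero QS (tpr z).
rewrite (Q_expand Hq aJ QB) [RHS](Q_expand Hq aJ QC); congr lincomb; apply/funext => i.
exact: BC.
Qed.

(** Changing the frame multiplies the coefficients by the smooth matrix of products of the two
    frames, so one frame is enough. *)
Lemma smooth_pullbackQ_frame s z : W (tpr z) -> near_pt AZ z (fun z' => Q (s z')) ->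
  (forall i, smooth_fun AZ (s # i) z) -> smooth_pullbackQ s z.
Proof.
move=> Wz nQ sf; split => // W' F' W'z aF' i.
have sg j : smooth_fun AZ (fun z' => qdot Q (F j (tpr z')) (F' i (tpr z'))) z.
  apply: (smooth_fun_tpr QS (f := fun q => qdot Q (F j q) (F' i q))).
  by apply: (smooth_qdot QS); [exact: (frame_Qsec QS _ aF Wz)|exact: (frame_Qsec QS _ aF' W'z)].
apply: (smooth_fun_eq _ (smooth_fun_dot sg sf)).
apply: near_ptS3 nQ (near_pt_tpr QS (near_frame QS aF Wz)) (near_pt_tpr QS (near_frame QS aF' W'z)) _.
move=> z' Qs Wz' W'z'; apply: esym.
exact: (qdot_dot (tangent_nonzero QS _) (frame_basis aF Wz') (basis_Q i (frame_basis aF' W'z')) Qs).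
Qed.

Variable z : Z.
Hypothesis Wz : W (tpr z).
Let aJ := frame_basis aF Wz.
Let Hq := tangent_nonzero QS (tpr z).
Let nW : near_pt AZ z (fun z' => W (tpr z')) := near_pt_tpr QS (near_frame QS aF Wz).

Lemma pconn_metric (v : TZ z) s t : smooth_pullbackQ s z -> smooth_pullbackQ t z ->
  dird v (fun z' => \sum_i (s # i) z' * (t # i) z') =
  \sum_i (d v s i * (t # i) z + (s # i) z * d v t i).
Proof.
move=> ss st; have sf i := smooth_comp i aF Wz ss; have sg i := smooth_comp i aF Wz st.
rewrite (dird_dot AZs v sf sg) /pconn_comp !sum3 !(conn_form_diag _ _ aF Wz).
rewrite (conn_form_anti QS aF (pi_push v) 1 ord0 Wz) (conn_form_anti QS aF (pi_push v) ord_max ord0 Wz).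
rewrite (conn_form_anti QS aF (pi_push v) ord_max 1 Wz).
by abstract_terms @dird; abstract_terms @conn_form; abstract_terms @sec_coef; ring.
Qed.

Lemma Theta_comp (B : endo_at z) : Theta B -> \sum_i qdot Q (F i (tpr z)) B * tw_coef F i z = 0.
Proof.
move=> [QB BJ]; rewrite -[RHS]BJ; apply: esym; exact: (qdot_dot Hq aJ QB (twistor_Q z)).
Qed.

(** Differentiating <s, tau> = 0. This tau-component of D_v s is what the projection removes, and it
    produces the second fundamental form in the curvature. *)
Lemma pconn_orth (v : TZ z) s : smooth_Theta s z ->
  \sum_j d v s j * tw_coef F j z = - \sum_j (s # j) z * qdot Q (F j (tpr z)) (vp v).
Proof.
move=> [nT ss]; have st := smooth_tauto QS z.
have := pconn_metric v ss st.
have -> : dird v (fun z' => \sum_i (s # i) z' * (tauto (Q := Q) # i) z') = 0.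
  apply: etrans (dird_cst AZs v 0); apply: (dird_eq AZs v).
    apply: near_ptS2 nT nW _ => z' [QB BJ] Wz'.
    apply: etrans BJ; apply: esym.
    exact: (qdot_dot (tangent_nonzero QS _) (frame_basis aF Wz') QB (twistor_Q z')).
  by apply: smooth_fun_dot => i; [exact: (smooth_comp i aF Wz ss)|exact: (smooth_comp i aF Wz st)].
rewrite big_split /= => /esym/eqP; rewrite addr_eq0 => /eqP h.
rewrite -[LHS]/(\sum_i d v s i * (tauto (Q := Q) # i) z) h; congr (- _).
by apply: eq_bigr => i _; rewrite (pullback_conn_comp QS v st i aF Wz).
Qed.

Section At.
Variables (v : TZ z) (s : psec).
Arguments s : clear implicits.
Hypothesis ss : smooth_pullbackQ s z.

Lemma Theta_conn_comp i : qdot Q (F i (tpr z)) (N z v s) =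
  d v s i - (\sum_j d v s j * tw_coef F j z) * tw_coef F i z.
Proof.
have QD := pullback_conn_Q QS v ss; have QJ := twistor_Q z.
have E : qdot Q (pullback_conn D v s) (tJ (t := z)) = \sum_j d v s j * tw_coef F j z.
  rewrite (qdot_dot Hq aJ QD QJ); apply: eq_bigr => j _.
  by rewrite (pullback_conn_comp QS v ss j aF Wz).
rewrite /Theta_conn /Pi E -scaleNr addrC.
rewrite (qdot_lin Hq _ aJ QJ QD (basis_Q i aJ)) (pullback_conn_comp QS v ss i aF Wz).
by rewrite -/(tw_coef F i z) mulNr addrC.
Qed.

Lemma Theta_conn_Theta : Theta (N z v s).
Proof.
have QD := pullback_conn_Q QS v ss; have QJ := twistor_Q z.
have QN : Q (N z v s).
  by rewrite /Theta_conn /Pi -scaleNr addrC; exact: (Q_lincomb2 _ aJ).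
split => //; rewrite (qdot_dot Hq aJ QN QJ) /dot3 !sum3 !Theta_conn_comp !sum3.
have := tw_coef_unit QS aF Wz; rewrite /dot3 sum3 -!/(tw_coef F _ z).
move: (tw_coef F ord0 z) (tw_coef F 1 z) (tw_coef F ord_max z) (d v s ord0) (d v s 1) (d v s ord_max).
move=> a0 a1 a2 d0 d1 d2 h.
transitivity ((d0 * a0 + d1 * a1 + d2 * a2) * (1 - (a0 * a0 + a1 * a1 + a2 * a2))); first by ring.
by rewrite h subrr mulr0.
Qed.

End At.

Lemma pconn_lin (v w : TZ z) (a : R) s i : smooth_pullbackQ s z ->
  d (a *: v + w) s i = a * d v s i + d w s i.
Proof.
move=> ss; rewrite /pconn_comp !sum3 (dird_lin AZs a v w (smooth_comp i aF Wz ss)) (pi_push_lin QS).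
rewrite !(conn_form_lin QS aF a (pi_push v) (pi_push w) _ _ Wz).
by abstract_terms @dird; abstract_terms @conn_form; abstract_terms @sec_coef; ring.
Qed.

Lemma comp_lin (f : Z -> R) s t : smooth_pullbackQ s z -> smooth_pullbackQ t z ->
  near_pt AZ z (fun z' => Q (f z' *: s z' + t z') /\
    forall i, ((fun y => f y *: s y + t y) # i) z' = f z' * (s # i) z' + (t # i) z').
Proof.
move=> [nQs _] [nQt _]; apply: near_ptS3 nQs nQt nW _ => z' QB QC Wz'.
have aJ' := frame_basis aF Wz'; split; first exact: (Q_lincomb2 _ aJ').
by move=> i; exact: (qdot_lin (tangent_nonzero QS _) _ aJ' QB QC (basis_Q i aJ')).
Qed.

Lemma pconn_leibniz (v : TZ z) (f : Z -> R) s t i : smooth_fun AZ f z ->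
  smooth_pullbackQ s z -> smooth_pullbackQ t z ->
  d v (fun y => f y *: s y + t y) i = dird v f * (s # i) z + f z * d v s i + d v t i.
Proof.
move=> sf ss st; have nc := comp_lin f ss st.
have [_ cz] := near_pt_self AZs nc.
have sg j := smooth_comp j aF Wz ss; have sh j := smooth_comp j aF Wz st.
have sm : smooth_fun AZ (fun y => f y * (s # i) y + (t # i) y) z by apply: smooth_funD => //; exact: smooth_funM.
have E : dird v ((fun y => f y *: s y + t y) # i) = dird v f * (s # i) z + f z * dird v (s # i) + dird v (t # i).
  have -> : dird v ((fun y => f y *: s y + t y) # i) = dird v (fun y => f y * (s # i) y + (t # i) y).
    by apply: esym; apply: (dird_eq AZs v) => //; apply: near_ptS nc _ => z' [_ ->].
  by rewrite (dirdD AZs v (smooth_funM sf (sg i)) (sh i)) (dirdM AZs v sf (sg i)).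
rewrite /pconn_comp E !sum3 !cz.
by abstract_terms @dird; abstract_terms @conn_form; abstract_terms @sec_coef; move: (f z) => r; ring.
Qed.

Lemma pconn_eq (v : TZ z) s t i : smooth_pullbackQ s z -> near_pt AZ z (fun y => s y = t y) ->
  d v s i = d v t i.
Proof.
move=> ss nst; have e j : (s # j) z = (t # j) z by rewrite /sec_coef (near_pt_self AZs nst).
have E : dird v (s # i) = dird v (t # i).
  apply: (dird_eq AZs v); last exact: (smooth_comp i aF Wz ss).
  by apply: near_ptS nst _ => y; rewrite /sec_coef => ->.
by rewrite /pconn_comp E !sum3 !e.
Qed.

Lemma smooth_pconn (U : vfield AZ) s i : smooth_vfield AZ U z -> smooth_pullbackQ s z ->
  smooth_fun AZ (fun z' => d (U z') s i) z.
Proof.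
move=> sU ss; have [c pc] := atlas_cover As (tpr z).
apply: smooth_funD; first exact: (smooth_dird AZs sU (smooth_comp i aF Wz ss)).
apply: smooth_fun_dot => j; last exact: (smooth_comp j aF Wz ss).
apply: (@smooth_conn_form_push _ _ _ _ _ _ QS W F c z aF Wz pc (fun z' => pi_push (U z'))) => l.
exact: (smooth_push_coord QS aF Wz pc l sU).
Qed.

End OneFrame.

End ThetaConnection.

Section HermitianConnection.
Variables (R : realType) (M : topologicalType) (m : nat) (A : set (chart R M m)).
Variable Q : forall p : M, set (tangent A p -> tangent A p).
Variable D : affine_connection A.
Hypothesis QS : quaternionic_setting Q D.
Let AZs := twistor_smooth_atlas QS.
Implicit Types (p q : M) (z : twistor Q).
Local Notation Z := (twistor Q).
Local Notation AZ := (@twistor_atlas R M m A Q).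
Local Notation TZ := (tangent AZ).
Local Notation psec := (pullback_section Q).
Local Notation N := (Theta_conn Q D).
Implicit Types (s t : psec).

Lemma Theta_at s z : smooth_Theta s z -> Theta (s z).
Proof. by move=> [nT _]; exact: (near_pt_self AZs nT). Qed.

Lemma Theta_lin z (B C : endo_at z) (a : R) : Theta B -> Theta C -> Theta (a *: B + C).
Proof.
move=> tB tC; have [W [F [Wz aF]]] := qs_frame QS (tpr z).
have aJ := frame_basis aF Wz; have Hq := tangent_nonzero QS (tpr z).
have QJ := twistor_Q z; have QBC := Q_lincomb2 a aJ (proj1 tB) (proj1 tC).
split => //; rewrite (qdotC Hq aJ QBC QJ) (qdot_lin Hq a aJ (proj1 tB) (proj1 tC) QJ).
by rewrite (Theta_orth QS tB) (Theta_orth QS tC) mulr0 addr0.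
Qed.

Lemma smooth_pullbackQ_lin (f : Z -> R) s t z : smooth_fun AZ f z ->
  smooth_pullbackQ s z -> smooth_pullbackQ t z ->
  smooth_pullbackQ (fun y => f y *: s y + t y) z.
Proof.
move=> sf ss st; have [W [F [Wz aF]]] := qs_frame QS (tpr z).
have nc := comp_lin QS aF Wz f ss st.
apply: (smooth_pullbackQ_frame QS aF Wz).
  by apply: near_ptS nc _ => y [].
move=> i.
have s1 := smooth_funD (smooth_funM sf (smooth_comp i aF Wz ss)) (smooth_comp i aF Wz st).
by apply: (smooth_fun_eq _ s1); apply: near_ptS nc _ => y [_ ->].
Qed.

Lemma smooth_pullbackQ0 z : smooth_pullbackQ (fun z' => 0 : endo_at z') z.
Proof.
have [W [F [Wz aF]]] := qs_frame QS (tpr z).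
have n0 : near_pt AZ z (fun z' => Q (0 : endo_at z') /\ forall i, sec_coef F i (fun y => 0 : endo_at y) z' = 0).
  apply: near_ptS (near_pt_tpr QS (near_frame QS aF Wz)) _ => z' Wz'.
  have aJ := frame_basis aF Wz'; have Q0' := Q0 aJ; split => // i.
  have := qdotZ (tangent_nonzero QS _) 0 aJ Q0' (basis_Q i aJ).
  by rewrite scale0r mul0r.
apply: (smooth_pullbackQ_frame QS aF Wz); first by apply: near_ptS n0 _ => y [].
move=> i; apply: (smooth_fun_eq _ (smooth_fun_cst 0)).
by apply: near_ptS n0 _ => y [_ ->].
Qed.

(** Additivity (f = 1) and the Leibniz rule (t = 0) in one formula. The term with the derivative of
    [f] survives the projection unchanged because [s] is orthogonal to tau. *)
Lemma Theta_conn_lin z (v : TZ z) (f : Z -> R) s t : smooth_fun AZ f z ->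
  smooth_Theta s z -> smooth_pullbackQ t z ->
  N z v (fun y => f y *: s y + t y) = dird v f *: s z + (f z *: N z v s + N z v t).
Proof.
move=> sf ts st; have [_ ss] := ts; have [W [F [Wz aF]]] := qs_frame QS (tpr z).
have aJ := frame_basis aF Wz; have Hq := tangent_nonzero QS (tpr z).
have sst := smooth_pullbackQ_lin sf ss st.
have QNs := proj1 (Theta_conn_Theta QS aF Wz v ss).
have QNt := proj1 (Theta_conn_Theta QS aF Wz v st).
have QN := proj1 (Theta_conn_Theta QS aF Wz v sst).
have Qs := pullback_at QS ss.
have Q2 := Q_lincomb2 (f z) aJ QNs QNt; have Q3 := Q_lincomb2 (dird v f) aJ Qs Q2.
apply: (Q_ext QS aF Wz QN Q3) => i.
have QFi := basis_Q i aJ.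
rewrite (qdot_lin Hq _ aJ Qs Q2 QFi) (qdot_lin Hq _ aJ QNs QNt QFi).
rewrite !(Theta_conn_comp QS aF Wz v _ i)// !sum3.
rewrite !(pconn_leibniz QS aF Wz v _ sf ss st).
have := Theta_comp QS aF Wz (Theta_at ts); rewrite sum3 -!/(sec_coef F _ s z).
move: (sec_coef F ord0 s z) (sec_coef F 1 s z) (sec_coef F ord_max s z) (tw_coef F i z) (sec_coef F i s z).
move: (tw_coef F ord0 z) (tw_coef F 1 z) (tw_coef F ord_max z) (dird v f) (f z).
abstract_terms @pconn_comp; move=> a0 a1 a2 df fz f0 f1 f2 ai fi h.
apply/eqP; rewrite -subr_eq0; apply/eqP.
transitivity (- (df * (f0 * a0 + f1 * a1 + f2 * a2) * ai)); first by ring.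
by rewrite h mulr0 mul0r oppr0.
Qed.

Lemma Theta_conn0 z (v : TZ z) : N z v (fun z' => 0 : endo_at z') = 0.
Proof.
have ts : smooth_Theta (fun z' => 0 : endo_at z') z.
  split; last exact: smooth_pullbackQ0.
  apply: near_ptT => z'; have [W [F [Wz aF]]] := qs_frame QS (tpr z').
  have aJ := frame_basis aF Wz; have Hq := tangent_nonzero QS (tpr z').
  have Q0' : Q (0 : endo_at z') := Q0 aJ; split => //.
  rewrite (qdotC Hq aJ Q0' (twistor_Q z')); have := qdotZ Hq 0 aJ Q0' (twistor_Q z').
  by rewrite scale0r mul0r.
have := Theta_conn_lin v (smooth_fun_cst 1) ts (smooth_pullbackQ0 z).
rewrite (_ : (fun y : Z => 1 *: (0 : endo_at y) + 0) = fun y => 0 : endo_at y); last first.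
  by apply/functional_extensionality_dep => y; rewrite scaler0 addr0.
by rewrite (dird_cst AZs) scale0r scale1r add0r => /esym/eqP; rewrite addrC -subr_eq0 addrK => /eqP.
Qed.

Lemma smooth_Theta_conn z (U : vfield AZ) s : smooth_vfield AZ U z -> smooth_pullbackQ s z ->
  near_pt AZ z (fun z' => smooth_pullbackQ s z') -> smooth_Theta (fun z' => N z' (U z') s) z.
Proof.
move=> sU ss ns; have [W [F [Wz aF]]] := qs_frame QS (tpr z).
have nT : near_pt AZ z (fun z' => Theta (N z' (U z') s)).
  apply: near_ptS2 ns (near_pt_tpr QS (near_frame QS aF Wz)) _ => z' ss' Wz'.
  exact: (Theta_conn_Theta QS aF Wz' _ ss').
split => //; apply: (smooth_pullbackQ_frame QS aF Wz).
  by apply: near_ptS nT _ => z' [].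
move=> i; have sd j := smooth_pconn QS aF Wz j sU ss.
have sa j := smooth_tw_coef QS j aF Wz.
apply: (smooth_fun_eq _ (smooth_funB (sd i) (smooth_funM (smooth_fun_dot sd sa) (sa i)))).
apply: near_ptS2 ns (near_pt_tpr QS (near_frame QS aF Wz)) _ => z' ss' Wz'.
by rewrite /sec_coef (Theta_conn_comp QS aF Wz' (U z') ss' i).
Qed.

Lemma smooth_pullbackQ_near s z : smooth_pullbackQ s z -> near_pt AZ z (smooth_pullbackQ s).
Proof.
move=> ss; have [W [F [Wz aF]]] := qs_frame QS (tpr z).
have nf : near_pt AZ z (fun z' => forall i, smooth_fun AZ (sec_coef F i s) z').
  by apply: near_pt_forall => i; exact: (smooth_fun_near AZs (smooth_comp i aF Wz ss)).
apply: near_ptS3 nf (near_pt_near AZs (proj1 ss)) (near_pt_tpr QS (near_frame QS aF Wz)) _.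
by move=> z' sf nQ Wz'; exact: (smooth_pullbackQ_frame QS aF Wz').
Qed.

Lemma Theta_conn_connection : is_connection (E := @endo_at R M m A Q) (@smooth_Theta R M m A Q) N.
Proof.
split.
- move=> z s [nT ss] a v w; have [W [F [Wz aF]]] := qs_frame QS (tpr z).
  have aJ := frame_basis aF Wz; have Hq := tangent_nonzero QS (tpr z).
  have QN u := proj1 (Theta_conn_Theta QS aF Wz u ss).
  apply: (Q_ext QS aF Wz (QN _) (Q_lincomb2 a aJ (QN v) (QN w))) => i.
  rewrite (qdot_lin Hq _ aJ (QN v) (QN w) (basis_Q i aJ)) !(Theta_conn_comp QS aF Wz _ ss i) !sum3.
  rewrite !(pconn_lin QS aF Wz v w a _ ss).
  by abstract_terms @pconn_comp; abstract_terms @tw_coef; ring.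
- move=> z s t ts tt v.
  have := Theta_conn_lin v (smooth_fun_cst 1) ts (proj2 tt).
  rewrite (_ : (fun y : Z => 1 *: s y + t y) = fun y => s y + t y); last first.
    by apply/functional_extensionality_dep => y; rewrite scale1r.
  by rewrite (dird_cst AZs) scale0r scale1r add0r.
- move=> z f s sf ts v.
  have := Theta_conn_lin v sf ts (smooth_pullbackQ0 z).
  rewrite (_ : (fun y : Z => f y *: s y + 0) = fun y => f y *: s y); last first.
    by apply/functional_extensionality_dep => y; rewrite addr0.
  by rewrite Theta_conn0 addr0.
- move=> z s t [_ ss] [_ st] nst v; have [W [F [Wz aF]]] := qs_frame QS (tpr z).
  have QNs := proj1 (Theta_conn_Theta QS aF Wz v ss).
  have QNt := proj1 (Theta_conn_Theta QS aF Wz v st).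
  apply: (Q_ext QS aF Wz QNs QNt) => i.
  rewrite (Theta_conn_comp QS aF Wz v ss i) (Theta_conn_comp QS aF Wz v st i) !sum3.
  by rewrite !(pconn_eq QS aF Wz v _ ss nst).
- move=> z U s sU [nT ss].
  exact: (smooth_Theta_conn sU ss (smooth_pullbackQ_near ss)).
Qed.

Lemma smooth_Theta_J s z : smooth_Theta s z -> smooth_Theta (fun z' => tJ (t := z') \o s z') z.
Proof.
move=> [nT ss]; have [W [F [Wz aF]]] := qs_frame QS (tpr z).
have nJ : near_pt AZ z (fun z' => Theta (tJ (t := z') \o s z' : endo_at z')).
  by apply: near_ptS nT _ => z'; exact: (Theta_J QS).
split => //; apply: (smooth_pullbackQ_frame QS aF Wz); first by apply: near_ptS nJ _ => z' [].
move=> i; have sa j := smooth_tw_coef QS j aF Wz; have sf j := smooth_comp j aF Wz ss.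
have sx : smooth_fun AZ (fun z' => cross (fun j => tw_coef F j z') (fun j => sec_coef F j s z') i) z.
  by move: i; apply: ord3P; rewrite /cross /=; apply: smooth_funB; apply: smooth_funM.
apply: (smooth_fun_eq _ sx).
apply: near_ptS2 nT (near_pt_tpr QS (near_frame QS aF Wz)) _ => z' tz' Wz'.
by rewrite /sec_coef (Theta_J_comp QS i aF Wz' tz').
Qed.

(** On Theta, composition with J is the cross product with tau. Its derivative has the extra term
    D_v tau x s, the product of two vectors orthogonal to tau, hence a multiple of tau, which the
    projection kills. The computation checks this in an adapted frame. *)
Lemma Theta_conn_J z (v : TZ z) s : smooth_Theta s z ->
  N z v (fun z' => tJ (t := z') \o s z') = tJ (t := z) \o N z v s.
Proof.
move=> ts; have [nT ss] := ts; have [nJ sJ] := smooth_Theta_J ts.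
have [W [F [Wz aF Fz]]] := adapted_frame QS z.
have tN := Theta_conn_Theta QS aF Wz v ss.
have tNJ := Theta_conn_Theta QS aF Wz v sJ.
apply: (Q_ext QS aF Wz (proj1 tNJ) (proj1 (Theta_J QS tN))) => i.
rewrite (Theta_conn_comp QS aF Wz v sJ i) (Theta_J_comp QS i aF Wz tN).
have a j := adapted_coef QS j aF Wz Fz.
have sa j := smooth_tw_coef QS j aF Wz; have sf j := smooth_comp j aF Wz ss.
have f0 : sec_coef F ord0 s z = 0.
  have := Theta_comp QS aF Wz (Theta_at ts); rewrite sum3 !a -!/(sec_coef F _ s z) /=.
  by rewrite mulr1 !mulr0 !addr0.
have va0 : dird v (tw_coef F ord0) = 0 by exact: (dird_adapted QS v aF Wz Fz).
have nx j : near_pt AZ z (fun z' => sec_coef F j (fun z' => tJ (t := z') \o s z') z' =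
    cross (fun j => tw_coef F j z') (fun j => sec_coef F j s z') j).
  apply: near_ptS2 nT (near_pt_tpr QS (near_frame QS aF Wz)) _ => z' tz' Wz'.
  by rewrite /sec_coef (Theta_J_comp QS j aF Wz' tz').
have dx j : dird v (sec_coef F j (fun z' => tJ (t := z') \o s z')) =
    dird v (fun z' => cross (fun j => tw_coef F j z') (fun j => sec_coef F j s z') j).
  by apply: (dird_eq AZs v (nx j)); exact: (smooth_comp j aF Wz sJ).
have cz j := near_pt_self AZs (nx j).
have dm j k : dird v (fun z' => tw_coef F j z' * sec_coef F k s z') =
  dird v (tw_coef F j) * sec_coef F k s z + tw_coef F j z * dird v (sec_coef F k s).
  exact: (dirdM AZs v (sa j) (sf k)).
have dc j k j' k' : dird v (fun z' => tw_coef F j z' * sec_coef F k s z' - tw_coef F j' z' * sec_coef F k' s z') =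
  dird v (tw_coef F j) * sec_coef F k s z + tw_coef F j z * dird v (sec_coef F k s) -
  (dird v (tw_coef F j') * sec_coef F k' s z + tw_coef F j' z * dird v (sec_coef F k' s)).
  by rewrite (dirdB AZs v (smooth_funM (sa j) (sf k)) (smooth_funM (sa j') (sf k'))) !dm.
have oa := conn_form_anti QS aF (pi_push v) ord_max 1 Wz.
have od j := conn_form_diag QS (pi_push v) j aF Wz.
move: i; apply: ord3P; rewrite /cross /= !(Theta_conn_comp QS aF Wz v ss) !sum3 /pconn_comp !sum3 !dx !cz.
- rewrite /cross /= !a /=; abstract_terms @dird; abstract_terms @conn_form; abstract_terms @sec_coef.
  by ring.
- rewrite /cross /= !dc va0 !a f0 oa !od /=.
  by abstract_terms @dird; abstract_terms @conn_form; abstract_terms @sec_coef; ring.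
- rewrite /cross /= !dc va0 !a f0 oa !od /=.
  by abstract_terms @dird; abstract_terms @conn_form; abstract_terms @sec_coef; ring.
Qed.

Lemma Theta_conn_metric z (v : TZ z) s t : smooth_Theta s z -> smooth_Theta t z ->
  smooth_fun AZ (fun z' => qdot Q (s z') (t z')) z /\
  dird v (fun z' => qdot Q (s z') (t z')) = qdot Q (N z v s) (t z) + qdot Q (s z) (N z v t).
Proof.
move=> ts tt; have [nTs ss] := ts; have [nTt st] := tt.
have [W [F [Wz aF]]] := qs_frame QS (tpr z).
have aJ := frame_basis aF Wz; have Hq := tangent_nonzero QS (tpr z).
have sf j := smooth_comp j aF Wz ss; have sg j := smooth_comp j aF Wz st.
have nd : near_pt AZ z (fun z' => \sum_i sec_coef F i s z' * sec_coef F i t z' = qdot Q (s z') (t z')).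
  apply: near_ptS3 nTs nTt (near_pt_tpr QS (near_frame QS aF Wz)) _ => z' [Qs _] [Qt _] Wz'.
  by apply: esym; exact: (qdot_dot (tangent_nonzero QS _) (frame_basis aF Wz') Qs Qt).
have sd := smooth_fun_dot sf sg; split; first exact: (smooth_fun_eq nd sd).
rewrite -(dird_eq AZs v nd sd) (pconn_metric QS aF Wz v ss st).
have QNs := proj1 (Theta_conn_Theta QS aF Wz v ss).
have QNt := proj1 (Theta_conn_Theta QS aF Wz v st).
have Qs := pullback_at QS ss; have Qt := pullback_at QS st.
rewrite (qdot_dot Hq aJ QNs Qt) (qdot_dot Hq aJ Qs QNt) /dot3 !sum3.
rewrite !(Theta_conn_comp QS aF Wz v ss) !(Theta_conn_comp QS aF Wz v st) !sum3.
have := Theta_comp QS aF Wz (Theta_at ts); have := Theta_comp QS aF Wz (Theta_at tt).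
rewrite !sum3 -!/(sec_coef F _ _ z).
move: (sec_coef F ord0 s z) (sec_coef F 1 s z) (sec_coef F ord_max s z).
move: (sec_coef F ord0 t z) (sec_coef F 1 t z) (sec_coef F ord_max t z).
move: (tw_coef F ord0 z) (tw_coef F 1 z) (tw_coef F ord_max z).
move: (pconn_comp D F v s ord0) (pconn_comp D F v s 1) (pconn_comp D F v s ord_max).
move: (pconn_comp D F v t ord0) (pconn_comp D F v t 1) (pconn_comp D F v t ord_max).
move=> e0 e1 e2 d0 d1 d2 a0 a1 a2 g0 g1 g2 f0 f1 f2 hg hf.
apply/eqP; rewrite -subr_eq0; apply/eqP.
transitivity ((d0 * a0 + d1 * a1 + d2 * a2) * (g0 * a0 + g1 * a1 + g2 * a2) +
  (e0 * a0 + e1 * a1 + e2 * a2) * (f0 * a0 + f1 * a1 + f2 * a2)); first by ring.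
by rewrite hg hf !mulr0 addr0.
Qed.

(** The real part of the hermitian condition is compatibility with the metric; the imaginary part is
    the same statement for J s in place of s, combined with complex linearity. *)
Lemma Theta_conn_hermitian : hermitian_connection N.
Proof.
split; first exact: Theta_conn_connection.
  by move=> z s ts v; exact: Theta_conn_J.
move=> z s t ts tt v; have [sd dd] := Theta_conn_metric v ts tt.
have [sdJ ddJ] := Theta_conn_metric v (smooth_Theta_J ts) tt.
have half g : smooth_fun AZ g z -> dird v (fun z' => g z' / 2) = dird v g / 2.
  by move=> sg; rewrite (dirdM AZs v sg (smooth_fun_cst 2^-1)) (dird_cst AZs) mulr0 addr0.
have -> : dird v (fun z' => complex.Re (Theta_h (s z') (t z'))) = dird v (fun z' => qdot Q (s z') (t z')) / 2.
  exact: half.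
have -> : dird v (fun z' => complex.Im (Theta_h (s z') (t z'))) =
    - (dird v (fun z' => qdot Q (tJ (t := z') \o s z') (t z')) / 2).
  rewrite -(half _ sdJ) -(dirdN AZs v)//; apply: smooth_funM => //; exact: smooth_fun_cst.
rewrite dd ddJ (Theta_conn_J v ts) /Theta_h.
apply/eqP; rewrite eq_complex /=; apply/andP; split; apply/eqP; first by rewrite mulrDl.
by rewrite mulrDl opprD.
Qed.

End HermitianConnection.

(** * The curvature of the induced connection in a frame *)

Section ThetaCurvature.
Variables (R : realType) (M : topologicalType) (m : nat) (A : set (chart R M m)).
Variable Q : forall p : M, set (tangent A p -> tangent A p).
Variable D : affine_connection A.
Hypothesis QS : quaternionic_setting Q D.
Let As := qs_atlas QS.
Let AZs := twistor_smooth_atlas QS.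
Implicit Types (p q : M) (z : twistor Q).
Local Notation endo := (forall q, tangent A q -> tangent A q).
Local Notation Z := (twistor Q).
Local Notation AZ := (@twistor_atlas R M m A Q).
Local Notation psec := (pullback_section Q).
Local Notation vp := (vpart D).
Local Notation om := (conn_form Q D).
Local Notation N := (Theta_conn Q D).
Implicit Types (s t : psec).

Section OneFrame.
Variables (W : set M) (F : 'I_3 -> endo) (c : chart R M m) (z : Z).
Arguments F : clear implicits.
Hypotheses (aF : admissible_frame Q W F) (Wz : W (tpr z)) (pc : chart_at A (tpr z) c).
Let aJ := frame_basis aF Wz.
Let Hq := tangent_nonzero QS (tpr z).
Let nW : near_pt AZ z (fun z' => W (tpr z')) := near_pt_tpr QS (near_frame QS aF Wz).
Let nC : near_pt AZ z (fun z' => chart_at A (tpr z') c) := near_pt_tpr QS (near_pt_chart As pc).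
Local Notation cf x := (cfield As c (coords x c)).

Section TwoFields.
Variables (U V : vfield AZ).
Hypotheses (sU : smooth_vfield AZ U z) (sV : smooth_vfield AZ V z).

Let smooth_om i j (X : vfield AZ) : smooth_vfield AZ X z ->
  smooth_fun AZ (fun z' => om F i j (pi_push (X z'))) z.
Proof.
move=> sX; apply: (@smooth_conn_form_push _ _ _ _ _ _ QS W F c z aF Wz pc (fun z' => pi_push (X z'))) => l.
exact: (smooth_push_coord QS aF Wz pc l sX).
Qed.

Lemma dird_conn_form_push (X Y : vfield AZ) i j : smooth_vfield AZ X z -> smooth_vfield AZ Y z ->
  dird (X z) (fun z' => om F i j (pi_push (Y z'))) =
  \sum_l (dird (X z) (fun z' => dird (Y z') (fun y => c (tpr y) 0 l)) * om F i j (coord_field As c l (tpr z))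
    + (pi_push (Y z)) c 0 l * dird (pi_push (X z)) (fun q => om F i j (coord_field As c l q))).
Proof.
move=> sX sY; pose g l q := om F i j (coord_field As c l q).
have sg l : smooth_fun A (g l) (tpr z).
  by apply: (conn_form_smooth QS aF _ _ Wz); exact: smooth_coord_field.
have sgZ l : smooth_fun AZ (fun z' => g l (tpr z')) z by exact: (smooth_fun_tpr QS (sg l)).
have sc l : smooth_fun AZ (fun z' => dird (Y z') (fun y => c (tpr y) 0 l)) z.
  by apply: (smooth_dird AZs sY); exact: (smooth_fun_tpr QS (smooth_fun_coord As l pc)).
have E : dird (X z) (fun z' => om F i j (pi_push (Y z'))) =
    dird (X z) (fun z' => \sum_l dird (Y z') (fun y => c (tpr y) 0 l) * g l (tpr z')).
  apply: esym; apply: (dird_eq AZs (X z)); last exact: smooth_fun_dot.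
  apply: near_ptS2 nW nC _ => z' Wz' pc'.
  rewrite (conn_form_expand QS aF _ i j Wz' pc'); apply: eq_bigr => l _.
  by rewrite (pi_push_coord QS _ _ pc').
rewrite E (dird_dot AZs (X z) sc sgZ); apply: eq_bigr => l _.
by rewrite (pi_push_dird QS (X z) (sg l)) (pi_push_coord QS (Y z) l pc).
Qed.

Lemma dird_conn_form_cfield (x y : tangent A (tpr z)) i j :
  dird x (fun q => om F i j (cf y q)) =
  \sum_l y c 0 l * dird x (fun q => om F i j (coord_field As c l q)).
Proof.
pose g l q := om F i j (coord_field As c l q).
have sg l : smooth_fun A (g l) (tpr z).
  by apply: (conn_form_smooth QS aF _ _ Wz); exact: smooth_coord_field.
have sc l : smooth_fun A (fun q : M => y c 0 l) (tpr z) by exact: smooth_fun_cst.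
have E : dird x (fun q => om F i j (cf y q)) = dird x (fun q => \sum_l y c 0 l * g l q).
  apply: esym; apply: (dird_eq As x); last exact: smooth_fun_dot.
  apply: near_ptS2 (near_frame QS aF Wz) (near_pt_chart As pc) _ => q Wq qc.
  by rewrite (conn_form_expand QS aF _ i j Wq qc) (cfieldE As _ qc).
rewrite E (dird_dot As x sc sg); apply: eq_bigr => l _.
by rewrite (dird_cst As) mul0r add0r.
Qed.

(** Naturality of the curvature form under pullback to Z. The fields on Z need not project to fields
    on M, so it is verified on components along the coordinate fields of the base. *)
Lemma curv_form_push i j :
  dird (U z) (fun z' => om F i j (pi_push (V z'))) - dird (V z) (fun z' => om F i j (pi_push (U z')))
  - om F i j (pi_push (lie_bracket AZ U V z))
  + \sum_l (om F i l (pi_push (U z)) * om F l j (pi_push (V z))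
          - om F i l (pi_push (V z)) * om F l j (pi_push (U z))) =
  curv_form QS F c i j (pi_push (U z)) (pi_push (V z)).
Proof.
rewrite /curv_form !dird_conn_form_cfield !dird_conn_form_push//; congr (_ + _).
rewrite (conn_form_expand QS aF _ i j Wz pc).
rewrite -!sumrB; apply: eq_bigr => l _.
rewrite (pi_push_coord QS (lie_bracket AZ U V z) l pc).
rewrite (lie_bracketP AZs sU sV (smooth_fun_tpr QS (smooth_fun_coord As l pc))).
rewrite -/As; abstract_terms @dird; abstract_terms @conn_form; abstract_terms @fun_of_matrix; ring.
Qed.

Variable s : psec.
Arguments s : clear implicits.
Hypothesis ts : smooth_Theta s z.
Let ss : smooth_pullbackQ s z := proj2 ts.
Local Notation vpc i X := (qdot Q (F i (tpr z)) (vp X)).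

(* Where the frame is orthogonal to the tautological section, projecting to Theta
   adds to the connection of Q only the second fundamental form term. *)
Lemma Theta_conn2_comp (X Y : vfield AZ) i : smooth_vfield AZ X z -> smooth_vfield AZ Y z ->
  tw_coef F i z = 0 ->
  qdot Q (F i (tpr z)) (N z (X z) (fun z' => N z' (Y z') s)) =
  dird (X z) (fun z' => dird (Y z') (sec_coef F i s))
  + \sum_j (dird (X z) (fun z' => om F i j (pi_push (Y z'))) * sec_coef F j s z
            + om F i j (pi_push (Y z)) * dird (X z) (sec_coef F j s)
            + om F i j (pi_push (X z)) * dird (Y z) (sec_coef F j s))
  + \sum_j om F i j (pi_push (X z)) * \sum_k om F j k (pi_push (Y z)) * sec_coef F k s z
  + (\sum_j sec_coef F j s z * vpc j (Y z)) * vpc i (X z).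
Proof.
move=> sX sY ai.
have sa j := smooth_tw_coef QS j aF Wz; have sf j := smooth_comp j aF Wz ss.
have tN : smooth_Theta (fun z' => N z' (Y z') s) z.
  exact: (smooth_Theta_conn QS sY ss (smooth_pullbackQ_near QS ss)).
have sd j := smooth_pconn QS aF Wz j sY ss.
pose q z' := \sum_j pconn_comp D F (Y z') s j * tw_coef F j z'.
have sq : smooth_fun AZ q z by exact: smooth_fun_dot.
have qz : q z = - \sum_j sec_coef F j s z * vpc j (Y z) by exact: (pconn_orth QS aF Wz (Y z) ts).
have nN j : near_pt AZ z (fun z' => sec_coef F j (fun z' => N z' (Y z') s) z' =
    pconn_comp D F (Y z') s j - q z' * tw_coef F j z').
  apply: near_ptS2 (smooth_pullbackQ_near QS ss) nW _ => z' ss' Wz'.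
  by rewrite /sec_coef (Theta_conn_comp QS aF Wz' (Y z') ss' j).
have Nz j := near_pt_self AZs (nN j).
have so j : smooth_fun AZ (fun z' => om F i j (pi_push (Y z'))) z by exact: smooth_om.
have dN : dird (X z) (sec_coef F i (fun z' => N z' (Y z') s)) =
    dird (X z) (fun z' => dird (Y z') (sec_coef F i s))
    + \sum_j (dird (X z) (fun z' => om F i j (pi_push (Y z'))) * sec_coef F j s z
            + om F i j (pi_push (Y z)) * dird (X z) (sec_coef F j s))
    - q z * dird (X z) (tw_coef F i).
  rewrite (dird_eq AZs (X z) (nN i) (smooth_comp i aF Wz (proj2 tN))).
  have e1 : dird (X z) (fun z' => q z' * tw_coef F i z') = q z * dird (X z) (tw_coef F i).
    by apply: etrans (dirdM AZs (X z) sq (sa i)) _; rewrite ai mulr0 add0r.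
  have e2 := etrans (dirdD AZs (X z) (smooth_dird AZs sY (sf i)) (smooth_fun_dot so sf))
    (f_equal2 +%R (erefl _) (dird_dot AZs (X z) so sf)).
  exact: (etrans (dirdB AZs (X z) (sd i) (smooth_funM sq (sa i)))
    (f_equal2 (fun a b => a - b) e2 e1)).
rewrite (Theta_conn_comp QS aF Wz (X z) (proj2 tN) i) ai mulr0 subr0 /pconn_comp dN.
have -> : vpc i (X z) = dird (X z) (tw_coef F i) + \sum_j om F i j (pi_push (X z)) * tw_coef F j z.
  exact: (vpart_comp QS (X z) i aF Wz).
have -> : \sum_j sec_coef F j s z * vpc j (Y z) = - q z by rewrite qz opprK.
rewrite !sum3 !Nz /pconn_comp !sum3.
move: (q z) => r.
abstract_terms @dird; abstract_terms @conn_form; abstract_terms @tw_coef; abstract_terms @sec_coef; ring.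
Qed.

(** A Gauss equation: Theta is a subbundle of the pullback of Q, and its curvature is the projected
    curvature of Q plus a quadratic term in the second fundamental form D tau. *)
Lemma Theta_curvature_comp i : tw_coef F i z = 0 ->
  qdot Q (F i (tpr z)) (curvature (E := @endo_at R M m A Q) N U V s z) =
  \sum_j sec_coef F j s z * (vpc j (V z) * vpc i (U z) - vpc j (U z) * vpc i (V z))
  + \sum_j curv_form QS F c i j (pi_push (U z)) (pi_push (V z)) * sec_coef F j s z.
Proof.
move=> ai.
have QN X Y (sX : smooth_vfield AZ X z) (sY : smooth_vfield AZ Y z) : Q (N z (X z) (fun z' => N z' (Y z') s)).
  have tN := smooth_Theta_conn QS sY ss (smooth_pullbackQ_near QS ss).
  exact: (proj1 (Theta_conn_Theta QS aF Wz (X z) (proj2 tN))).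
have QB := proj1 (Theta_conn_Theta QS aF Wz (lie_bracket AZ U V z) ss).
have QNN (B C : endo_at z) : Q B -> Q C -> Q (B - C) /\
    qdot Q (F i (tpr z)) (B - C) = qdot Q (F i (tpr z)) B - qdot Q (F i (tpr z)) C.
  move=> hB hC; rewrite -scaleN1r addrC; split; first exact: (Q_lincomb2 _ aJ).
  by rewrite (qdot_lin Hq _ aJ hC hB (basis_Q i aJ)) mulN1r addrC.
have [Q1 E1] := QNN _ _ (QN U V sU sV) (QN V U sV sU).
have [Q2 E2] := QNN _ _ Q1 QB.
rewrite /curvature E2 E1 (Theta_conn2_comp sU sV ai) (Theta_conn2_comp sV sU ai).
rewrite (Theta_conn_comp QS aF Wz _ ss i) ai mulr0 subr0 /pconn_comp.
rewrite (lie_bracketP AZs sU sV (smooth_comp i aF Wz ss)).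
under [X in _ = _ + X]eq_bigr do rewrite -curv_form_push.
rewrite !sum3.
abstract_terms @dird; abstract_terms @conn_form; abstract_terms @sec_coef; abstract_terms @qdot; ring.
Qed.

End TwoFields.
End OneFrame.
End ThetaCurvature.

(** * The Chern condition in adapted frames *)

Section Chern.
Variables (R : realType) (M : topologicalType) (m : nat) (A : set (chart R M m)).
Variable Q : forall p : M, set (tangent A p -> tangent A p).
Variable D : affine_connection A.
Hypothesis QS : quaternionic_setting Q D.
Let As := qs_atlas QS.
Let AZs := twistor_smooth_atlas QS.
Implicit Types (p q : M) (z : twistor Q).
Local Notation endo := (forall q, tangent A q -> tangent A q).
Local Notation Z := (twistor Q).
Local Notation AZ := (@twistor_atlas R M m A Q).
Local Notation TZ := (tangent AZ).
Local Notation psec := (pullback_section Q).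
Local Notation vp := (vpart D).
Local Notation N := (Theta_conn Q D).
Local Notation curvN := (curvature (E := @endo_at R M m A Q) N).
Implicit Types (s t : psec).

Lemma curvature_Theta z (U V : vfield AZ) s : smooth_vfield AZ U z -> smooth_vfield AZ V z ->
  smooth_Theta s z -> Theta (curvN U V s z).
Proof.
move=> sU sV ts; have [W [F [Wz aF]]] := qs_frame QS (tpr z).
have ns := smooth_pullbackQ_near QS (proj2 ts).
have T (v : TZ z) t : smooth_pullbackQ t z -> Theta (N z v t) := @Theta_conn_Theta _ _ _ _ _ _ QS W F aF z Wz v t.
have T1 := T (U z) _ (proj2 (smooth_Theta_conn QS sV (proj2 ts) ns)).
have T2 := T (V z) _ (proj2 (smooth_Theta_conn QS sU (proj2 ts) ns)).
have T3 := T (lie_bracket AZ U V z) s (proj2 ts).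
have TB (B C : endo_at z) : Theta B -> Theta C -> Theta (B - C).
  by move=> tB tC; rewrite -scaleN1r addrC; exact: (Theta_lin QS).
exact: (TB _ _ (TB _ _ T1 T2) T3).
Qed.

Section Adapted.
Variables (W : set M) (F : 'I_3 -> endo) (c : chart R M m) (z : Z).
Arguments F : clear implicits.
Hypotheses (aF : admissible_frame Q W F) (Wz : W (tpr z)) (pc : chart_at A (tpr z) c).
Hypothesis Fz : F ord0 (tpr z) = tJ (t := z).
Local Notation k := (curv_form QS F c).
Local Notation vpc i X := (qdot Q (F i (tpr z)) (vp X)).

Let a j : tw_coef F j z = (j == ord0)%:R := adapted_coef QS j aF Wz Fz.

Lemma adapted_Theta0 (B : endo_at z) : Theta B -> qdot Q (F ord0 (tpr z)) B = 0.
Proof. by rewrite Fz; exact: (Theta_orth QS). Qed.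

(* In the adapted frame the only entry of the curvature is the component k_32 of
   the curvature of Q, plus the area form of the fibre. *)
Lemma curvN_adapted (U V : vfield AZ) s : smooth_vfield AZ U z -> smooth_vfield AZ V z ->
  smooth_Theta s z ->
  (qdot Q (F 1 (tpr z)) (curvN U V s z) =
    - (vpc 1 (V z) * vpc ord_max (U z) - vpc 1 (U z) * vpc ord_max (V z)
      + k ord_max 1 (pi_push (U z)) (pi_push (V z))) * sec_coef F ord_max s z) *
  (qdot Q (F ord_max (tpr z)) (curvN U V s z) =
    (vpc 1 (V z) * vpc ord_max (U z) - vpc 1 (U z) * vpc ord_max (V z)
      + k ord_max 1 (pi_push (U z)) (pi_push (V z))) * sec_coef F 1 s z).
Proof.
move=> sU sV ts; have f0 : sec_coef F ord0 s z = 0 by exact: (adapted_Theta0 (Theta_at QS ts)).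
have kd i (x y : tangent A (tpr z)) : k i i x y = 0.
  have := curv_form_anti QS aF pc Wz x y i i; move: (curv_form QS F c i i x y) => r; lra.
have ka (x y : tangent A (tpr z)) := curv_form_anti QS aF pc Wz x y 1 ord_max.
split; rewrite (Theta_curvature_comp QS aF Wz pc sU sV ts); last first.
- by rewrite a.
- rewrite !sum3 f0 kd; abstract_terms @curv_form; abstract_terms @sec_coef; abstract_terms @qdot; ring.
- by rewrite a.
- rewrite !sum3 f0 kd ka; abstract_terms @curv_form; abstract_terms @sec_coef; abstract_terms @qdot; ring.
Qed.

Lemma vpart_J_adapted (v : TZ z) :
  (vpc 1 (twistor_J Q D z v) = - vpc ord_max v) * (vpc ord_max (twistor_J Q D z v) = vpc 1 v).
Proof.
have tv := vpart_Theta QS v; rewrite (proj2 (twistor_JP QS v)).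
split; rewrite (Theta_J_comp QS _ aF Wz tv) /cross /= !a /=.
  by rewrite mul0r mul1r sub0r.
by rewrite mul0r mul1r subr0.
Qed.

(** The section is the projection of F_1 to the orthogonal complement of tau; being nonzero at [z],
    it allows k_21 to be read off from the curvature. *)
Lemma theta_frame_section : exists s, smooth_Theta s z /\ sec_coef F 1 s z = 1.
Proof.
pose s : psec := fun z' => (- tw_coef F 1 z') *: (tJ (t := z') : endo_at z') + (F 1 (tpr z') : endo_at z').
have sa j := smooth_tw_coef QS j aF Wz.
have sF1 : smooth_pullbackQ (fun z' => F 1 (tpr z') : endo_at z') z.
  split.
    by apply: near_ptS (near_pt_tpr QS (near_frame QS aF Wz)) _ => z' Wz'; exact: (basis_Q 1 (frame_basis aF Wz')).
  move=> W' F' W'z aF' i.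
  apply: (smooth_fun_tpr QS (f := fun q => qdot Q (F' i q) (F 1 q))).
  by apply: (smooth_qdot QS); [exact: (frame_Qsec QS _ aF' W'z)|exact: (frame_Qsec QS _ aF Wz)].
have ss : smooth_pullbackQ s z.
  exact: (smooth_pullbackQ_lin QS (smooth_funN (sa 1)) (smooth_tauto QS z) sF1).
have e z' (Wz' : W (tpr z')) : Q (s z') /\ forall i, qdot Q (F i (tpr z')) (s z') =
    - tw_coef F 1 z' * tw_coef F i z' + (i == 1)%:R.
  have aJ := frame_basis aF Wz'; have Hq := tangent_nonzero QS (tpr z').
  have QJ := twistor_Q z'; have QF1 := basis_Q 1 aJ.
  split; first exact: (Q_lincomb2 _ aJ).
  by move=> i; rewrite (qdot_lin Hq _ aJ QJ QF1 (basis_Q i aJ)) (qdot_basisE Hq i 1 aJ).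
exists s; split; last by have [_ E] := e z Wz; rewrite /sec_coef E !a /= mulr0 add0r.
split => //; apply: near_ptS (near_pt_tpr QS (near_frame QS aF Wz)) _ => z' Wz'.
have [Qs E] := e z' Wz'; split => //.
have aJ := frame_basis aF Wz'; have Hq := tangent_nonzero QS (tpr z').
rewrite (qdot_dot Hq aJ Qs (twistor_Q z')) /dot3 sum3 !E -!/(tw_coef F _ z') /=.
have := tw_coef_unit QS aF Wz'; rewrite /dot3 sum3.
move: (tw_coef F ord0 z') (tw_coef F 1 z') (tw_coef F ord_max z') => a0 a1 a2 h.
transitivity (a1 * (1 - (a0 * a0 + a1 * a1 + a2 * a2))); first by ring.
by rewrite h subrr mulr0.
Qed.

End Adapted.

(** The area form of the fibre is invariant under the complex structure, so only the component of
    the curvature of Q is constrained; since the latter depends only on projections, horizontal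
    vectors suffice to test it. *)
Lemma chern_connectionP : chern_connection Q (twistor_J Q D) N <->
  forall W (F : 'I_3 -> endo) c z, admissible_frame Q W F -> W (tpr z) -> chart_at A (tpr z) c ->
  F ord0 (tpr z) = tJ (t := z) -> forall x y,
  curv_form QS F c ord_max 1 (tJ (t := z) x) (tJ (t := z) y) = curv_form QS F c ord_max 1 x y.
Proof.
split=> [[_ H] W F c z aF Wz pc Fz x y|H].
  have t0 : Theta (0 : endo_at z).
    have aJ := frame_basis aF Wz; have Q0' := Q0 aJ; split => //.
    have Hq := tangent_nonzero QS (tpr z).
    rewrite (qdotC Hq aJ Q0' (twistor_Q z)).
    by have := qdotZ Hq 0 aJ Q0' (twistor_Q z); rewrite scale0r mul0r.
  (* Lifts with zero vertical part remove the fibre term from the curvature, leaving k_21 at x and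
     y. *)
  have [u [ux u0]] := twistor_split QS x t0; have [v [vy v0]] := twistor_split QS y t0.
  have [sU Uz] := extensionP AZs u; have [sV Vz] := extensionP AZs v.
  have [s [ts s1]] := theta_frame_section aF Wz Fz.
  have E1 := snd (curvN_adapted aF Wz pc Fz (smooth_twistor_J QS sU) (smooth_twistor_J QS sV) ts).
  have E2 := snd (curvN_adapted aF Wz pc Fz sU sV ts).
  have := etrans (esym E1) (etrans (congr1 (fun B => qdot Q (F ord_max (tpr z)) B) (H z _ _ s sU sV ts)) E2).
  have Ju := vpart_J_adapted aF Wz Fz (extension u z); have Jv := vpart_J_adapted aF Wz Fz (extension v z).
  rewrite (fst Ju) (snd Ju) (fst Jv) (snd Jv) s1 !mulr1.
  rewrite (proj1 (twistor_JP QS (extension u z))) (proj1 (twistor_JP QS (extension v z))) Uz Vz ux vy u0 v0.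
  by abstract_terms @curv_form; abstract_terms @qdot; lra.
split; first exact: (Theta_conn_hermitian QS).
move=> z U V s sU sV ts; have [W [F [Wz aF Fz]]] := adapted_frame QS z.
have [c pc] := atlas_cover As (tpr z).
have sJU := smooth_twistor_J QS sU; have sJV := smooth_twistor_J QS sV.
have T1 := curvature_Theta sJU sJV ts; have T2 := curvature_Theta sU sV ts.
have JU := vpart_J_adapted aF Wz Fz (U z); have JV := vpart_J_adapted aF Wz Fz (V z).
have HK : curv_form QS F c ord_max 1 (pi_push (twistor_J Q D z (U z))) (pi_push (twistor_J Q D z (V z))) =
    curv_form QS F c ord_max 1 (pi_push (U z)) (pi_push (V z)).
  by rewrite (proj1 (twistor_JP QS (U z))) (proj1 (twistor_JP QS (V z))); exact: (H W F c z aF Wz pc Fz).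
apply: (Q_ext QS aF Wz (proj1 T1) (proj1 T2)); apply: ord3P.
- exact: etrans (adapted_Theta0 Fz T1) (esym (adapted_Theta0 Fz T2)).
- apply: etrans (fst (curvN_adapted aF Wz pc Fz sJU sJV ts)) _.
  apply: etrans (esym (fst (curvN_adapted aF Wz pc Fz sU sV ts))).
  (* J rotates the two vertical components by a right angle, so the 2 by 2 determinant formed by
     those of U and V is unchanged. *)
  rewrite (fst JU) (snd JU) (fst JV) (snd JV) HK.
  by abstract_terms @curv_form; abstract_terms @sec_coef; abstract_terms @qdot; ring.
- apply: etrans (snd (curvN_adapted aF Wz pc Fz sJU sJV ts)) _.
  apply: etrans (esym (snd (curvN_adapted aF Wz pc Fz sU sV ts))).
  rewrite (fst JU) (snd JU) (fst JV) (snd JV) HK.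
  by abstract_terms @curv_form; abstract_terms @sec_coef; abstract_terms @qdot; ring.
Qed.

End Chern.

(** * The Chern condition and self-duality *)

Section ManifoldAtlas.
Variables (R : realType) (M : topologicalType) (m : nat) (A : set (chart R M m)).
Hypothesis MA : smooth_manifold A.

Lemma manifold_near_image c p (W : set M) : chart_at A p c -> open W -> W p ->
  \forall u \near c p, exists y, [/\ cdom c y, W y & c y = u].
Proof.
move=> [Ac cp] oW Wp; have [_ _ Hc _] := MA; have [oc _ _ oim] := Hc c Ac.
have oI : open (c @` (cdom c `&` W)) by apply: oim; [exact: openI|move=> y []].
have : nbhs (c p) (c @` (cdom c `&` W)) by apply: open_nbhs_nbhs; split => //; exists p.
by apply: filterS => u [y [cy Wy] <-]; exists y.
Qed.

Lemma manifold_chart_inj c x y : A c -> cdom c x -> cdom c y -> c x = c y -> x = y.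
Proof.
move=> Ac cx cy; have [_ _ Hc _] := MA; have [_ ci _ _] := Hc c Ac.
by move: cx cy => /mem_set cx /mem_set cy; exact: ci.
Qed.

Lemma manifold_cinv c x y : A c -> cdom c y -> cinv c x (c y) = y.
Proof.
move=> Ac cy; apply: the_eq => // y' [cy' E].
exact: (manifold_chart_inj Ac).
Qed.

Lemma manifold_open_near (W : set M) p : open W -> W p -> near_pt A p W.
Proof.
move=> oW Wp c pc; have [Ac _] := pc.
by apply: filterS (manifold_near_image pc oW Wp) => u [y [cy Wy <-]]; rewrite manifold_cinv.
Qed.

Lemma manifold_smooth_atlas : smooth_atlas A.
Proof.
have [_ cover Hc smooth] := MA; split.
- by move=> c x y; exact: manifold_chart_inj.
- move=> c x xc; have := manifold_near_image xc openT I.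
  by apply: filterS => u [y [cy _ yu]]; exists y.
- by move=> x c c' xc [Ac' cx']; have [oc' _ _ _] := Hc c' Ac'; exact: (manifold_open_near oc' cx').
- by move=> x c c'; exact: smooth.
- exact: cover.
Qed.

End ManifoldAtlas.

Section SelfDual.
Variables (R : realType) (M : topologicalType) (m : nat) (A : set (chart R M m)).
Variable Q : forall p : M, set (tangent A p -> tangent A p).
Variable D : affine_connection A.
Hypothesis QS : quaternionic_setting Q D.
Hypothesis m4 : (4 < m)%N.
Let As := qs_atlas QS.
Implicit Types (z : twistor Q).
Local Notation endo := (forall q, tangent A q -> tangent A q).

Let CD : is_connection (E := fun p => tangent A p) (smooth_vfield A) D.
Proof. by have [] := qs_conn QS. Qed.

(** Read off from the linearity of the curvature of TM: by [curv_frame] both sides are coefficients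
    of the same element of Q_p, and coefficients in an admissible basis are unique. *)
Lemma curv_form_lin W (F : 'I_3 -> endo) c p : admissible_frame Q W F -> W p -> chart_at A p c ->
  forall i j (a : R) (x x' y : tangent A p),
  curv_form QS F c i j (a *: x + x') y = a * curv_form QS F c i j x y + curv_form QS F c i j x' y.
Proof.
move=> aF Wp pc i j a x x' y; have aJ := frame_basis aF Wp; have Hq := tangent_nonzero QS p.
have lF : linear (F j p) by exact: (Q_linear QS (basis_Q j aJ)).
pose kk x l := curv_form QS F c l j x y.
suff /(congr1 (fun f => f i)) : kk (a *: x + x') = fun l => a * kk x l + kk x' l by [].
apply: (lincomb_inj Hq aJ); apply/funext => z; rewrite /lincomb.
rewrite -(curv_frame QS aF pc Wp) !(curv_lin1 As CD pc) lF.
have E u := curv_frame QS aF pc Wp u y z j.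
rewrite [RHS](_ : _ = a *: (\sum_l kk x l *: F l p z) + \sum_l kk x' l *: F l p z); last first.
  by rewrite scaler_sumr -big_split /=; apply: eq_bigr => l _; rewrite scalerDl scalerA.
rewrite -!E.
rewrite -/As; generalize (curv D As c x y (F j p z)) (curv D As c x' y (F j p z)) => u v.
generalize (F j p (curv D As c x y z)) (F j p (curv D As c x' y z)) => w w'; tangent_ring.
Qed.

(** The Ricci computation applied to the curvature of D and an adapted frame. The curvature of
    top-degree forms is minus the trace, a sign that does not affect invariance. *)
Lemma adapted_self_dual W (F : 'I_3 -> endo) c z : admissible_frame Q W F -> W (tpr z) ->
  chart_at A (tpr z) c -> F ord0 (tpr z) = tJ (t := z) ->
  (forall x y, curv_form QS F c ord_max 1 (tJ (t := z) x) (tJ (t := z) y) = curv_form QS F c ord_max 1 x y) <->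
  (forall x y, topform_curv D (tJ (t := z) x) (tJ (t := z) y) = topform_curv D x y).
Proof.
move=> aF Wz pc Fz; have [qJ _] := frame_basis aF Wz.
have TF : torsion_free D by have [] := qs_conn QS.
have H := @curv_J_invariant R M m A As c (tpr z) pc (@curv R M m A D As c (tpr z)) (fun i => F i (tpr z))
  (fun i j x y => curv_form QS F c i j x y) m4 (curv_lin1 As CD pc) (curv_lin3 As CD pc) (fun x y w
    => curv_anti D As c x y w)
  (fun x y w => curv_bianchi As CD pc x y w TF) qJ (curv_frame QS aF pc Wz)
  (fun i j x y => curv_form_anti QS aF pc Wz x y i j) (curv_form_lin aF Wz pc)
  (fun i j x y => curv_form_antisym QS F c x y i j).
rewrite Fz in H; split=> [/H h x y|h].
  by rewrite !(topform_curvE As CD pc) h.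
apply/H => x y; have := h x y; rewrite !(topform_curvE As CD pc); exact: oppr_inj.
Qed.

Lemma chern_self_dual :
  chern_connection Q (twistor_J Q D) (Theta_conn Q D) <-> self_dual Q D.
Proof.
split=> [/(chern_connectionP QS) H p J QJ JJ|H].
  have [W0 [F0 [Wp aF0]]] := qs_frame QS p.
  have aJ := frame_basis aF0 Wp; have Hq := tangent_nonzero QS p.
  (* In Q_p the square of B is - |B|^2 Id, so J^2 = - Id says precisely that J is a point of the
     twistor space. *)
  have h1 : qdot Q J J = 1.
    apply: (scale_inj Hq) => y; have := qdot_sqr Hq y aJ QJ; rewrite JJ scaleNr => /oppr_inj <-.
    by rewrite scale1r.
  pose z := Twistor QJ h1.
  have [W [F [Wz aF Fz]]] := adapted_frame QS z; have [c pc] := atlas_cover As (tpr z).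
  exact: (proj1 (adapted_self_dual aF Wz pc Fz) (H W F c z aF Wz pc Fz)).
apply/(chern_connectionP QS) => W F c z aF Wz pc Fz.
apply: (proj2 (adapted_self_dual aF Wz pc Fz)) => x y.
apply: (H (tpr z) (tJ (t := z)) (twistor_Q z)) => w.
rewrite (qdot_sqr (tangent_nonzero QS _) w (frame_basis aF Wz) (twistor_Q z)) (twistor_unit z).
by rewrite scaleN1r.
Qed.

End SelfDual.

Theorem proposition1 (R : realType) (M : topologicalType) (n : nat)
    (A : set (chart R M (4 * n)))
    (Q : forall p : M, set (tangent A p -> tangent A p))
    (D : affine_connection A) :
  (2 <= n)%N ->
  smooth_manifold A ->
  connected [set: M] ->
  quaternionic_structure Q ->
  quaternionic_connection Q D ->
  chern_connection Q (twistor_J Q D) (Theta_conn Q D) <-> self_dual Q D.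
Proof.
move=> n2 MA _ [QF _] QC.
(* For n >= 2 the dimension is at least 8; in the Ricci computation this makes h - 2 = 2n - 2
   nonzero. *)
have m4 : (4 < 4 * n)%N by apply: (@leq_trans (4 * 2)) => //; rewrite leq_mul2l.
have QS : quaternionic_setting Q D.
  split => //; first exact: manifold_smooth_atlas.
    by move=> W p; exact: (manifold_open_near MA).
  exact: leq_trans m4.
exact: (chern_self_dual QS m4).
Qed.
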